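(* Let $m>0$, and let $X$, $A$, $(T(t))_{t\ge0}$ and $E_{z_0}$ be as defined in the context. Then: 1. $E_{z_0}(t)\to 0$ as $t\to\infty$ for every $z_0\in X$. 2. For every $z_0\in \operatorname{Ran}(i\sqrt{m}-A)\cap \operatorname{Ran}(-i\sqrt{m}-A)$ one has $E_{z_0}(t)=O(t^{-2})$ as $t\to\infty$. 3. The rate in 2 is optimal in the following sense: given any function $r:[0,\infty)\to(0,\infty)$ satisfying $r(t)=o(t^{-2})$ as $t\to\infty$, there exists $z_0\in \operatorname{Ran}(i\sqrt{m}-A)\cap \operatorname{Ran}(-i\sqrt{m}-A)$ such that $E_{z_0}(t)\neq O(r(t))$ as $t\to\infty$.
   Context: Fix a constant $m>0$. Let $X=H^1(\mathbb{R})\times L^2(\mathbb{R})$ (complex-valued functions), a complex Hilbert space with norm $$\|z\|_X^2=m\|u\|_{L^2(\mathbb{R})}^2+\|u'\|_{L^2(\mathbb{R})}^2+\|v\|_{L^2(\mathbb{R})}^2,\qquad z=(u,v)\in X.$$ Let $A:D(A)\subseteq X\to X$ be the linear operator $$A(u,v)=(v,\,(u+v)''-mu),\qquad D(A)=\{(u,v)\in H^1(\mathbb{R})\times H^1(\mathbb{R}): u+v\in H^2(\mathbb{R})\}.$$ The operator $A$ generates a contraction $C_0$-semigroup $(T(t))_{t\ge0}$ on $X$. The abstract Cauchy problem $\dot z(t)=Az(t)$, $z(0)=z_0=(u_0,v_0)\in X$, is the reformulation, with $z=(u,u_t)$, of the Klein--Gordon equation with Kelvin--Voigt damping $$u_{tt}-u_{xx}+mu-u_{txx}=0\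 \ (x\in\mathbb{R},\ t>0),\qquad u(\cdot,0)=u_0\in H^1(\mathbb{R}),\quad u_t(\cdot,0)=v_0\in L^2(\mathbb{R}).$$ The solution with initial data $z_0\in X$ is the (mild) solution $(u(\cdot,t),u_t(\cdot,t))=T(t)z_0$, and its energy is $$E_{z_0}(t)=\frac12\int_{\mathbb{R}} m|u(x,t)|^2+|u_x(x,t)|^2+|u_t(x,t)|^2\,dx=\frac12\|T(t)z_0\|_X^2,\qquad t\ge0.$$ For $\lambda\in\mathbb{C}$, $\operatorname{Ran}(\lambda-A)=\{\lambda z-Az: z\in D(A)\}$. *)

(* Defs.v *)
From HB Require Import structures.
From mathcomp Require Import all_boot all_order all_algebra.
From mathcomp Require Import generic_quotient ring_quotient complex.
From mathcomp Require Import all_classical all_reals all_analysis.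
From mathcomp Require Import measurable_realfun.
From mathcomp Require Import ring lra.

Set Implicit Arguments.
Unset Strict Implicit.
Unset Printing Implicit Defensive.
Import Order.TTheory GRing.Theory Num.Theory.
Import numFieldNormedType.Exports.
Import ComplexField.Normc.
Local Open Scope classical_set_scope.
Local Open Scope ring_scope.
Local Open Scope complex_scope.
Local Open Scope quotient_scope.

(* Landau notations need the filter as a [filter_on]; the library declares one
   for [\oo] and for points, but not for [+oo]. *)
Canonical pinfty_filter_on (R : numFieldType) :=
  FilterType (pinfty_nbhs R) proper_pinfty_nbhs.

Section L2.
Variable R : realType.
Local Notation leb := (@lebesgue_measure R).
Local Notation C := R[i].

Definition complex_measurable (f : R -> C) :=
  measurable_fun [set: R] (fun x => complex.Re (f x)) /\
  measurable_fun [set: R] (fun x => complex.Im (f x)).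

Definition square_integrable : {pred R -> C} := mem [set f |
  complex_measurable f /\
  (\int[leb]_x ((normc (f x)) ^+ 2)%:E < +oo)%E].

Lemma normc_sqE (z : C) :
  normc z ^+ 2 = complex.Re z ^+ 2 + complex.Im z ^+ 2.
Proof. by case: z => a b /=; rewrite sqr_sqrtr// addr_ge0// sqr_ge0. Qed.

Lemma normc_sqD (a x y : C) :
  normc (a * x + y) ^+ 2 <= 2 * normc a ^+ 2 * normc x ^+ 2 + 2 * normc y ^+ 2.
Proof.
rewrite -mulrA -exprMn -normcM !normc_sqE.
move: (a * x) y => [p q] [r s] /=.
have := sqr_ge0 (p - r); have := sqr_ge0 (q - s); nra.
Qed.

Lemma ReMD (a x y : C) : complex.Re (a * x + y) =
  complex.Re a * complex.Re x - complex.Im a * complex.Im x + complex.Re y.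
Proof. by move: a x y => [a b] [c d] [e f]. Qed.

Lemma ImMD (a x y : C) : complex.Im (a * x + y) =
  complex.Re a * complex.Im x + complex.Im a * complex.Re x + complex.Im y.
Proof. by move: a x y => [a b] [c d] [e f]. Qed.

Lemma complex_measurable_lin (a : C) (f g : R -> C) :
  complex_measurable f -> complex_measurable g ->
  complex_measurable (fun x => a * f x + g x).
Proof.
move=> [fr fi] [gr gi]; split.
- under eq_fun => x do rewrite ReMD.
  by apply: measurable_funD => //; apply: measurable_funB => //;
    apply: measurable_funM.
- under eq_fun => x do rewrite ImMD.
  by apply: measurable_funD => //; apply: measurable_funD => //;
    apply: measurable_funM.
Qed.

Lemma measurable_normc_sq (f : R -> C) : complex_measurable f ->
  measurable_fun [set: R] (fun x => normc (f x) ^+ 2).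
Proof.
move=> [fr fi]; under eq_fun => x do rewrite normc_sqE.
by apply: measurable_funD; apply: measurable_funX.
Qed.

Lemma square_integrable_submod : submod_closed square_integrable.
Proof.
split.
  rewrite inE /square_integrable/=; split.
    by split => /=; exact: measurable_cst.
  rewrite integral0_eq ?ltry// => x _.
  by rewrite !expr0n/= addr0 sqrtr0 expr0n.
move=> a f g; rewrite !inE /= => -[fm f2] [gm g2].
split; first exact: complex_measurable_lin.
have mf : measurable_fun [set: R] (fun x => (normc (f x) ^+ 2)%:E).
  apply/measurable_EFinP; exact: measurable_normc_sq.
have mg : measurable_fun [set: R] (fun x => (normc (g x) ^+ 2)%:E).
  apply/measurable_EFinP; exact: measurable_normc_sq.
apply: (@le_lt_trans _ _ (\int[leb]_x
   ((2 * normc a ^+ 2)%:E * (normc (f x) ^+ 2)%:E +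
    2%:E * (normc (g x) ^+ 2)%:E)))%E.
  apply: ge0_le_integral => //=.
  - by move=> x _; rewrite lee_fin sqr_ge0.
  - apply/measurable_EFinP; apply: measurable_normc_sq.
    exact: complex_measurable_lin.
  - by apply: emeasurable_funD; apply: measurable_funeM.
  - by move=> x _; rewrite -!EFinM -EFinD lee_fin normc_sqD.
have k0 : (0 <= (2 * normc a ^+ 2)%:E)%E by rewrite lee_fin mulr_ge0// sqr_ge0.
have s0 (h : R -> C) x : (0 <= (normc (h x) ^+ 2)%:E)%E.
  by rewrite lee_fin sqr_ge0.
rewrite ge0_integralD//=.
- rewrite !ge0_integralZl//=.
  by rewrite lte_add_pinfty// lte_mul_pinfty.
- by move=> x _; rewrite mule_ge0.
- exact: measurable_funeM.
- by move=> x _; rewrite mule_ge0.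
- exact: measurable_funeM.
Qed.

HB.instance Definition _ :=
  GRing.isSubmodClosed.Build _ _ square_integrable square_integrable_submod.

Record L2fun := MkL2fun {
  L2fun_val :> R -> C ;
  _ : L2fun_val \in square_integrable }.
HB.instance Definition _ := [isSub for L2fun_val].
HB.instance Definition _ := [Choice of L2fun by <:].
HB.instance Definition _ := [SubChoice_isSubLmodule of L2fun by <:].

Lemma L2fun_lin a (f g : L2fun) x : (a *: f + g) x = a * f x + g x.
Proof. by []. Qed.

Definition null_L2fun : {pred L2fun} := mem [set f : L2fun |
  {ae leb, forall x, f x = 0}].

Lemma null_L2fun_submod : submod_closed null_L2fun.
Proof.
split; rewrite ?inE /=; first exact: aeW.
move=> a f g; rewrite !inE /= => f0 g0.
have aeF := ae_filter_ringOfSetsType leb.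
by apply: filterS2 f0 g0 => x fx gx; rewrite [LHS]L2fun_lin fx gx addr0 mulr0.
Qed.

HB.instance Definition _ :=
  GRing.isSubmodClosed.Build _ _ null_L2fun null_L2fun_submod.

(* Scaling is inherited from [L2fun] below: [ideal_quot] only provides the
   additive group structure. *)
Definition L2 : Type := {ideal_quot null_L2fun}.
HB.instance Definition _ := GRing.Zmodule.on L2.
HB.instance Definition _ := EqQuotient.on L2.

Definition L2_repr (u : L2) : R -> C := repr u : L2fun.
Coercion L2_repr : L2 >-> Funclass.

Definition L2_scale (a : C) (u : L2) : L2 := \pi_L2 (a *: repr u).

Lemma pi_L2_scale a (f : L2fun) : L2_scale a (\pi_L2 f) = \pi_L2 (a *: f).
Proof.
apply/eqP; rewrite /L2_scale -Quotient.idealrBE -scalerBr.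
by rewrite rpredZ// Quotient.idealrBE reprK.
Qed.

Lemma pi_L2D (f g : L2fun) : \pi_L2 (f + g) = \pi_L2 f + \pi_L2 g.
Proof. exact: Quotient.pi_add. Qed.

Lemma L2_scaleA a b u : L2_scale a (L2_scale b u) = L2_scale (a * b) u.
Proof.
elim/quotW: u => f; rewrite [L2_scale b _]pi_L2_scale.
by rewrite [LHS]pi_L2_scale [RHS]pi_L2_scale scalerA.
Qed.

Lemma L2_scale1 : left_id 1 L2_scale.
Proof. by move=> u; elim/quotW: u => f; rewrite pi_L2_scale scale1r. Qed.

Lemma L2_scaleDr : right_distributive L2_scale +%R.
Proof.
move=> a; elim/quotW => f; elim/quotW => g.
by rewrite -pi_L2D !pi_L2_scale scalerDr pi_L2D.
Qed.

Lemma L2_scaleDl u : {morph L2_scale^~ u : a b / a + b}.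
Proof.
by elim/quotW: u => f a b; rewrite !pi_L2_scale scalerDl pi_L2D.
Qed.

HB.instance Definition _ := GRing.Zmodule_isLmodule.Build C L2
  L2_scaleA L2_scale1 L2_scaleDr L2_scaleDl.

End L2.

Section WeakDerivative.
Variable R : realType.
Local Notation leb := (@lebesgue_measure R).
Local Notation C := R[i].

Definition complex_integral (f : R -> C) : C :=
  (\int[leb]_x complex.Re (f x))%R +i* (\int[leb]_x complex.Im (f x))%R.

Definition test_function (phi : R -> R) :=
  (forall n x, derivable (derive1n n phi) x 1) /\
  compact (closure [set x | phi x != 0]).

(* Real-valued test functions are enough: the identity is complex-linear
   in [phi]. *)
Definition is_weak_derivative (u w : L2 R) := forall phi, test_function phi ->
  complex_integral (fun x => u x * (derive1 phi x)%:C) =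
  - complex_integral (fun x => w x * (phi x)%:C).

(* Continuous with compact support: both [phi] and [derive1 phi] qualify. *)
Let cc_function (psi : R -> R) := continuous psi /\
  exists2 K, compact K & forall x, ~ K x -> psi x = 0.

Let complex_integrable (f : R -> C) :=
  leb.-integrable setT (EFin \o (fun x => complex.Re (f x))) /\
  leb.-integrable setT (EFin \o (fun x => complex.Im (f x))).

Let complex_integral_lin a f g : complex_integrable f ->
  complex_integrable g -> complex_integral (fun x => a * f x + g x) =
  a * complex_integral f + complex_integral g.
Proof.
move=> [fr fi] [gr gi]; apply/eqP; rewrite eq_complex; apply/andP.
have iZ k (h : R -> R) : leb.-integrable setT (EFin \o h) ->
    leb.-integrable setT (EFin \o (fun x => k * h x)).
  by move=> ih; apply: eq_integrable (integrableZl _ k ih) => // x _; rewrite /= EFinM.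
rewrite ReMD ImMD /complex_integral /=; split; apply/eqP.
- under eq_Rintegral do rewrite ReMD.
  have ih : leb.-integrable setT (EFin \o (fun x =>
      complex.Re a * complex.Re (f x) - complex.Im a * complex.Im (f x))).
    by apply: eq_integrable (integrableB _ (iZ _ _ fr) (iZ _ _ fi)).
  rewrite RintegralD// (RintegralB _ (iZ _ _ fr) (iZ _ _ fi))//.
  by rewrite !RintegralZl.
- under eq_Rintegral do rewrite ImMD.
  have ih : leb.-integrable setT (EFin \o (fun x =>
      complex.Re a * complex.Im (f x) + complex.Im a * complex.Re (f x))).
    by apply: eq_integrable (integrableD _ (iZ _ _ fi) (iZ _ _ fr)).
  rewrite RintegralD// (RintegralD _ (iZ _ _ fi) (iZ _ _ fr))//.
  by rewrite !RintegralZl.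
Qed.

Let complex_integral_ae f g : complex_measurable f -> complex_measurable g ->
  {ae leb, forall x, f x = g x} -> complex_integral f = complex_integral g.
Proof.
have aeF := ae_filter_ringOfSetsType leb.
move=> [fr fi] [gr gi] fg; congr (_ +i* _); congr fine;
  apply: ae_eq_integral => //; try exact/measurable_EFinP.
- by apply: filterS fg => x fgx _; rewrite /= fgx.
- by apply: filterS fg => x fgx _; rewrite /= fgx.
Qed.

Let test_cc phi : test_function phi -> cc_function phi /\ cc_function (derive1 phi).
Proof.
move=> [dphi cK]; have cphi n : continuous (derive1n n phi).
  by move=> x; apply/differentiable_continuous/derivable1_diffP/dphi.
split; split; [exact: (cphi 0)| |exact: (cphi 1)|];
  exists (closure [set x | phi x != 0]) => // x Kx.
- by apply: contrapT => /eqP px; apply: Kx; exact: subset_closure.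
- rewrite derive1E (@near_eq_derive _ _ _ phi (cst 0)) ?derive_cst//.
  have : nbhs x (~` closure [set x | phi x != 0]).
    by apply: open_nbhs_nbhs; split => //; apply: closed_openC; exact: closed_closure.
  apply: filterS => y Ky; apply: contrapT => /eqP py; apply: Ky.
  exact: subset_closure.
Qed.

Let L2_mul_integrable (f : R -> C) psi : f \in @square_integrable R ->
  cc_function psi -> complex_integrable (fun x => f x * (psi x)%:C).
Proof.
rewrite inE => -[[mr mi] f2] [cpsi [K cK psi0]].
have mpsi : measurable_fun [set: R] psi by exact: continuous_measurable_fun.
have ipsi : leb.-integrable setT (EFin \o (fun x => psi x ^+ 2)).
  have -> : EFin \o (fun x => psi x ^+ 2) =
      (EFin \o (fun x => psi x ^+ 2)) \_ K.
    apply/funext => x; rewrite patchE; case: ifPn => // /negP Kx.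
    by rewrite /= psi0 ?expr0n//= => Kx'; apply: Kx; rewrite inE.
  have mK : measurable K by exact: compact_measurable.
  have [+ _] := @integrable_mkcond _ _ _ leb K (fun x => (psi x ^+ 2)%:E) mK; apply.
  apply: continuous_compact_integrable => //.
  by apply: continuous_subspaceT => x; apply: cvgM; exact: cpsi.
have ifn : leb.-integrable setT (EFin \o (fun x => normc (f x) ^+ 2)).
  apply/integrableP; split.
    by apply/measurable_EFinP; exact: measurable_normc_sq.
  by under eq_integral do rewrite /= ger0_norm ?sqr_ge0//.
have key (g : R -> R) : measurable_fun [set: R] g ->
    (forall x, g x ^+ 2 <= normc (f x) ^+ 2) ->
    leb.-integrable setT (EFin \o (fun x => g x * psi x)).
  move=> mg gf; apply: (le_integrable _ _ _ (integrableD _ ifn ipsi)) => //.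
    by apply/measurable_EFinP; exact: measurable_funM.
  move=> x _ /=; rewrite lee_fin [leRHS]ger0_norm ?addr_ge0 ?sqr_ge0//.
  rewrite (le_trans _ (lerD (gf x) (lexx _)))// ler_norml.
  move: (g x) (psi x) => p q; apply/andP; split.
    by have := sqr_ge0 (p + q); nra.
  by have := sqr_ge0 (p - q); nra.
have ReM x : complex.Re (f x * (psi x)%:C) = complex.Re (f x) * psi x.
  by case: (f x) => p q /=; rewrite mulr0 subr0.
have ImM x : complex.Im (f x * (psi x)%:C) = complex.Im (f x) * psi x.
  by case: (f x) => p q /=; rewrite mulr0 add0r.
split.
- rewrite (_ : (fun x => _) = fun x => complex.Re (f x) * psi x); last exact/funext.
  by apply: key => // x; rewrite normc_sqE lerDl sqr_ge0.
- rewrite (_ : (fun x => _) = fun x => complex.Im (f x) * psi x); last exact/funext.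
  by apply: key => // x; rewrite normc_sqE lerDr sqr_ge0.
Qed.

Let L2_reprP (u : L2 R) : L2_repr u \in @square_integrable R.
Proof. exact: (valP (repr u)). Qed.

Let L2_repr_lin a (u w : L2 R) :
  {ae leb, forall x, L2_repr (a *: u + w) x = a * u x + w x}.
Proof.
have : repr (a *: u + w) - (a *: repr u + repr w) \in @null_L2fun R.
  rewrite Quotient.idealrBE reprK; apply/eqP; rewrite pi_L2D reprK.
  by congr (_ + _).
rewrite inE; have aeF := ae_filter_ringOfSetsType leb.
by apply: filterS => x /eqP; rewrite subr_eq0 => /eqP.
Qed.

Let complex_integral_L2_lin a (u w : L2 R) psi : cc_function psi ->
  complex_integral (fun x => L2_repr (a *: u + w) x * (psi x)%:C) =
  a * complex_integral (fun x => u x * (psi x)%:C) +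
  complex_integral (fun x => w x * (psi x)%:C).
Proof.
move=> cpsi; have im (v : L2 R) := L2_mul_integrable (L2_reprP v) cpsi.
have mm (v : L2 R) : complex_measurable (fun x => v x * (psi x)%:C).
  by have [/integrableP[/measurable_EFinP ? _] /integrableP[/measurable_EFinP ? _]] := im v.
rewrite -complex_integral_lin//; apply: complex_integral_ae => //.
  exact: complex_measurable_lin.
have aeF := ae_filter_ringOfSetsType leb.
by apply: filterS (L2_repr_lin a u w) => x ->; rewrite mulrDl mulrA.
Qed.

Definition H1_pred : {pred L2 R} :=
  mem [set u | exists w, is_weak_derivative u w].

Lemma H1_submod : submod_closed H1_pred.
Proof.
have H1_lin a u w : u \in H1_pred -> w \in H1_pred -> a *: u + w \in H1_pred.
  rewrite !inE => -[u' uu'] [w' ww']; exists (a *: u' + w') => phi tphi.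
  have [c0 c1] := test_cc tphi.
  by rewrite !complex_integral_L2_lin// uu'// ww'// mulrN opprD.
split => //; rewrite inE; exists 0 => phi /test_cc[c0 c1].
have z psi : cc_function psi ->
    complex_integral (fun x => L2_repr 0 x * (psi x)%:C) = 0.
  move=> cpsi; have := complex_integral_L2_lin (- 1) 0 0 cpsi.
  by rewrite scaler0 addr0 mulN1r addNr.
by rewrite !z// oppr0.
Qed.

HB.instance Definition _ := GRing.isSubmodClosed.Build _ _ H1_pred H1_submod.

Record H1 := MkH1 { H1_val :> L2 R ; _ : H1_val \in H1_pred }.
HB.instance Definition _ := [isSub for H1_val].
HB.instance Definition _ := [Choice of H1 by <:].
HB.instance Definition _ := [SubChoice_isSubLmodule of H1 by <:].

(* Meaningful for [u \in H1_pred] only; defaults to 0 elsewhere. *)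
Definition weak_derivative (u : L2 R) : L2 R :=
  xget 0 [set w | is_weak_derivative u w].

Definition H2_pred : {pred L2 R} :=
  mem [set u | u \in H1_pred /\ weak_derivative u \in H1_pred].

Definition L2_norm (u : L2 R) : R :=
  Num.sqrt (\int[leb]_x (normc (u x) ^+ 2))%R.

End WeakDerivative.

Section Semigroup.
Variables (R : realType) (V : lmodType R[i]) (nrm : V -> R).

Definition contraction_C0_semigroup (T : R -> V -> V) :=
  [/\ forall t, 0 <= t -> linear (T t),
      T 0 = id,
      forall s t, 0 <= s -> 0 <= t -> T (s + t) = T s \o T t,
      forall t, 0 <= t -> forall z, nrm (T t z) <= nrm z &
      forall z, nrm (T t z - z) @[t --> 0^'+] --> 0].

(* [A] is total; its values outside the domain [D] are irrelevant. *)
Definition generator_of (T : R -> V -> V) (D : set V) (A : V -> V) :=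
  forall z w, (D z /\ A z = w) <->
    nrm ((t^-1)%:C *: (T t z - z) - w) @[t --> 0^'+] --> 0.

Definition resolvent_range (D : set V) (A : V -> V) (lambda : R[i]) : set V :=
  [set lambda *: z - A z | z in D].

End Semigroup.

Section KleinGordon.
Variables (R : realType) (m : R).

Definition KG_space : lmodType R[i] := (H1 R * L2 R)%type.

Definition KG_norm (z : KG_space) : R :=
  Num.sqrt (m * L2_norm (z.1 : H1 R) ^+ 2
            + L2_norm (weak_derivative (z.1 : H1 R)) ^+ 2 + L2_norm z.2 ^+ 2).

Definition KG_dom : set KG_space :=
  [set z | z.2 \in @H1_pred R /\ \val z.1 + z.2 \in @H2_pred R].

(* The defaults of [insubd] and [weak_derivative] are only used outside
   [KG_dom]. *)
Definition KG_op (z : KG_space) : KG_space :=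
  (insubd (0 : H1 R) z.2,
   weak_derivative (weak_derivative (\val z.1 + z.2)) - m%:C *: \val z.1).

Definition KG_energy (T : R -> KG_space -> KG_space) (z0 : KG_space) (t : R) : R :=
  2^-1 * KG_norm (T t z0) ^+ 2.

End KleinGordon.

(* Main.v *)
(**
  Both the upper and the lower bounds are energy estimates in physical space.
  Write [D_h] for the difference quotient and [S_h] for the average over an
  interval of length [h], so that [D_h u = S_h u'].  Since [A] commutes with
  translations, the functional [|z|^2 + I(D_h z) + C/2 |D_h z|^2], with [I] a
  cross term between position and velocity and [C = 1 + 1/m], loses at least
  [|D_h z|^2] per unit of time along solutions, whence
  [t |T(t) D_h z|^2 <= |z|^2 + C |D_h z|^2].

  - Stability: a state [z] is the average of [z] and a far translate of [z], of
    norm close to [|z| / sqrt 2], plus a multiple of a difference quotient, which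
    decays.
  - Rate: [z] lies in both ranges only if it is a second derivative, [z = Q''];
    then [S_h S_h z = D_h D_h Q], and the decay estimate applies twice, uniformly
    in [h].
  - Optimality: data [(0, g'')] lie in both ranges.  The dissipation rate is
    [2 |u_tx|^2 <= 2 |g'''|^2], so dilations of a fixed profile give [g] of H^2-size
    at most one with [|T(t) z|] bounded below by a constant over [t]; a gliding-hump sum
    of such data defeats any rate [r = o(t^-2)].
*)
From HB Require Import structures.
Require Import Defs.
From mathcomp Require Import all_boot all_order all_algebra complex.
From mathcomp Require Import generic_quotient ring_quotient.
From mathcomp Require Import all_classical all_reals all_analysis.
From mathcomp Require Import measurable_realfun.
From mathcomp Require Import ring lra.
Import Order.TTheory GRing.Theory Num.Theory.
Import numFieldNormedType.Exports.
Set Implicit Arguments.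
Unset Strict Implicit.
Unset Printing Implicit Defensive.
Local Open Scope classical_set_scope.
Local Open Scope ring_scope.
Local Open Scope complex_scope.

(** * Square-integrable real functions *)

(** The damping dissipates only [|v'|^2], with [v] the velocity, and this gives no control of [|v|]
    at low frequencies. What it does control, uniformly in [h], is [D_h v = S_h v'], because
    averaging is a contraction of L^2. The cross term [I] carries this control over to the other
    components of [D_h z], and [C/2 |D_h z|^2] compensates for its sign. Difference quotients
    replace derivatives because they are bounded on all of X and commute with [T(t)], whereas a
    state in the domain may have a position with only one derivative. The estimates are proved along
    trajectories in the domain and reach X by density. The points [+i sqrt m] and [-i sqrt m] are
    the eigenvalues of the oscillator [u_tt + m u = 0] to which the equation reduces at frequency
    zero, so lying in both ranges is a vanishing condition at low frequency. It amounts to two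
    derivatives: with [a^2 = -m] and [z = a y - A y], the combination [vel z + a pos z] equals
    [-(pos y + vel y)'']. *)

Section Affine.
Variable R : realType.
Local Notation leb := (@lebesgue_measure R).

Definition affine (a b : R) (x : measurableTypeR R) : measurableTypeR R :=
  a * x + b.

Lemma measurable_affine a b :
  measurable_fun [set: measurableTypeR R] (affine a b).
Proof. by apply: measurable_funD => //; apply: measurable_funM. Qed.

HB.instance Definition _ a b := isMeasurableFun.Build _ _
  (measurableTypeR R) (measurableTypeR R) (affine a b) (measurable_affine a b).

(** By uniqueness of Lebesgue measure it is enough to compare both sides on half-open intervals. For
    [a < 0] the preimage of []c, d]] is closed on the left and open on the right, which has the same
    length. *)
Lemma lebesgue_measure_affine a b (A : set R) : a != 0 -> measurable A ->
  leb A = (`|a|%:E * pushforward leb (affine a b) A)%E.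
Proof.
move=> a0 mA.
have -> // := @lebesgue_measure_unique R
  (mscale (NngNum (normr_ge0 a)) (pushforward leb (affine a b))) _ A mA.
move=> _ [[c d] _ <-]; rewrite /mscale/= /pushforward/=.
have [{}a0|{}a0|a1] := ltgtP a 0; last by rewrite a1 eqxx in a0.
- transitivity (`|a|%:E * leb (`[((d - b) / a)%R, ((c - b) / a)%R[%classic : set R))%E; last first.
    congr (_ * leb _)%E; apply/seteqP.
    by split => x /=; rewrite !in_itv/= /affine;
      rewrite ltr_ndivlMr// ler_ndivrMr// (mulrC x) => /andP[? ?];
      apply/andP; split; lra.
  rewrite !lebesgue_measure_itv/= !lte_fin ltr_nM2r ?invr_lt0// ltrD2r.
  case: ifPn => _; last by rewrite mule0.
  by rewrite -EFinD -EFinM; congr EFin; rewrite ltr0_norm//; field; rewrite lt_eqF.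
- transitivity (`|a|%:E * leb (`]((c - b) / a)%R, ((d - b) / a)%R]%classic : set R))%E; last first.
    congr (_ * leb _)%E; apply/seteqP.
    by split => x /=; rewrite !in_itv/= /affine;
      rewrite ltr_pdivrMr// ler_pdivlMr// (mulrC x) => /andP[? ?];
      apply/andP; split; lra.
  rewrite !lebesgue_measure_itv/= !lte_fin ltr_pM2r ?invr_gt0// ltrD2r.
  case: ifPn => _; last by rewrite mule0.
  by rewrite -EFinD -EFinM; congr EFin; rewrite gtr0_norm//; field; rewrite gt_eqF.
Qed.

Lemma ge0_integral_affine a b (f : R -> \bar R) : a != 0 ->
  measurable_fun [set: R] f -> (forall x, 0 <= f x)%E ->
  (\int[leb]_x f x = `|a|%:E * \int[leb]_x f (affine a b x))%E.
Proof.
move=> a0 mf f0.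
rewrite -[X in (_ * X)%E](ge0_integral_pushforward (measurable_affine a b) leb measurableT mf (fun x _ => f0 x)).
rewrite -(@ge0_integral_mscale _ _ R (pushforward leb (affine a b)) setT measurableT (NngNum (normr_ge0 a)))//.
apply: eq_measure_integral => A mA _.
exact: (lebesgue_measure_affine b a0 mA).
Qed.

End Affine.

Section SquareIntegrable.
Variable R : realType.
Local Notation leb := (@lebesgue_measure R).
Local Notation itg f := (leb.-integrable setT (EFin \o f)).
Local Notation "'Int' f" := (\int[leb]_x f x)%R (at level 10).
Implicit Types (f g : R -> R) (a b h : R).

Lemma EFin_Int f : itg f -> (\int[leb]_x (f x)%:E)%E = (Int f)%:E.
Proof. by move=> itf; rewrite fineK//; exact: integrable_fin_num itf. Qed.

Lemma ge0_itg f : measurable_fun [set: R] f -> (forall x, 0 <= f x) ->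
  (\int[leb]_x (f x)%:E < +oo)%E -> itg f.
Proof.
move=> mf f0 foo; apply/integrableP; split; first exact/measurable_EFinP.
by under eq_integral do rewrite /= ger0_norm//.
Qed.

Lemma itg_measurable f : itg f -> measurable_fun [set: R] f.
Proof. by move=> /integrableP[/measurable_EFinP]. Qed.

Lemma itg_le f g : measurable_fun [set: R] f -> itg g ->
  (forall x, `|f x| <= g x) -> itg f.
Proof.
move=> mf ig fg; apply: (le_integrable _ _ _ ig) => //; first exact/measurable_EFinP.
by move=> x _ /=; rewrite lee_fin (le_trans (fg x))// ler_norm.
Qed.

Lemma itgD f g : itg f -> itg g -> itg (fun x => f x + g x).
Proof. by move=> fi gi; apply: eq_integrable (integrableD _ fi gi). Qed.

Lemma itgZ a f : itg f -> itg (fun x => a * f x).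
Proof.
by move=> fi; apply: eq_integrable (integrableZl _ a fi) => // x _; rewrite /= EFinM.
Qed.

Lemma itgB f g : itg f -> itg g -> itg (fun x => f x - g x).
Proof. by move=> fi gi; apply: eq_integrable (integrableB _ fi gi). Qed.

Lemma IntD f g : itg f -> itg g -> Int (fun x => f x + g x) = Int f + Int g.
Proof. by move=> fi gi; rewrite RintegralD. Qed.

Lemma IntB f g : itg f -> itg g -> Int (fun x => f x - g x) = Int f - Int g.
Proof. by move=> fi gi; rewrite RintegralB. Qed.

Lemma IntZ a f : itg f -> Int (fun x => a * f x) = a * Int f.
Proof. by move=> fi; rewrite RintegralZl. Qed.

Lemma Int_ge0 f : (forall x, 0 <= f x) -> 0 <= Int f.
Proof. by move=> f0; rewrite Rintegral_ge0. Qed.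

Lemma Int_le f g : itg f -> itg g -> (forall x, f x <= g x) -> Int f <= Int g.
Proof. by move=> fi gi fg; apply: le_Rintegral. Qed.

Lemma Int_ae f g : measurable_fun [set: R] f -> measurable_fun [set: R] g ->
  {ae leb, forall x, f x = g x} -> Int f = Int g.
Proof.
have aeF := ae_filter_ringOfSetsType leb.
move=> fm gm fg; congr fine; apply: ae_eq_integral => //; try exact/measurable_EFinP.
by apply: filterS fg => x fgx _; rewrite /= fgx.
Qed.

Lemma measurable_comp_affine a b f : measurable_fun [set: R] f ->
  measurable_fun [set: R] (fun x => f (a * x + b)).
Proof. by move=> mf; exact: (measurableT_comp mf (measurable_affine a b)). Qed.

Lemma itg_affine a b f : a != 0 -> itg f -> itg (fun x => f (a * x + b)).
Proof.
move=> a0 /integrableP[/measurable_EFinP mf].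
rewrite (ge0_integral_affine b a0)//; last by do 2 apply: measurableT_comp => //.
move=> foo; apply/integrableP; split.
  by apply/measurable_EFinP; exact: measurable_comp_affine.
move: foo; rewrite ltey => /eqP foo; rewrite ltey; apply/eqP => e; apply: foo.
by rewrite /affine e gt0_muley// lte_fin normr_gt0.
Qed.

Lemma Int_affine a b f : a != 0 -> itg f ->
  Int f = `|a| * Int (fun x => f (a * x + b)).
Proof.
move=> a0 fi; have fia := itg_affine b a0 fi.
have mf := measurable_int _ fi.
apply: EFin_inj; rewrite EFinM -!EFin_Int// integralE [in RHS]integralE.
rewrite muleBr//; last first.
  by apply: fin_num_adde_defl; rewrite fin_numN integrable_neg_fin_num.
rewrite (@ge0_integral_affine _ a b)//; last first.
  exact: measurable_funepos.
rewrite [X in (_ - X)%E = _](@ge0_integral_affine _ a b)//.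
  congr (_ * _ - _ * _)%E; apply: eq_integral => x _.
    exact: (congr1 (@^~ x) (esym (funepos_comp (EFin \o f) (affine a b)))).
  exact: (congr1 (@^~ x) (esym (funeneg_comp (EFin \o f) (affine a b)))).
exact: measurable_funeneg.
Qed.

(** Measurability of [f] is a clause of its own because that of [f ^+ 2] does not imply it. *)
Definition sqi f := measurable_fun [set: R] f /\ itg (fun x => f x ^+ 2).

Lemma sqi_lin a f g : sqi f -> sqi g -> sqi (fun x => a * f x + g x).
Proof.
move=> [mf fi] [mg gi]; have m : measurable_fun [set: R] (fun x => a * f x + g x).
  by apply: measurable_funD => //; apply: measurable_funM.
split => //; apply: itg_le (itgD (itgZ (2 * a ^+ 2) fi) (itgZ 2 gi)) _.
  by apply: measurable_funX.
move=> x; rewrite ger0_norm ?sqr_ge0//.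
by have := sqr_ge0 (a * f x - g x); nra.
Qed.

Lemma sqi_cst0 : sqi (fun=> 0).
Proof. by split => //; under eq_fun do rewrite expr0n; exact: integrable0. Qed.

Lemma sqiB f g : sqi f -> sqi g -> sqi (fun x => f x - g x).
Proof.
move=> fi gi; have := sqi_lin (-1) gi fi.
by congr sqi; apply/funext => x; ring.
Qed.

Lemma sqiD f g : sqi f -> sqi g -> sqi (fun x => f x + g x).
Proof.
move=> fi gi; have := sqi_lin 1 gi fi.
by congr sqi; apply/funext => x; ring.
Qed.

Lemma sqi_mul f g : sqi f -> sqi g -> itg (fun x => f x * g x).
Proof.
move=> [mf fi] [mg gi]; apply: itg_le (itgD fi gi) _.
  exact: measurable_funM.
move=> x; rewrite ler_norml; apply/andP; split.
  by have := sqr_ge0 (f x + g x); have := sqr_ge0 (f x); have := sqr_ge0 (g x); nra.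
by have := sqr_ge0 (f x - g x); have := sqr_ge0 (f x); have := sqr_ge0 (g x); nra.
Qed.

Lemma sqi_affine a b f : a != 0 -> sqi f -> sqi (fun x => f (a * x + b)).
Proof.
move=> a0 [mf fi]; split; first exact: measurable_comp_affine.
exact: (itg_affine b a0 fi).
Qed.

Lemma Int_sqr_eq0 f : sqi f -> Int (fun x => f x ^+ 2) = 0 ->
  {ae leb, forall x, f x = 0}.
Proof.
move=> [mf fi] f0.
have : (\int[leb]_x `|(EFin \o (fun x => (f x ^+ 2)%R)) x|)%E = 0%E.
  under eq_integral do rewrite /= ger0_norm ?sqr_ge0//.
  by rewrite EFin_Int// f0.
have aeF := ae_filter_ringOfSetsType leb.
move/(ae_eq_integral_abs leb measurableT (measurable_int _ fi)).
by apply: filterS => x /(_ I)/= [] /eqP; rewrite sqrf_eq0 => /eqP.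
Qed.

End SquareIntegrable.

Section ProbabilityJensen.

(** Non-negativity of the variance: [(g - c) ^+ 2], with [c] the mean, has a non-negative integral,
    and expanding it uses that the total mass is one. *)
Lemma Rintegral_sqr_le d (T : measurableType d) (R : realType)
    (P : probability T R) (g : T -> R) :
  P.-integrable setT (EFin \o g) -> P.-integrable setT (EFin \o (fun x => g x ^+ 2)) ->
  (\int[P]_x g x)%R ^+ 2 <= (\int[P]_x (g x ^+ 2))%R.
Proof.
move=> gi g2i; set c := (\int[P]_x g x)%R.
have ci k : P.-integrable setT (EFin \o (fun=> k : R)).
  exact: finite_measure_integrable_cst.
have i1 : P.-integrable setT (EFin \o (fun x => - (2 * c) * g x)).
  by apply: eq_integrable (integrableZl _ (- (2 * c)) gi) => // x _; rewrite /= EFinM.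
have i2 : P.-integrable setT (EFin \o (fun x => - (2 * c) * g x + c ^+ 2)).
  by apply: eq_integrable (integrableD _ i1 (ci (c ^+ 2))).
have : 0 <= (\int[P]_x (g x ^+ 2 + (- (2 * c) * g x + c ^+ 2)))%R.
  apply: Rintegral_ge0 => x _; have := sqr_ge0 (g x - c); nra.
rewrite RintegralD// (RintegralD measurableT i1 (ci _))// RintegralZl// -/c.
rewrite Rintegral_cst//. have -> : fine (P setT) = 1 by rewrite probability_setT.
by rewrite mulr1; nra.
Qed.

End ProbabilityJensen.

(** * Steklov averages *)

Section Steklov.
Variable R : realType.
Local Notation leb := (@lebesgue_measure R).
Local Notation U := (uniform_prob (@ltr01 R)).
Local Notation itg f := (leb.-integrable setT (EFin \o f)).
Local Notation "'Int' f" := (\int[leb]_x f x)%R (at level 10).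
Implicit Types (f g : R -> R) (a b h : R).

(** The mean of [f] between [x] and [x + h], written as an expectation over a uniform [s]: it makes
    sense for [h] of either sign, as the adjoint requires, and Jensen and Fubini apply directly. *)
Definition steklov h f x := (\int[U]_s f (h * s + x)%R)%R.

Lemma ge0_integral_unif (f : R -> \bar R) : measurable_fun [set: R] f ->
  (forall x, 0 <= f x)%E -> (\int[U]_x f x = \int[leb]_(x in `[0%R, 1%R]) f x)%E.
Proof. by move=> mf f0; rewrite integral_uniform// subr0 invr1 mul1e. Qed.

Lemma unif_cst (c : R) : U.-integrable setT (EFin \o (fun=> c)).
Proof. exact: finite_measure_integrable_cst. Qed.

Lemma sqi_unif_integrable2 h f x : sqi f ->
  U.-integrable setT (EFin \o (fun s => f (h * s + x) ^+ 2)).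
Proof.
move=> [mf fi]; have mh : measurable_fun [set: R] (fun s => f (h * s + x) ^+ 2).
  by apply: measurable_funX; exact: measurable_comp_affine.
have [->|h0] := eqVneq h 0.
  by under eq_fun do rewrite mul0r add0r; exact: unif_cst.
apply/integrableP; split; first exact/measurable_EFinP.
under eq_integral do rewrite /= ger0_norm ?sqr_ge0//.
rewrite ge0_integral_unif//; first last.
- by move=> s; rewrite lee_fin sqr_ge0.
- exact/measurable_EFinP.
have /integrableP[_] := itg_affine x h0 fi.
apply: le_lt_trans; under [leRHS]eq_integral do rewrite /= ger0_norm ?sqr_ge0//.
apply: ge0_subset_integral => //; first exact/measurable_EFinP.
by move=> s _; rewrite lee_fin sqr_ge0.
Qed.

Lemma sqi_unif_integrable h f x : sqi f ->
  U.-integrable setT (EFin \o (fun s => f (h * s + x))).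
Proof.
move=> fi; have f2 := sqi_unif_integrable2 h x fi.
apply: (le_integrable _ _ _ (integrableD measurableT f2 (unif_cst 1))) => //.
  by apply/measurable_EFinP; apply: measurable_comp_affine; exact: fi.1.
move=> s _ /=; rewrite lee_fin [leRHS]ger0_norm ?addr_ge0 ?sqr_ge0//.
rewrite ler_norml; set y := f _; apply/andP; split.
  by have := sqr_ge0 (y + 1); have := sqr_ge0 y; nra.
by have := sqr_ge0 (y - 1); have := sqr_ge0 y; nra.
Qed.

Lemma measurable_addmul h :
  measurable_fun [set: R * R] (fun z : R * R => h * z.2 + z.1).
Proof.
by apply: measurable_funD => //; apply: measurable_funM.
Qed.

(** Tonelli gives measurability in [x] for non-negative integrands, so positive and negative parts
    are treated separately. *)
Lemma measurable_steklov h f : measurable_fun [set: R] f ->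
  measurable_fun [set: R] (steklov h f).
Proof.
move=> mf; pose F (z : measurableTypeR R * measurableTypeR R) := (f (h * z.2 + z.1))%:E.
have mF : measurable_fun setT F.
  by apply/measurable_EFinP; exact: (measurableT_comp mf (measurable_addmul h)).
apply: (measurableT_comp (@fine_measurable R setT measurableT)) => /=.
have Ep x : ((fun s => (f (h * s + x)%R)%:E)^\+ = (fun s => F^\+ (x, s)))%E.
  exact: (funepos_comp F (fun s => (x, s))).
have En x : ((fun s => (f (h * s + x)%R)%:E)^\- = (fun s => F^\- (x, s)))%E.
  exact: (funeneg_comp F (fun s => (x, s))).
under eq_fun => x do rewrite integralE Ep En.
apply: emeasurable_funB.
- apply: (@measurable_fun_fubini_tonelli_F _ _ _ _ R U F^\+%E) => //.
  exact: measurable_funepos.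
- apply: (@measurable_fun_fubini_tonelli_F _ _ _ _ R U F^\-%E) => //.
  exact: measurable_funeneg.
Qed.

Lemma steklov_sqr_le h f x : sqi f ->
  ((steklov h f x ^+ 2)%:E <= \int[U]_s ((f (h * s + x)%R) ^+ 2)%:E)%E.
Proof.
move=> fi; have i2 := sqi_unif_integrable2 h x fi.
rewrite -[leRHS]fineK ?integrable_fin_num// lee_fin.
apply: Rintegral_sqr_le => //; exact: sqi_unif_integrable.
Qed.

(** Tonelli: for fixed [s] the integral over [x] is that of a translate, whose value does not depend
    on [s], and [U] has mass one. *)
Lemma integral_unif_shift_sqr h f : sqi f ->
  (\int[leb]_x \int[U]_s ((f (h * s + x)%R) ^+ 2)%:E =
   (Int (fun x => f x ^+ 2))%:E)%E.
Proof.
move=> [mf fi].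
pose F (z : measurableTypeR R * measurableTypeR R) := ((f (h * z.2 + z.1)) ^+ 2)%:E.
have mF : measurable_fun setT F.
  apply/measurable_EFinP; apply: measurable_funX.
  exact: (measurableT_comp mf (measurable_addmul h)).
rewrite (@fubini_tonelli _ _ _ _ R leb U F mF); last first.
  by move=> z; rewrite lee_fin sqr_ge0.
rewrite (eq_integral (cst (Int (fun x => f x ^+ 2))%:E)).
  by rewrite integral_cst//= probability_setT mule1.
move=> s _ /=; rewrite -EFin_Int//.
rewrite (@ge0_integral_affine _ 1 (h * s))//; first last.
- by move=> x; rewrite lee_fin sqr_ge0.
- exact: measurable_int fi.
rewrite normr1 mul1e; apply: eq_integral => x _.
by rewrite /affine /F/= mul1r addrC.
Qed.

Lemma sqi_steklov h f : sqi f -> sqi (steklov h f).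
Proof.
move=> fi; have ms := measurable_steklov h fi.1; split => //.
apply: ge0_itg => //; first exact: measurable_funX.
  by move=> x; rewrite sqr_ge0.
apply: (@le_lt_trans _ _ (Int (fun x => f x ^+ 2))%:E); last exact: ltry.
rewrite -(integral_unif_shift_sqr h fi); apply: ge0_le_integral => //.
- by move=> x _; rewrite lee_fin sqr_ge0.
- by apply/measurable_EFinP; exact: measurable_funX.
- pose F (z : measurableTypeR R * measurableTypeR R) := ((f (h * z.2 + z.1)) ^+ 2)%:E.
  apply: (@measurable_fun_fubini_tonelli_F _ _ _ _ R U F) => //.
    apply/measurable_EFinP; apply: measurable_funX.
    exact: (measurableT_comp fi.1 (measurable_addmul h)).
  by move=> z; rewrite lee_fin sqr_ge0.
- by move=> x _; exact: steklov_sqr_le.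
Qed.

(** Jensen at each point, then Tonelli. This contraction, with constant one for every [h], is what
    makes the later estimates uniform in [h]. *)
Lemma Int_steklov_sqr h f : sqi f ->
  Int (fun x => steklov h f x ^+ 2) <= Int (fun x => f x ^+ 2).
Proof.
move=> fi; have si := sqi_steklov h fi.
rewrite -lee_fin -EFin_Int ?si.2// -(integral_unif_shift_sqr h fi).
apply: ge0_le_integral => //.
- by move=> x _; rewrite lee_fin sqr_ge0.
- exact: measurable_int si.2.
- pose F (z : measurableTypeR R * measurableTypeR R) := ((f (h * z.2 + z.1)) ^+ 2)%:E.
  apply: (@measurable_fun_fubini_tonelli_F _ _ _ _ R U F) => //.
    apply/measurable_EFinP; apply: measurable_funX.
    exact: (measurableT_comp fi.1 (measurable_addmul h)).
  by move=> z; rewrite lee_fin sqr_ge0.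
- by move=> x _; exact: steklov_sqr_le.
Qed.

Lemma steklov_lin h a f g : sqi f -> sqi g ->
  steklov h (fun x => a * f x + g x) = (fun x => a * steklov h f x + steklov h g x).
Proof.
move=> fi gi; apply/funext => x; rewrite /steklov.
have f1 := sqi_unif_integrable h x fi.
have g1 := sqi_unif_integrable h x gi.
rewrite RintegralD//; first by rewrite RintegralZl.
by apply: eq_integrable (integrableZl _ a f1) => // s _; rewrite /= EFinM.
Qed.

End Steklov.

(** * Steklov averages: adjoint and almost-everywhere convergence *)

Section SteklovAdjoint.
Variable R : realType.
Local Notation leb := (@lebesgue_measure R).
Local Notation U := (uniform_prob (@ltr01 R)).
Local Notation itg f := (leb.-integrable setT (EFin \o f)).
Local Notation "'Int' f" := (\int[leb]_x f x)%R (at level 10).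
Implicit Types (f g : R -> R) (a b h : R).

(** Fubini applies because the integrand is dominated by [A ^+ 2 + B ^+ 2], and each square is
    integrable on the product space. *)
Lemma Int_steklov_mul h f g : sqi f -> sqi g ->
  ((Int (fun x => steklov h f x * g x))%:E =
   \int[U]_s (Int (fun x => f (h * s + x) * g x))%:E)%E.
Proof.
move=> fi gi.
pose A (z : measurableTypeR R * measurableTypeR R) := f (h * z.2 + z.1).
pose B (z : measurableTypeR R * measurableTypeR R) := g z.1.
have mA : measurable_fun setT A.
  exact: (measurableT_comp fi.1 (measurable_addmul h)).
have mB : measurable_fun setT B by exact: (measurableT_comp gi.1 measurable_fst).
pose M := (leb \x U)%E.
have A2 : M.-integrable setT (EFin \o (fun z => A z ^+ 2)).
  apply/integrable12ltyP.
    by apply/measurable_EFinP; exact: measurable_funX.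
  under eq_integral => x _ do under eq_integral do rewrite /= ger0_norm ?sqr_ge0//.
  by rewrite /A/= integral_unif_shift_sqr// ltry.
have B2 : M.-integrable setT (EFin \o (fun z => B z ^+ 2)).
  apply/integrable12ltyP.
    by apply/measurable_EFinP; exact: measurable_funX.
  under eq_integral => x _ do under eq_integral do rewrite /= ger0_norm ?sqr_ge0//.
  apply: (@eq_ind_r _ (Int (fun x => g x ^+ 2))%:E (fun z => z < +oo)%E (ltry _)).
  rewrite -EFin_Int; last exact: gi.2.
  by apply: eq_integral => x _; rewrite /B/= integral_cst//= probability_setT mule1.
have AB : M.-integrable setT (EFin \o (fun z => A z * B z)).
  apply: (le_integrable measurableT _ _ (integrableD measurableT A2 B2)).
    by apply/measurable_EFinP; exact: measurable_funM.
  move=> z _ /=; rewrite lee_fin [leRHS]ger0_norm ?addr_ge0 ?sqr_ge0// ler_norml.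
  have := sqr_ge0 (A z); have := sqr_ge0 (B z) => Az0 Bz0.
  by apply/andP; split; [have := sqr_ge0 (A z + B z)|have := sqr_ge0 (A z - B z)]; nra.
have := Fubini AB; rewrite /A /B/= => E.
transitivity (\int[leb]_x \int[U]_y (f (h * y + x) * g x)%:E)%E.
  rewrite -EFin_Int; last by apply: sqi_mul => //; exact: sqi_steklov.
  apply: eq_integral => x _; rewrite /steklov -RintegralZr//; last exact: sqi_unif_integrable.
  rewrite fineK// integrable_fin_num//.
  by apply: eq_integrable (integrableZr _ (g x) (sqi_unif_integrable h x fi)) => // s _;
    rewrite /= EFinM.
rewrite E; apply: eq_integral => s _; rewrite EFin_Int//.
apply: sqi_mul => //.
by have := sqi_affine (h * s) (oner_neq0 R) fi; congr sqi; apply/funext => x; rewrite mul1r addrC.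
Qed.

(** For fixed [s], a translation by [- (h * s)] moves the shift from [f] to [g] with the opposite
    sign. *)
Lemma Int_steklov_adj h f g : sqi f -> sqi g ->
  Int (fun x => steklov h f x * g x) = Int (fun x => f x * steklov (- h) g x).
Proof.
move=> fi gi; apply: EFin_inj.
rewrite Int_steklov_mul//.
under [in RHS]eq_Rintegral do rewrite mulrC.
rewrite (Int_steklov_mul (- h) gi fi); apply: eq_integral => s _; congr EFin.
have si : sqi (fun x => f (h * s + x)).
  by have := sqi_affine (h * s) (oner_neq0 R) fi; congr sqi; apply/funext => x; rewrite mul1r addrC.
rewrite (Int_affine (- (h * s)) (oner_neq0 R)) ?sqi_mul// normr1 mul1r.
by apply: eq_Rintegral => x _; rewrite mul1r mulNr [- _ + x]addrC mulrC; congr (_ * f _); ring.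
Qed.

Lemma integral_unif_signed (f : R -> \bar R) : measurable_fun [set: R] f ->
  (\int[U]_x f x = \int[leb]_(x in `[0%R, 1%R]) f x)%E.
Proof.
move=> mf; rewrite integralE [in RHS]integralE !ge0_integral_unif//.
- exact: measurable_funeneg.
- exact: measurable_funepos.
Qed.

Lemma sqi_locally_integrable f : sqi f -> locally_integrable setT f.
Proof.
move=> [mf fi]; split => //; first exact: openT.
move=> K _ cK; have mK := compact_measurable cK.
apply: (@le_lt_trans _ _ (\int[leb]_(x in K) ((f x ^+ 2)%:E + cst 1%E x))%E).
  apply: ge0_le_integral => //.
  - by do 2 apply: measurableT_comp => //; exact: measurable_funTS.
  - apply: emeasurable_funD => //.
    by apply/measurable_EFinP; apply: measurable_funX; exact: measurable_funTS.
  - move=> x _; rewrite /= -EFinD lee_fin ler_norml; have := sqr_ge0 (f x) => fx0.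
    by apply/andP; split; [have := sqr_ge0 (f x + 1)|have := sqr_ge0 (f x - 1)]; nra.
rewrite ge0_integralD//; first last.
- by apply/measurable_EFinP; apply: measurable_funX; exact: measurable_funTS.
- by move=> x _; rewrite lee_fin sqr_ge0.
rewrite integral_cst// mul1e lte_add_pinfty//; last exact: compact_finite_measure.
apply: (@le_lt_trans _ _ (\int[leb]_x (f x ^+ 2)%:E)%E).
  apply: ge0_subset_integral => //; first by apply/measurable_EFinP; exact: measurable_funX.
  by move=> x _; rewrite lee_fin sqr_ge0.
by rewrite EFin_Int// ltry.
Qed.

Lemma sqi_itv_itg f (i : interval R) (c d : R) : [set` i] `<=` `[c, d]%classic ->
  sqi f -> itg (f \_ [set` i]).
Proof.
move=> icd [mf fi]; have mfi : measurable_fun [set: R] (f \_ [set` i]).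
  by apply/(measurable_restrictT _ _).1 => //; exact: measurable_funTS.
have c1 : itg ((cst 1 : R -> R) \_ (`[c, d] : set R)).
  rewrite -restrict_EFin; apply/integrable_restrict => //; rewrite setTI.
  apply: continuous_compact_integrable; first exact: segment_compact.
  by apply: continuous_subspaceT => ?; exact: cvg_cst.
apply: itg_le (itgD fi c1) _ => // x; rewrite !patchE.
case: ifPn => xi; last by rewrite normr0 addr_ge0 ?sqr_ge0//; case: ifP.
rewrite ifT; last by rewrite inE; apply: icd; rewrite inE in xi.
rewrite ler_norml /=; have := sqr_ge0 (f x) => fx0.
by apply/andP; split; [have := sqr_ge0 (f x + 1)|have := sqr_ge0 (f x - 1)]; nra.
Qed.

Lemma steklovE h f x : 0 < h -> sqi f ->
  ((steklov h f x)%:E = h^-1%:E * \int[leb]_(y in `[x, (x + h)%R]) (f y)%:E)%E.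
Proof.
move=> h0 fi; rewrite /steklov fineK; last first.
  by rewrite integrable_fin_num//; exact: sqi_unif_integrable.
rewrite integral_unif_signed; last first.
  by apply/measurable_EFinP; exact: measurable_comp_affine fi.1.
pose k := f \_ (`[x, x + h] : set R).
have ki : itg k by exact: (@sqi_itv_itg f `[x, x + h] x (x + h)).
rewrite [X in (_ * X)%E](_ : _ = (Int k)%:E); last first.
  by rewrite -EFin_Int// integral_mkcond restrict_EFin.
rewrite (Int_affine x (lt0r_neq0 h0) ki) gtr0_norm// -EFinM mulrA mulVf ?gt_eqF// mul1r.
rewrite -EFin_Int; last exact: (itg_affine x (lt0r_neq0 h0) ki).
rewrite integral_mkcond; apply: eq_integral => s _; rewrite /k !patchE.
rewrite (_ : (h * s + x \in `[x, x + h]%classic) = (s \in `[0, 1]%classic)); first by case: ifP.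
rewrite !mem_setE !in_itv/= lerDr [h * s + x]addrC lerD2l.
by rewrite pmulr_rge0// ger_pMr.
Qed.

(** Lebesgue differentiation along the intervals [[x, x + 1/(n+1)]], which are not balls around [x]
    but shrink nicely to it. *)
Lemma steklov_ae f : sqi f ->
  {ae leb, forall x, (steklov n.+1%:R^-1 f x) @[n --> \oo] --> f x}.
Proof.
move=> fi; pose E (x : R) (n : nat) := (`[x, x + n.+1%:R^-1]%classic : set R).
have n0 n : (0 : R) < n.+1%:R^-1 by rewrite invr_gt0 ltr0n.
have lE x n : leb (E x n) = (n.+1%:R^-1)%:E.
  by rewrite lebesgue_measure_itv/= lte_fin ltrDl n0 -EFinD addrC addKr.
have hE x : nicely_shrinking x (E x).
  split; first by move=> n; exact: measurable_itv.
  have n1 n : (0 : R) < 2 * n.+1%:R^-1 by rewrite mulr_gt0.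
  (* The ball of radius [2/(n+1)] contains the closed interval and has four times its measure. *)
  exists (4, (fun n => PosNum (n1 n))); split => //=.
  - by rewrite -[X in _ --> X](mulr0 2); apply: cvgM; [exact: cvg_cst|exact: cvg_harmonic].
  - move=> n y; rewrite /E /= in_itv/= /ball/= => /andP[xy yx].
    rewrite ltr_norml; have := n0 n.
    by move: (n.+1%:R^-1) xy yx => r xy yx r0; apply/andP; split; lra.
  - move=> n; rewrite lebesgue_measure_ball ?(ltW (n1 n))// lE -EFinM lee_fin.
    by have := n0 n; move: (n.+1%:R^-1) => r r0; rewrite mulr2n; lra.
have aeF := ae_filter_ringOfSetsType leb.
apply: filterS (lebesgue_differentiation (sqi_locally_integrable fi)) => x fx.
have := nice_lebesgue_differentiation hE (sqi_locally_integrable fi) fx.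
under eq_fun => n.
  rewrite lE inver gt_eqF// -(steklovE x (n0 n) fi); over.
by move/fine_cvg.
Qed.

End SteklovAdjoint.

(** * Limits and completeness in L^2 *)

Section L2Limits.
Variable R : realType.
Local Notation leb := (@lebesgue_measure R).
Local Notation itg f := (leb.-integrable setT (EFin \o f)).
Local Notation "'Int' f" := (\int[leb]_x f x)%R (at level 10).
Implicit Types (f g : R -> R) (a b h c : R).

Lemma limn_einf_le (u : (\bar R)^nat) (c : \bar R) :
  (forall n, u n <= c)%E -> (limn_einf u <= c)%E.
Proof.
move=> uc; rewrite limn_einf_lim; apply: lime_le; first exact: is_cvg_einfs.
apply: nearW => n; apply: le_trans (uc n); apply: ereal_inf_lbound.
by exists n => /=.
Qed.

Lemma fatou_Int (g_ : nat -> R -> R) g c :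
  (forall n, itg (g_ n)) -> measurable_fun [set: R] g ->
  (forall n x, 0 <= g_ n x) -> (forall x, 0 <= g x) ->
  {ae leb, forall x, g_ n x @[n --> \oo] --> g x} ->
  (forall n, Int (g_ n) <= c) -> itg g /\ Int g <= c.
Proof.
move=> gi mg g0 gg0 gcv gc.
have mE n : measurable_fun [set: R] (EFin \o g_ n) by exact: measurable_int (gi n).
have key : (\int[leb]_x (g x)%:E <= c%:E)%E.
  have aeF := ae_filter_ringOfSetsType leb.
  rewrite (@ae_eq_integral _ _ _ leb setT (fun x => limn_einf (fun n => (g_ n x)%:E)))//.
  - apply: le_trans (fatou leb measurableT mE _) _.
      by move=> n x _; rewrite lee_fin.
    by apply: limn_einf_le => n; rewrite EFin_Int// lee_fin.
  - exact/measurable_EFinP.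
  - have mesup : measurable_fun [set: R] (fun x => limn_esup (fun n => - (g_ n x)%:E)%E).
      apply: (@measurable_fun_limn_esup _ _ _ setT (fun n x => - (g_ n x)%:E)%E) => n.
      exact: measurableT_comp (mE n).
    exact: (measurableT_comp _ mesup).
  - apply: filterS gcv => x gx _ /=.
    have gx' : (g_ n x)%:E @[n --> \oo] --> (g x)%:E by apply: cvg_EFin => //; exact: nearW.
    by have [-> _] := cvg_limn_einf_sup gx'.
have ig : itg g by apply: ge0_itg => //; exact: le_lt_trans key (ltry _).
by split => //; rewrite -lee_fin -EFin_Int.
Qed.

(* Norms do not increase, so Fatou applied to [2 F^2 + 2 f^2 - (F - f)^2]
   upgrades almost-everywhere convergence to convergence in the mean. *)
Lemma ae_cvg_L2 (f_ : nat -> R -> R) f :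
  (forall n, sqi (f_ n)) -> sqi f ->
  (forall n, Int (fun x => f_ n x ^+ 2) <= Int (fun x => f x ^+ 2)) ->
  {ae leb, forall x, f_ n x @[n --> \oo] --> f x} ->
  Int (fun x => (f_ n x - f x) ^+ 2) @[n --> \oo] --> 0.
Proof.
move=> si fi le cv; apply/cvgrPdist_lt => e e0.
apply: contrapT => /= H.
(* Failure of convergence yields indices [phi n >= n] at which the distance stays at least [e];
   Fatou along [phi] then bounds [4 F] by [4 F - e]. *)
have ex n : exists m, (n <= m)%N /\ e <= Int (fun x => (f_ m x - f x) ^+ 2).
  apply: contrapT => H'; apply: H; exists n => // m /= nm.
  rewrite sub0r normrN ger0_norm; last by apply: Int_ge0 => x; rewrite sqr_ge0.
  by rewrite ltNge; apply/negP => em; apply: H'; exists m.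
have [phi phiP] := choice ex.
have sd n := sqiB (si n) fi.
have iF n : itg (fun x => 2 * f_ n x ^+ 2 + 2 * f x ^+ 2).
  by apply: itgD; apply: itgZ; [exact: (si n).2|exact: fi.2].
pose F := Int (fun x => f x ^+ 2).
have [||||||_] := @fatou_Int (fun n x => (2 * f_ (phi n) x ^+ 2 + 2 * f x ^+ 2) -
    (f_ (phi n) x - f x) ^+ 2) (fun x => 4 * f x ^+ 2) (4 * F - e).
- by move=> n; apply: itgB => //; exact: (sd _).2.
- by apply: measurable_funM => //; apply: measurable_funX; exact: fi.1.
- by move=> n x; have := sqr_ge0 (f_ (phi n) x + f x); nra.
- by move=> x; rewrite mulr_ge0// sqr_ge0.
- have aeF := ae_filter_ringOfSetsType leb.
  apply: filterS cv => x fx.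
  have {}fx : f_ (phi n) x @[n --> \oo] --> f x.
    apply: cvg_comp fx => A [N _ NA]; exists N => // n /= Nn; apply: NA => /=.
    exact: leq_trans Nn (phiP n).1.
  have c2 (u : nat -> R) (l : R) : u n @[n --> \oo] --> l -> u n ^+ 2 @[n --> \oo] --> l ^+ 2.
    by move=> ul; rewrite expr2; under eq_fun do rewrite expr2; exact: cvgM.
  rewrite (_ : 4 * f x ^+ 2 = (2 * f x ^+ 2 + 2 * f x ^+ 2) - (f x - f x) ^+ 2); last by ring.
  apply: cvgB; first by apply: cvgD; [apply: cvgMr; exact: c2|exact: cvg_cst].
  by apply: (c2 (fun n => f_ (phi n) x - f x)); apply: cvgB => //; exact: cvg_cst.
- move=> n; rewrite IntB//; last exact: (sd _).2.
  rewrite IntD ?IntZ//; [|exact: fi.2|exact: (si _).2|exact: itgZ (si _).2|exact: itgZ fi.2].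
  have := (phiP n).2; have := le (phi n); rewrite -/F; lra.
- rewrite IntZ; last exact: fi.2.
  by rewrite -/F; lra.
Qed.

Lemma steklov_cvg f : sqi f ->
  Int (fun x => (steklov n.+1%:R^-1 f x - f x) ^+ 2) @[n --> \oo] --> 0.
Proof.
move=> fi; apply: ae_cvg_L2 => //.
- by move=> n; exact: sqi_steklov.
- by move=> n; exact: Int_steklov_sqr.
- exact: steklov_ae.
Qed.

(** Riesz-Fischer with an explicit rate, which spares the extraction of a subsequence. The sum of
    the [2^n (d n x)^2] has integral at most the sum of the [2^-n], so it is finite almost
    everywhere, and then [|d n x| <= 2^-n + 2^n (d n x)^2] is summable. Fatou gives the distances to
    the limit. *)
Lemma sqi_complete (f_ : nat -> R -> R) : (forall n, sqi (f_ n)) ->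
  (forall n m, (n <= m)%N -> Int (fun x => (f_ m x - f_ n x) ^+ 2) <= (4^-1) ^+ n) ->
  exists2 f, sqi f & forall n, Int (fun x => (f x - f_ n x) ^+ 2) <= (4^-1) ^+ n.
Proof.
move=> si H; have sd n m := sqiB (si n) (si m).
have aux (a y : R) : 0 < a -> `|y| <= a^-1 + a * y ^+ 2.
  move=> a0; rewrite -(@ler_pM2l _ a)// mulrDr divff ?gt_eqF//.
  rewrite -[y ^+ 2]real_normK ?num_real//; move: `|y| => z.
  by have := sqr_ge0 (a * z - 1); have := sqr_ge0 (a * z); rewrite !expr2 => *; nra.
pose d n x := f_ n.+1 x - f_ n x.
have md n : measurable_fun [set: R] (EFin \o (fun x => 2 ^+ n * d n x ^+ 2)).
  by apply/measurable_EFinP; apply: measurable_funM => //; exact: itg_measurable (sd _ _).2.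
pose G x := (\sum_(n <oo) (2 ^+ n * d n x ^+ 2)%:E)%E.
have G0 n x : 0 <= 2 ^+ n * d n x ^+ 2 by rewrite mulr_ge0 ?sqr_ge0// exprn_ge0.
have cg : cvgn (series (fun n => 2^-1 ^+ n : R)).
  have -> : (fun n => 2^-1 ^+ n : R) = geometric 1 2^-1.
    by apply/funext => n; rewrite /= mul1r.
  by apply: is_cvg_geometric_series; rewrite ger0_norm//; lra.
have Gi : leb.-integrable setT G.
  apply/integrableP; split.
    by apply: ge0_emeasurable_sum => [n x _ _|n _]; [rewrite lee_fin|exact: md].
  have -> : (\int[leb]_x `|G x| = \int[leb]_x G x)%E.
    by apply: eq_integral => x _; rewrite gee0_abs//; apply: nneseries_ge0 => n _ _; rewrite lee_fin.
  rewrite integral_nneseries//; last by move=> n x _; rewrite lee_fin.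
  apply: (@le_lt_trans _ _ (\sum_(n <oo) (2^-1 ^+ n)%:E)%E).
    apply: lee_nneseries => [n _ _|n _].
      by apply: integral_ge0 => x _; rewrite lee_fin.
    rewrite EFin_Int; last by apply: itgZ; exact: (sd _ _).2.
    rewrite lee_fin IntZ; last exact: (sd _ _).2.
    apply: (@le_trans _ _ (2 ^+ n * (4^-1) ^+ n)); first by rewrite ler_wpM2l ?exprn_ge0 ?H.
    by rewrite -exprMn (_ : 2 * 4^-1 = 2^-1 :> R) //; field.
  have -> : (\sum_(n <oo) (2^-1 ^+ n : R)%:E = (limn (series (fun n => 2^-1 ^+ n : R)))%:E)%E.
    rewrite -EFin_lim//; congr (limn _); apply/funext => n /=.
    by rewrite -sumEFin.
  exact: ltry.
(* An upper limit is defined at every point and measurable, so no exceptional set has to be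
   removed. *)
pose f x := fine (limn_esup (fun n => (f_ n x)%:E)).
have mf : measurable_fun [set: R] f.
  apply: (measurableT_comp (@fine_measurable R setT measurableT)).
  apply: (@measurable_fun_limn_esup _ _ _ setT (fun n x => (f_ n x)%:E)) => n.
  by apply/measurable_EFinP; exact: (si n).1.
have fcv : {ae leb, forall x, f_ n x @[n --> \oo] --> f x}.
  have aeF := ae_filter_ringOfSetsType leb.
  apply: filterS (integrable_ae measurableT Gi) => x /(_ I) Gx.
  suff c : cvgn (f_ ^~ x).
    move/cvg_ex : c => [l fl].
    suff -> : f x = l by [].
    have fl' : (f_ n x)%:E @[n --> \oo] --> l%:E by apply: cvg_EFin => //; exact: nearW.
    by rewrite /f; have [_ ->] := cvg_limn_einf_sup fl'.
  have -> : f_ ^~ x = (fun n => f_ 0%N x + series (d ^~ x) n).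
    apply/funext => n; rewrite /series /d /=.
    by rewrite telescope_sumr// addrC subrK.
  apply: is_cvgD; first exact: is_cvg_cst.
  apply: normed_cvg.
  have cS : cvgn (series (fun n => 2^-1 ^+ n + 2 ^+ n * d n x ^+ 2 : R)).
    have -> : series (fun n => 2^-1 ^+ n + 2 ^+ n * d n x ^+ 2 : R) =
        (fun n => series (fun n => 2^-1 ^+ n) n + series (fun n => 2 ^+ n * d n x ^+ 2) n).
      by apply/funext => n; rewrite /series/= big_split.
    apply: is_cvgD => //; apply: nondecreasing_is_cvgn.
      by apply: nondecreasing_series => n _ _.
    exists (fine (G x)) => _ [n _ <-].
    rewrite -lee_fin fineK// /series/= -sumEFin.
    by apply: nneseries_lim_ge => k _ _; rewrite lee_fin.
  apply: series_le_cvg cS => n.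
  - by rewrite normr_ge0.
  - by rewrite addr_ge0// exprn_ge0.
  - by rewrite exprVn; apply: aux; rewrite exprn_gt0.
have key n : itg (fun x => (f x - f_ n x) ^+ 2) /\
    Int (fun x => (f x - f_ n x) ^+ 2) <= (4^-1) ^+ n.
  apply: (@fatou_Int (fun m x => (f_ (m + n)%N x - f_ n x) ^+ 2)).
  - by move=> m; exact: (sd _ _).2.
  - by apply: measurable_funX; apply: measurable_funB => //; exact: (si n).1.
  - by move=> m x; rewrite sqr_ge0.
  - by move=> x; rewrite sqr_ge0.
  - have aeF := ae_filter_ringOfSetsType leb.
    apply: filterS fcv => x fx.
    have fx' : f_ (m + n)%N x - f_ n x @[m --> \oo] --> f x - f_ n x.
      by apply: cvgB; [move: fx; rewrite -(cvg_shiftn n)|exact: cvg_cst].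
    by rewrite expr2; under eq_fun do rewrite expr2; exact: cvgM.
  - by move=> m; apply: H; exact: leq_addl.
exists f => [|n]; last exact: (key n).2.
have : sqi (fun x => f x - f_ 0%N x).
  by split; [apply: measurable_funB => //; exact: (si 0%N).1|exact: (key 0%N).1].
by move=> /sqiD /(_ (si 0%N)); congr sqi; apply/funext => x; rewrite subrK.
Qed.

End L2Limits.

(** * Test functions and the fundamental lemma *)

Section TestFunctions.
Variable R : realType.
Local Notation leb := (@lebesgue_measure R).
Local Notation U := (uniform_prob (@ltr01 R)).
Local Notation itg f := (leb.-integrable setT (EFin \o f)).
Local Notation "'Int' f" := (\int[leb]_x f x)%R (at level 10).
Implicit Types (f g phi : R -> R) (a b h c : R).

Lemma dominated_Int (g_ : nat -> R -> R) g G :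
  (forall n, measurable_fun [set: R] (g_ n)) -> measurable_fun [set: R] g ->
  (forall x, g_ n x @[n --> \oo] --> g x) -> itg G ->
  (forall n x, `|g_ n x| <= G x) -> Int (g_ n) @[n --> \oo] --> Int g.
Proof.
move=> mg_ mg gcv iG gG.
have [|||||ig _ cv] := @dominated_convergence _ _ _ leb setT measurableT
  (fun n x => (g_ n x)%:E) (EFin \o g) (EFin \o G).
- by move=> n; apply/measurable_EFinP; exact: mg_.
- exact/measurable_EFinP.
- by apply: aeW => x _; apply: cvg_EFin; [exact: nearW|exact: gcv].
- exact: iG.
- by apply: aeW => x n _; rewrite lee_fin.
by apply/fine_cvg; rewrite fineK//; exact: integrable_fin_num.
Qed.

Definition smooth f := forall n x, derivable (derive1n n f) x 1.

Definition csupp f := exists M, forall x, M < `|x| -> f x = 0.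

Lemma test_functionP f : test_function f <-> smooth f /\ csupp f.
Proof.
split=> [[sf cf]|[sf [M fM]]]; split => //.
  have [M [_ MK]] := compact_bounded cf.
  exists (M + 1) => x xM; apply: contrapT => /eqP fx.
  have := MK (M + 1); rewrite ltrDl ltr01 => /(_ isT x).
  move=> H; have : `|x| <= M + 1 by apply: H; exact: (@subset_closure _ [set y | f y != 0]).
  by rewrite leNgt xM.
apply: (subclosed_compact _ (@segment_compact R (- M) M)); first exact: closed_closure.
rewrite closureE => x /(_ `[-M, M]%classic); apply; split; first exact: itv_closed.
move=> y /= fy; rewrite in_itv/= -ler_norml leNgt; apply/negP => /fM fy0.
by rewrite fy0 eqxx in fy.
Qed.

Lemma smooth_continuous f : smooth f -> continuous f.
Proof.
move=> sf x; apply/differentiable_continuous/derivable1_diffP; exact: (sf 0%N).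
Qed.

Lemma smooth_derive1 f : smooth f -> smooth (derive1 f).
Proof. by move=> sf n; have := sf n.+1; rewrite /derive1n iterSr. Qed.

Lemma csupp_derive1 f : csupp f -> csupp (derive1 f).
Proof.
move=> [M fM]; exists M => x Mx.
rewrite derive1E (@near_eq_derive _ _ _ f (cst 0)) ?derive_cst//.
have : \forall y \near x, M < `|y|.
  have nx : `|y| @[y --> x] --> `|x| by exact: norm_continuous.
  by move/cvgrPdist_lt : nx => /(_ (`|x| - M)); rewrite subr_gt0 => /(_ Mx);
    apply: filterS => y; rewrite ltr_norml => /andP[_]; lra.
by apply: filterS => y /fM.
Qed.

Lemma test_derive1 f : test_function f -> test_function (derive1 f).
Proof.
by move=> /test_functionP[sf cf]; apply/test_functionP; split;
  [exact: smooth_derive1|exact: csupp_derive1].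
Qed.

Lemma cc_itg f : continuous f -> csupp f -> itg f.
Proof.
move=> cf [M fM].
have -> : f = f \_ (`[- M, M] : set R).
  apply/funext => x; rewrite patchE; case: ifPn => //.
  by rewrite mem_setE in_itv/= -ler_norml -ltNge => /fM ->.
rewrite -restrict_EFin; apply/integrable_restrict => //; rewrite setTI.
apply: continuous_compact_integrable; first exact: segment_compact.
exact: continuous_subspaceT.
Qed.

Lemma cc_sqi f : continuous f -> csupp f -> sqi f.
Proof.
move=> cf [M fM]; split; first exact: continuous_measurable_fun.
rewrite (_ : (fun x => _) = (fun x => f x * f x)); last by apply/funext => x; rewrite expr2.
apply: cc_itg; first by move=> x; apply: cvgM; exact: cf.
by exists M => x /fM ->; rewrite mul0r.
Qed.

Lemma test_sqi f : test_function f -> sqi f.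
Proof.
by move=> /test_functionP[sf cf]; apply: cc_sqi => //; exact: smooth_continuous.
Qed.

(* [expR (- 1/s) / s^k] for [s > 0], smoothly extended by [0]. *)
Definition flat k (s : R) : R := if 0 < s then s^-1 ^+ k * expR (- s^-1) else 0.

Lemma flatE k j s : s ^+ j * flat (j + k) s = flat k s.
Proof.
rewrite /flat; case: ifPn => s0; last by rewrite mulr0.
by rewrite exprD mulrA mulrA -exprMn mulfV ?gt_eqF// expr1n mul1r.
Qed.

Lemma flat_ge0 k s : 0 <= flat k s.
Proof.
rewrite /flat; case: ifPn => // s0.
by rewrite mulr_ge0 ?expR_ge0// exprn_ge0// invr_ge0 ltW.
Qed.

(** One term of the exponential series suffices: [e^v >= v^(k+1) / (k+1)!] at [v = 1/s]. A bound
    linear in [s] is what the derivative at zero requires. *)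
Lemma flat_le k s : flat k s <= k.+1`!%:R * `|s|.
Proof.
rewrite /flat; case: ifPn => s0; last by rewrite mulr_ge0.
rewrite gtr0_norm//.
have v0 : 0 < s^-1 by rewrite invr_gt0.
have := @expR_ge1Dxn R s^-1 k (ltW v0).
rewrite expRN; set v := s^-1 in v0 *; set e := expR v => H.
have e0 : 0 < e by rewrite expR_gt0.
have f0 : (0 : R) < k.+1`!%:R by rewrite ltr0n fact_gt0.
rewrite ler_pdivrMr//.
apply: (@le_trans _ _ (k.+1`!%:R * s * (v ^+ k.+1 / k.+1`!%:R))).
  have sv : s * v = 1 by rewrite mulfV ?gt_eqF.
  rewrite exprS (_ : _ * _ = (s * v) * (v ^+ k) * (k.+1`!%:R / k.+1`!%:R)); last by ring.
  by rewrite sv divff ?gt_eqF// mul1r mulr1.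
apply: ler_wpM2l; first by rewrite mulr_ge0// ltW.
by rewrite (le_trans _ H)// lerDr.
Qed.

(** Away from zero this is calculus. At zero the difference quotient is [flat k.+1] itself, by
    [flatE], and [flat_le] sends it to zero, so one formula covers all points. *)
Lemma is_derive_flat k s :
  is_derive s (1 : R) (flat k) (flat k.+2 s - k%:R * flat k.+1 s).
Proof.
have [s0|s0|<-] := ltgtP 0 s.
- pose e := ((fun x : R => x^-1) ^+ k) * (expR \o (fun x => - x^-1)).
  have dv : is_derive s (1 : R) (fun x => x^-1) (- (s ^- 2)).
    have := @is_deriveV _ id s 1 1; rewrite /= gt_eqF// => /(_ isT).
    by move=> /(_ (is_derive_id _ _)); rewrite scaler1.
  have de : is_derive s (1 : R) e (flat k.+2 s - k%:R * flat k.+1 s).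
    have dn : is_derive s (1 : R) (fun x => - x^-1) (s ^- 2).
      by have := is_deriveN dv; rewrite opprK.
    have := is_deriveM (is_deriveX k dv) (@is_derive1_comp R expR (fun x => - x^-1) s _ _ (is_derive_expR (- s^-1)) dn).
    move=> H; apply: (@is_derive_eq _ _ _ _ _ _ _ _ H); rewrite /flat s0 /= /GRing.scale/= -exprVn.
    rewrite (_ : ((fun x => x^-1) ^+ k) s = s^-1 ^+ k); last first.
      by elim: (k) => [|j IH]; rewrite ?expr0// !exprS -IH.
    by case: (k) => [|j]; rewrite /= ?exprS; ring.
  apply: near_eq_is_derive de; near=> x; rewrite /flat /e ifT; last first.
    by rewrite -oppr_lt0; near: x; apply: Nlt_nbhsl; rewrite oppr_lt0.
  rewrite /= [in LHS]/GRing.mul/=; congr (_ * _).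
  by elim: (k) => [|j IH]; rewrite ?expr0// !exprS -IH.
- rewrite {2 3}/flat ltNge ltW//= mulr0 subr0.
  apply: near_eq_is_derive (is_derive_cst 0 s 1); near=> x.
  rewrite /flat ifF//; apply/negbTE; rewrite -leNgt ltW//.
  by near: x; exact: lt_nbhsl.
- rewrite {2 3}/flat ltxx mulr0 subr0.
  have cv : h^-1 *: (flat k (h *: 1 + 0) - flat k 0) @[h --> 0^'] --> (0 : R).
    apply/cvgrPdist_le => e e0; near=> h.
    rewrite sub0r normrN /GRing.scale/= mulr1 addr0 [flat k 0]/flat ltxx subr0.
    have h0 : h != 0 by near: h; exact: nbhs_dnbhs_neq.
    rewrite -(flatE k 1) expr1 mulKf// ger0_norm ?flat_ge0//.
    rewrite (le_trans (flat_le _ _))// mulrC -ler_pdivlMr ?ltr0n ?fact_gt0//.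
    by near: h; apply: dnbhs0_le; rewrite divr_gt0// ltr0n fact_gt0.
  by apply: DeriveDef; [exact: (cvgP _ cv)|exact: cvg_lim cv].
Unshelve. all: by end_near. Qed.

End TestFunctions.

Section Fundamental.
Variable R : realType.
Local Notation leb := (@lebesgue_measure R).
Local Notation U := (uniform_prob (@ltr01 R)).
Local Notation itg f := (leb.-integrable setT (EFin \o f)).
Local Notation "'Int' f" := (\int[leb]_x f x)%R (at level 10).
Implicit Types (f g phi : R -> R) (a b h c : R).

(** With [q] fixed, this class is stable under differentiation, which yields smoothness by
    induction. *)
Definition bump k (p q : {poly R}) (x : R) : R := p.[x] * flat k q.[x].

(** [flatE] brings all orders to [k.+2] at the price of powers of [q], which the polynomial factor
    absorbs. *)
Lemma is_derive_bump k (p q : {poly R}) x : is_derive x (1 : R) (bump k p q)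
  (bump k.+2 (p^`() * q ^+ 2 + p * q^`() * (1 - k%:R *: q)) q x).
Proof.
have := is_deriveM (is_derive_poly p x)
  (is_derive1_comp (is_derive_flat k q.[x]) (is_derive_poly q x)).
move=> H; apply: (@is_derive_eq _ _ _ _ _ _ _ _ H).
rewrite /bump /GRing.scale/= -(flatE k 2) -(flatE k.+1 1) !hornerE /=; ring.
Qed.

Lemma smooth_bump k (p q : {poly R}) : smooth (bump k p q).
Proof.
move=> n x; have [j [r ->]] : exists j r, derive1n n (bump k p q) = bump j r q.
  elim: n => [|n [j [r IH]]]; first by exists k, p.
  rewrite derive1nS IH; exists j.+2, (r^`() * q ^+ 2 + r * q^`() * (1 - j%:R *: q)).
  apply/funext => y; rewrite derive1E.
  by have [_ ->] := is_derive_bump j r q y.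
by have [] := is_derive_bump j r q x.
Qed.

(** For [a < b] the quadratic is positive exactly on []a, b[]; the factor [n.+1] drives the values
    there to one, so the sequence tends to the indicator of the interval. *)
Definition bump_itv a b n : R -> R :=
  bump 0 1 (n.+1%:R *: (('X - a%:P) * (b%:P - 'X))).

Lemma bump_itvE a b n x :
  bump_itv a b n x = flat 0 (n.+1%:R * ((x - a) * (b - x))).
Proof. by rewrite /bump_itv /bump !hornerE. Qed.

Lemma test_bump_itv a b n : test_function (bump_itv a b n).
Proof.
apply/test_functionP; split; first exact: smooth_bump.
exists (`|a| + `|b|) => x xab; rewrite bump_itvE /flat ifF//.
apply/negbTE; rewrite pmulr_rgt0 ?ltr0n// -leNgt.
have := ler_norm a; have := ler_norm b; have := ler_norm (- a); have := ler_norm (- b).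
rewrite !normrN => *; move: xab; rewrite ltNge ler_norml negb_and -!ltNge => /orP[] xab.
  by rewrite nmulr_rle0; lra.
by rewrite pmulr_rle0; lra.
Qed.

Lemma flat0_le1 s : flat 0 s <= 1 :> R.
Proof.
rewrite /flat; case: ifPn => // s0.
by rewrite expr0 mul1r -expR0 ler_expR oppr_le0 invr_ge0 ltW.
Qed.

Lemma bump_itv_cvg a b x : a < b ->
  bump_itv a b n x @[n --> \oo] --> (\1_(`]a, b[ : set R) x : R).
Proof.
move=> ab; under eq_fun do rewrite bump_itvE.
rewrite indicE mem_setE in_itv/=.
case: (boolP (a < x < b)) => [/andP[ax xb]|xab]; last first.
  rewrite (_ : (fun n : nat => _) = cst 0); first exact: cvg_cst.
  apply/funext => n /=; rewrite /flat ifF//; apply/negbTE.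
  rewrite pmulr_rgt0 ?ltr0n// -leNgt; move: xab; rewrite negb_and -!leNgt => /orP[] xab.
    by rewrite mulr_le0_ge0//; lra.
  by rewrite mulr_ge0_le0//; lra.
set c := (x - a) * (b - x).
have c0 : 0 < c by rewrite mulr_gt0 ?subr_gt0.
rewrite (_ : (fun n : nat => _) = (fun n : nat => expR (- (n.+1%:R^-1 * c^-1)))); last first.
  by apply/funext => n; rewrite /flat mulr_gt0 ?ltr0n// expr0 mul1r invfM.
rewrite (_ : true%:R = expR (- 0) :> R); last by rewrite oppr0 expR0.
apply: continuous_cvg; first exact: continuous_expR.
 apply: cvgN; rewrite -(mul0r c^-1).
by apply: cvgM; [exact: cvg_harmonic|exact: cvg_cst].
Qed.

(** The bumps turn vanishing against test functions into vanishing of the integral over every open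
    interval, hence of every Steklov average, and [steklov_ae] concludes. *)
Lemma test_fundamental g : sqi g ->
  (forall phi, test_function phi -> Int (fun x => g x * phi x) = 0) ->
  {ae leb, forall x, g x = 0}.
Proof.
move=> gi g0.
have gab a b : a < b -> Int (g \_ (`]a, b[ : set R)) = 0.
  move=> ab.
  have iG : itg (fun x => `|(g \_ (`[a, b] : set R)) x|).
    have := @sqi_itv_itg R g `[a, b] a b (@subset_refl _ _) gi.
    by move=> /integrable_norm.
  have mgab : measurable_fun [set: R] (g \_ (`]a, b[ : set R)).
    by apply/(measurable_restrictT _ _).1 => //; apply: measurable_funTS; exact: gi.1.
  have cv : Int (fun x => g x * bump_itv a b n x) @[n --> \oo] --> Int (g \_ (`]a, b[ : set R)).
    apply: (dominated_Int _ mgab _ iG).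
    - by move=> n; apply: measurable_funM; [exact: gi.1|exact: (test_sqi (test_bump_itv a b n)).1].
    - move=> x; rewrite (_ : (g \_ _) x = g x * \1_(`]a, b[ : set R) x).
        by apply: cvgM; [exact: cvg_cst|exact: bump_itv_cvg].
      by rewrite patchE indicE; case: ifP; rewrite ?mulr1 ?mulr0.
    - move=> n x; rewrite patchE normrM; case: ifPn => xab.
        rewrite ler_piMr// bump_itvE ger0_norm ?flat_ge0//; exact: flat0_le1.
      rewrite bump_itvE [flat _ _](_ : _ = 0) ?normr0 ?mulr0//.
      rewrite /flat ifF//; apply/negbTE; rewrite pmulr_rgt0 ?ltr0n// -leNgt.
      move: xab; rewrite mem_setE in_itv/= negb_and -!ltNge => /orP[] xab.
        by rewrite mulr_le0_ge0//; lra.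
      by rewrite mulr_ge0_le0//; lra.
  apply/esym; move/cvg_lim : cv => <- //; rewrite (_ : (fun n : nat => _) = cst 0).
    by rewrite lim_cst.
  by apply/funext => n; rewrite g0//; exact: test_bump_itv.
have s0 n : steklov n.+1%:R^-1 g = cst 0.
  apply/funext => x; have n0 : (0 : R) < n.+1%:R^-1 by rewrite invr_gt0.
  apply: EFin_inj; rewrite (steklovE x n0 gi).
  have mg : measurable_fun [set: R] (EFin \o g) by apply/measurable_EFinP; exact: gi.1.
  rewrite -integral_itv_bndo_bndc; last exact: measurable_funTS.
  rewrite -integral_itv_obnd_cbnd; last exact: measurable_funTS.
  rewrite [X in (_ * X)%E](_ : _ = (Int (g \_ (`]x, (x + n.+1%:R^-1)%R[ : set R)))%:E).
    by rewrite gab ?mule0// ltrDl.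
  rewrite -EFin_Int; first by rewrite integral_mkcond restrict_EFin.
  by apply: (@sqi_itv_itg R g _ x (x + n.+1%:R^-1)) => // y; exact: subset_itv_oo_cc.
have aeF := ae_filter_ringOfSetsType leb.
apply: filterS (steklov_ae gi) => x; under eq_fun do rewrite s0.
by move/cvg_lim => <- //; rewrite lim_cst.
Qed.

Lemma amgm l a b : 0 < l -> `|a * b| <= l / 2 * b ^+ 2 + l^-1 / 2 * a ^+ 2.
Proof.
move=> l0; rewrite -(@ler_pM2l _ l)// normrM.
rewrite -[b ^+ 2]real_normK ?num_real// -[a ^+ 2]real_normK ?num_real//.
move: `|a| `|b| => {}a {}b.
rewrite (_ : l * (_ + _) = (l * b) ^+ 2 / 2 + a ^+ 2 / 2); last by field; rewrite gt_eqF.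
by have := sqr_ge0 (l * b - a); rewrite !expr2 => *; nra.
Qed.

Lemma sqi_shift c f : sqi f -> sqi (fun x => f (x + c)).
Proof.
move=> fi; have := sqi_affine c (oner_neq0 R) fi.
by congr sqi; apply/funext => x; rewrite mul1r.
Qed.

Lemma itg_shift c f : itg f -> itg (fun x => f (x + c)).
Proof.
move=> fi; have := itg_affine c (oner_neq0 R) fi.
by rewrite (_ : (fun x => _) = fun x => f (x + c)) //; apply/funext => x; rewrite mul1r.
Qed.

Lemma Int_shift c f : itg f -> Int (fun x => f (x + c)) = Int f.
Proof.
move=> fi; rewrite [RHS](Int_affine c (oner_neq0 R) fi) normr1 mul1r.
by apply: eq_Rintegral => x _; rewrite mul1r.
Qed.

(** [x] and [x + n] cannot both have absolute value below [n/2], so one factor of [f (x + n) * f x]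
    always belongs to the tail of [f]. The weighted inequality [amgm] charges a small weight [l] to
    the full mass and [l^-1] to the tail, which tends to zero. *)
Lemma Int_shift_mul_cvg0 f : sqi f ->
  Int (fun x => f (x + n%:R) * f x) @[n --> \oo] --> 0.
Proof.
move=> fi; pose A n : set R := [set x | n%:R <= `|x| * 2].
have mA n : measurable (A n).
  rewrite -[A n]setTI; apply: (measurable_fun_ler (D := setT) (f := cst n%:R)
    (g := fun x : R => `|x| * 2)) => //.
  by apply: measurable_funM => //; exact: measurable_normr.
pose t n := Int (fun x => f x ^+ 2 * \1_(A n) x).
have mt n : measurable_fun [set: R] (fun x => f x ^+ 2 * \1_(A n) x).
  by apply: measurable_funM; [exact: itg_measurable fi.2|exact: measurable_indic].
have it n : itg (fun x => f x ^+ 2 * \1_(A n) x).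
  apply: itg_le fi.2 _ => // x; rewrite normrM ger0_norm ?sqr_ge0//.
  by rewrite ler_piMr ?sqr_ge0// indicE; case: (_ \in _); rewrite ?normr1 ?normr0.
have t0 : t n @[n --> \oo] --> 0.
  have -> : 0 = Int (fun=> 0 : R) by rewrite Rintegral_cst// mul0r.
  apply: (dominated_Int _ _ _ fi.2) => //.
  - move=> x; apply/cvgrPdist_lt => e e0; exists (Num.truncn (`|x| * 2)).+1 => // n /= xn.
    rewrite indicE memNset ?mulr0 ?subrr ?normr0//= => H.
    have := truncnS_gt (`|x| * 2); rewrite ltNge => /negP; apply.
    by apply: le_trans H; rewrite ler_nat.
  - move=> n x; rewrite normrM ger0_norm ?sqr_ge0//.
    by rewrite ler_piMr ?sqr_ge0// indicE; case: (_ \in _); rewrite ?normr1 ?normr0.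
pose F := Int (fun x => f x ^+ 2).
have F0 : 0 <= F by apply: Int_ge0 => x; rewrite sqr_ge0.
have far (x c : R) : `|x| * 2 < c -> c <= `|x + c| * 2.
  move=> xc; have H1 : - x <= `|x| by rewrite -normrN ler_norm.
  by have H2 : x + c <= `|x + c| := ler_norm _; lra.
have bound n l : 0 < l -> `|Int (fun x => f (x + n%:R) * f x)| <= l * F + l^-1 * t n.
  move=> l0.
  pose r x := l / 2 * (f (x + n%:R) ^+ 2 + f x ^+ 2) + l^-1 / 2 *
    (f (x + n%:R) ^+ 2 * \1_(A n) (x + n%:R) + f x ^+ 2 * \1_(A n) x).
  have i1 := itg_shift n%:R fi.2; have i2 := itg_shift n%:R (it n).
  have ri : itg r by apply: itgD; apply: itgZ; apply: itgD => //; exact: fi.2.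
  have -> : l * F + l^-1 * t n = Int r.
    rewrite IntD; [|by apply: itgZ; apply: itgD => //; exact: fi.2|by apply: itgZ; apply: itgD].
    rewrite !IntZ; [|exact: itgD|by apply: itgD => //; exact: fi.2].
    rewrite !IntD ?(Int_shift n%:R fi.2) ?(Int_shift n%:R (it n))//; last exact: fi.2.
    by rewrite -/F -/(t n); field; rewrite gt_eqF.
  have si := sqi_shift n%:R fi.
  apply: le_trans (le_normr_Rintegral measurableT (sqi_mul si fi)) _.
  apply: Int_le => //; first exact: integrable_norm (sqi_mul si fi).
  move=> x; rewrite /r !indicE; set u := f (x + _); set v := f x.
  have ub : (x + n%:R \in A n) || (x \in A n).
    rewrite /A !mem_setE /=; apply/orP.
    by have [xn|xn] := leP n%:R (`|x| * 2); [right|left; exact: far].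
  have := sqr_ge0 u; have := sqr_ge0 v => v0 u0.
  have au : `|u * v| <= l / 2 * v ^+ 2 + l^-1 / 2 * u ^+ 2 by exact: amgm.
  have av : `|u * v| <= l / 2 * u ^+ 2 + l^-1 / 2 * v ^+ 2 by rewrite mulrC; exact: amgm.
  have lu : 0 <= l * u ^+ 2 by rewrite mulr_ge0// ltW.
  have lv : 0 <= l * v ^+ 2 by rewrite mulr_ge0// ltW.
  have li : 0 < l^-1 by rewrite invr_gt0.
  have liu : 0 <= l^-1 * u ^+ 2 by rewrite mulr_ge0// ltW.
  have liv : 0 <= l^-1 * v ^+ 2 by rewrite mulr_ge0// ltW.
  by case: (x + n%:R \in A n) ub; case: (x \in A n) => //= _; rewrite ?mulr1 ?mulr0; lra.
apply/cvgrPdist_le => e e0.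
(* With this [l] the mass term is at most [e / 2], also when [F = 0]; [l] being fixed, the tail is
   then made at most [l * e / 2]. *)
pose l := e / (2 * (F + 1)).
have l0 : 0 < l by rewrite divr_gt0// mulr_gt0// ltr_pwDr.
have lF : l * F <= e / 2.
  rewrite (_ : l * F = (e / 2) * (F / (F + 1))); last by rewrite /l; field; lra.
  by apply: ler_piMr; [rewrite divr_ge0// ltW|rewrite ler_pdivrMr; lra].
move/cvgrPdist_le : t0 => /(_ (l * e / 2)); rewrite divr_gt0 ?(mulr_gt0 l0)// => /(_ isT).
apply: filterS => n; rewrite !sub0r !normrN => tn.
rewrite (le_trans (bound n l l0))// [leRHS](splitr e) lerD//.
by rewrite mulrC ler_pdivrMr// (le_trans (ler_norm _))// (le_trans tn)//; by rewrite le_eqVlt; apply/orP; left; apply/eqP; field.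
Qed.

End Fundamental.

(** * Weak derivatives *)

Section WeakReal.
Variable R : realType.
Local Notation leb := (@lebesgue_measure R).
Local Notation U := (uniform_prob (@ltr01 R)).
Local Notation itg f := (leb.-integrable setT (EFin \o f)).
Local Notation "'Int' f" := (\int[leb]_x f x)%R (at level 10).
Implicit Types (f g phi : R -> R) (a b h c : R).

Lemma is_derive_comp_affine f a b x df : is_derive (a * x + b) (1 : R) f df ->
  is_derive x (1 : R) (fun y => f (a * y + b)) (a * df).
Proof.
move=> fx; have da : is_derive x (1 : R) (fun y => a * y + b) a.
  rewrite (_ : (fun y => _) = horner (a *: 'X + b%:P)); last first.
    by apply/funext => y; rewrite !hornerE.
  have := is_derive_poly (a *: 'X + b%:P) x.
  by rewrite derivD derivZ derivX derivC addr0 !hornerE.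
by rewrite mulrC; exact: (@is_derive1_comp R f (fun y => a * y + b)).
Qed.

Lemma is_derive1P f x : derivable f x 1 -> is_derive x (1 : R) f (derive1 f x).
Proof. by move=> /derivableP; rewrite derive1E. Qed.

Lemma is_derive1E f x df : is_derive x (1 : R) f df -> derive1 f x = df.
Proof. by case=> _; rewrite derive1E. Qed.

Definition dq h f (x : R) : R := h^-1 * (f (x + h) - f x).

Lemma is_derive_dq h f x : (forall y, derivable f y 1) ->
  is_derive x (1 : R) (dq h f) (dq h (derive1 f) x).
Proof.
move=> df; have d1 : is_derive x (1 : R) (fun y => f (y + h)) (derive1 f (x + h)).
  have := @is_derive_comp_affine f 1 h x (derive1 f (x + h)).
  rewrite !mul1r => /(_ (is_derive1P (df _))).
  by rewrite (_ : (fun y => _) = (fun y => f (y + h))) //; apply/funext => y; rewrite mul1r.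
exact: (is_deriveZ h^-1 (is_deriveB d1 (is_derive1P (df x)))).
Qed.

Lemma smooth_dq h f : smooth f -> smooth (dq h f).
Proof.
move=> sf; have E n : derive1n n (dq h f) = dq h (derive1n n f).
  elim: n => [//|n IH]; rewrite derive1nS IH; apply/funext => x.
  by rewrite (is_derive1E (is_derive_dq h x (sf n))).
by move=> n x; rewrite E; have [] := is_derive_dq h x (sf n).
Qed.

Lemma test_affine a b f : a != 0 -> test_function f ->
  test_function (fun x => f (a * x + b)).
Proof.
move=> a0 /test_functionP[sf [M fM]]; apply/test_functionP; split.
  have E n : derive1n n (fun x => f (a * x + b)) = (fun x => a ^+ n * derive1n n f (a * x + b)).
    elim: n => [|n IH]; first by apply/funext => x; rewrite mul1r.
    rewrite derive1nS IH; apply/funext => x; apply: is_derive1E.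
    rewrite exprSr -mulrA; apply: is_deriveZ.
    by apply: is_derive_comp_affine; rewrite derive1nS; exact/is_derive1P/sf.
  move=> n x; rewrite E; apply: derivableZ.
  by have [] := is_derive_comp_affine (is_derive1P (sf n (a * x + b))).
exists ((M + `|b|) / `|a|) => x; rewrite ltr_pdivrMr ?normr_gt0// => Mx.
apply: fM; have := ler_normB (a * x + b) b; rewrite addrK normrM mulrC.
by move: Mx; lra.
Qed.

Lemma steklov_derive1 h f x : h != 0 -> (forall y, derivable f y 1) ->
  continuous (derive1 f) -> steklov h (derive1 f) x = dq h f x.
Proof.
move=> h0 df cf; pose G s := h^-1 * f (h * s + x).
have dG s : is_derive s (1 : R) G (derive1 f (h * s + x)).
  have := is_deriveZ h^-1 (is_derive_comp_affine (is_derive1P (df (h * s + x)))).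
  by rewrite /GRing.scale/= mulKf.
have cG : continuous G.
  move=> s; apply/differentiable_continuous/derivable1_diffP; by have [] := dG s.
have caf : continuous (fun s => derive1 f (h * s + x)).
  move=> s; apply: (@continuous_comp _ _ _ (fun s => h * s + x) (derive1 f)); last exact: cf.
  by apply: cvgD; [apply: cvgMr; exact: cvg_id|exact: cvg_cst].
rewrite /steklov /Rintegral integral_unif_signed; last first.
  by apply/measurable_EFinP; exact: continuous_measurable_fun.
rewrite (@continuous_FTC2 R _ G 0 1 ltr01).
- by rewrite /= /G /dq mulr1 mulr0 add0r -mulrBr addrC [h + x]addrC addrC.
- exact: continuous_subspaceT.
- split; first by move=> s _; have [] := dG s.
    by apply: cvg_at_right_filter; exact: cG.
  by apply: cvg_at_left_filter; exact: cG.
- by move=> s _; rewrite (is_derive1E (dG s)).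
Qed.

Lemma csupp_steklov h f : measurable_fun [set: R] f -> csupp f -> csupp (steklov h f).
Proof.
move=> mf [M fM]; exists (M + `|h|) => x Mx; rewrite /steklov /Rintegral integral_unif_signed.
  rewrite integral0_eq// => s; rewrite /= in_itv/= => /andP[s0 s1]; rewrite fM//.
  have := ler_normB (h * s + x) (h * s); rewrite addrAC subrr add0r normrM.
  rewrite (ger0_norm s0); have : `|h| * s <= `|h| by rewrite ler_piMr.
  by move: Mx; lra.
by apply/measurable_EFinP; exact: measurable_comp_affine.
Qed.

Lemma test_primitive f : test_function f ->
  exists2 F : R -> R, (forall x : R, derivable F x 1) & derive1 F = f.
Proof.
move=> /test_functionP[sf cf]; have ctf := smooth_continuous sf.
have fi := cc_itg ctf cf.
pose F x := (\int[leb]_(t in `]-oo, x]) f t)%R.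
have H x : derivable F x 1 /\ derive1 F x = f x.
  apply: (@continuous_FTC1 R f -oo%O x (x + 1)) => //.
  - by rewrite ltrDl.
  - exact: integrableS fi.
  - by rewrite ltNyr.
  - exact: ctf.
by exists F => [x|]; [have [] := H x|apply/funext => x; have [] := H x].
Qed.

(** A primitive [F] of [f] need not have compact support, but its difference quotient, which is the
    average of [f], does. *)
Lemma test_steklov h f : h != 0 -> test_function f ->
  test_function (steklov h f) /\ derive1 (steklov h f) = dq h f.
Proof.
move=> h0 tf; have [F dF Ff] := test_primitive tf.
move/test_functionP : (tf) => [sf cf]; have ctf := smooth_continuous sf.
have sE : steklov h f = dq h F.
  have cF : continuous (derive1 F) by rewrite Ff.
  apply/funext => x; rewrite -Ff.
  exact: (steklov_derive1 x h0 dF cF).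
have dE : derive1 (steklov h f) = dq h f.
  by apply/funext => x; rewrite sE (is_derive1E (is_derive_dq h x dF)) Ff.
split; last exact: dE.
apply/test_functionP; split.
  case=> [|n] x; first by rewrite /= sE; have [] := is_derive_dq h x dF.
  by rewrite /derive1n iterSr dE; exact: smooth_dq.
by apply: csupp_steklov => //; exact: continuous_measurable_fun.
Qed.

Definition rwd f g := forall phi, test_function phi ->
  Int (fun x => f x * derive1 phi x) = - Int (fun x => g x * phi x).

Lemma rwd_unique f g g' : sqi g -> sqi g' -> rwd f g -> rwd f g' ->
  {ae leb, forall x, g x = g' x}.
Proof.
move=> gi gi' fg fg'; have aeF := ae_filter_ringOfSetsType leb.
apply: filterS (test_fundamental (sqiB gi gi') _) => [x /eqP|phi tp].
  by rewrite subr_eq0 => /eqP.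
have pi := test_sqi tp; under eq_Rintegral do rewrite mulrBl.
rewrite IntB ?sqi_mul//; apply/eqP; rewrite subr_eq0 -eqr_opp.
by rewrite -fg// fg'.
Qed.

Lemma sqi_dq h f : sqi f -> sqi (dq h f).
Proof.
move=> fi; have := sqi_lin h^-1 (sqiB (sqi_shift h fi) fi) (sqi_cst0 R).
by congr sqi; apply/funext => x; rewrite addr0.
Qed.

Lemma Int_dq_adj h f g : sqi f -> sqi g ->
  Int (fun x => dq h f x * g x) = - Int (fun x => f x * dq (- h) g x).
Proof.
move=> fi gi.
have s1 := sqi_mul (sqi_shift h fi) gi; have s2 := sqi_mul fi gi.
have s3 := sqi_mul fi (sqi_shift (- h) gi).
have -> : (fun x => dq h f x * g x) =
    (fun x => h^-1 * (f (x + h) * g x - f x * g x)).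
  by apply/funext => x; rewrite /dq; ring.
have -> : (fun x => f x * dq (- h) g x) =
    (fun x => - h^-1 * (f x * g (x - h) - f x * g x)).
  by apply/funext => x; rewrite /dq invrN; ring.
rewrite !IntZ ?IntB//; [|exact: itgB|exact: itgB].
have <- : Int (fun x => f (x + h) * g x) = Int (fun x => f x * g (x - h)).
  by rewrite -(Int_shift h s3); apply: eq_Rintegral => x _; rewrite addrK.
by ring.
Qed.

(** Averaging gains one derivative for an arbitrary square-integrable [f]: the adjoint average of
    [derive1 phi] is a difference quotient of [phi], which moves back onto [f]. *)
Lemma rwd_steklov h f : h != 0 -> sqi f -> rwd (steklov h f) (dq h f).
Proof.
move=> h0 fi phi tp; have tdp := test_derive1 tp.
rewrite Int_steklov_adj//; last exact: test_sqi.
rewrite Int_dq_adj ?opprK//; last exact: test_sqi.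
apply: eq_Rintegral => x _; rewrite steklov_derive1 ?oppr_eq0//.
  by have [dp _] := tp; exact: (dp 0%N).
by apply: smooth_continuous; have /test_functionP[] := tdp.
Qed.

(** [steklov (- h) phi] is again a test function, with derivative [dq (- h) phi]. Testing the weak
    derivative on it and moving both operators back identifies the two sides, so all difference
    quotients of [f] are bounded by [g]. *)
Lemma rwd_dq h f g : h != 0 -> sqi f -> sqi g -> rwd f g ->
  {ae leb, forall x, dq h f x = steklov h g x}.
Proof.
move=> h0 fi gi fg; have aeF := ae_filter_ringOfSetsType leb.
have di := sqi_dq h fi; have si := sqi_steklov h gi.
apply: filterS (test_fundamental (sqiB di si) _) => [x /eqP|phi tp].
  by rewrite subr_eq0 => /eqP.
have pi := test_sqi tp; under eq_Rintegral do rewrite mulrBl.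
rewrite IntB ?sqi_mul//; apply/eqP; rewrite subr_eq0; apply/eqP.
have hN0 : - h != 0 by rewrite oppr_eq0.
have [ts ds] := test_steklov hN0 tp.
by rewrite Int_dq_adj// Int_steklov_adj// -ds fg// opprK.
Qed.

Lemma rwd_affine a b f g : a != 0 -> sqi f -> sqi g -> rwd f g ->
  rwd (fun x => f (a * x + b)) (fun x => a * g (a * x + b)).
Proof.
move=> a0 fi gi fg phi tp.
pose psi y := phi (a^-1 * y + - (b / a)).
have psiE x : psi (a * x + b) = phi x by rewrite /psi; congr phi; field.
have ai : a^-1 != 0 by rewrite invr_eq0.
have tpsi : test_function psi by exact: test_affine.
have dpsi x : a * derive1 psi (a * x + b) = derive1 phi x.
  have [dphi _] := tp; have := is_derive_comp_affine (is_derive1P (dphi 0%N (a^-1 * (a * x + b) + - (b / a)))).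
  rewrite -/(derive1n 0 phi) => /is_derive1E; rewrite -/psi => ->.
  by rewrite mulVKf//; congr (derive1 phi _); field.
have := fg psi tpsi.
rewrite (Int_affine b a0) ?sqi_mul//; [|exact/test_sqi/test_derive1].
rewrite [X in _ = - X](Int_affine b a0) ?sqi_mul//; last exact: test_sqi.
rewrite -mulrN => /mulfI; rewrite normr_eq0 => /(_ a0) H.
have si : itg (fun x => f (a * x + b) * derive1 psi (a * x + b)).
  by apply: (itg_affine b a0 (f := fun x => f x * derive1 psi x)); apply: sqi_mul => //; exact/test_sqi/test_derive1.
have gi' : itg (fun x => g (a * x + b) * psi (a * x + b)).
  by apply: (itg_affine b a0 (f := fun x => g x * psi x)); apply: sqi_mul => //; exact/test_sqi.
transitivity (a * Int (fun x => f (a * x + b) * derive1 psi (a * x + b))).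
  by rewrite -IntZ//; apply: eq_Rintegral => x _; rewrite mulrCA dpsi.
rewrite H mulrN -IntZ//; congr (- _).
by apply: eq_Rintegral => x _; rewrite psiE mulrA.
Qed.

End WeakReal.

Local Open Scope quotient_scope.

(** * Symmetric forms *)

Section SymmetricForms.
Variables (R : realType) (V : lmodType R[i]).
Implicit Types (B : V -> V -> R) (x y z : V) (c : R).

(** Bilinear over the reals on a complex space: the energies involve only the real part of the
    Hermitian product. *)
Definition sform B := [/\ forall x y, B x y = B y x,
  forall x y z, B (x + y) z = B x z + B y z &
  forall c x y, B (c%:C *: x) y = c * B x y].

Section Theory.
Variable B : V -> V -> R.
Hypothesis sB : sform B.

Lemma formC x y : B x y = B y x. Proof. by case: sB. Qed.
Lemma formDl x y z : B (x + y) z = B x z + B y z. Proof. by case: sB. Qed.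
Lemma formZl c x y : B (c%:C *: x) y = c * B x y. Proof. by case: sB. Qed.
Lemma formDr x y z : B z (x + y) = B z x + B z y.
Proof. by rewrite formC formDl !(formC z). Qed.
Lemma formZr c x y : B y (c%:C *: x) = c * B y x.
Proof. by rewrite formC formZl (formC y). Qed.
Lemma formNl x y : B (- x) y = - B x y.
Proof.
have -> : - x = (-1)%:C *: x by rewrite rmorphN rmorph1 scaleN1r.
by rewrite formZl mulN1r.
Qed.
Lemma formNr x y : B y (- x) = - B y x.
Proof. by rewrite formC formNl (formC y). Qed.
Lemma formBl x y z : B (x - y) z = B x z - B y z.
Proof. by rewrite formDl formNl. Qed.
Lemma formBr x y z : B z (x - y) = B z x - B z y.
Proof. by rewrite formDr formNr. Qed.
Lemma form0l y : B 0 y = 0.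
Proof. by rewrite -[0 in LHS](subrr y) formBl subrr. Qed.
Lemma formDD x y : B (x + y) (x + y) = B x x + 2 * B x y + B y y.
Proof. by rewrite formDl !formDr (formC y x); ring. Qed.
Lemma formBB x y : B (x - y) (x - y) = B x x - 2 * B x y + B y y.
Proof. by rewrite formBl !formBr (formC y x); ring. Qed.
Lemma formZZ c x : B (c%:C *: x) (c%:C *: x) = c ^+ 2 * B x x.
Proof. by rewrite formZl formZr expr2 mulrA. Qed.

Hypothesis B0 : forall x, 0 <= B x x.

(** The form may be degenerate, so [B y y = 0] is treated apart: there [B x x + 2 t B x y >= 0] for
    all [t] forces [B x y = 0]. *)
Lemma form_CS x y : B x y ^+ 2 <= B x x * B y y.
Proof.
have [y0|y0] := eqVneq (B y y) 0.
  have H t : 0 <= B x x + 2 * t * B x y.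
    have := B0 (x + t%:C *: y); rewrite formDD formZr formZZ y0 mulr0 addr0.
    by rewrite mulrA.
  suff -> : B x y = 0 by rewrite expr0n /= mulr_ge0.
  apply/eqP; apply: contraT => xy.
  have := H (- (B x x + 1) / (2 * B x y)).
  have -> : 2 * (- (B x x + 1) / (2 * B x y)) * B x y = - (B x x + 1) by field.
  by lra.
have {}y0 : 0 < B y y by rewrite lt_neqAle eq_sym y0 B0.
have := B0 (x - (B x y / B y y)%:C *: y).
rewrite formBB formZr formZZ => H.
rewrite -subr_ge0 (_ : _ - _ = B y y *
  (B x x - 2 * (B x y / B y y * B x y) + (B x y / B y y) ^+ 2 * B y y)).
  by rewrite mulr_ge0// ltW.
by field; rewrite gt_eqF.
Qed.

Definition fnorm x := Num.sqrt (B x x).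

Lemma fnorm_ge0 x : 0 <= fnorm x. Proof. exact: sqrtr_ge0. Qed.

Lemma fnorm_sqr x : fnorm x ^+ 2 = B x x.
Proof. by rewrite sqr_sqrtr. Qed.

Lemma form_le x y : `|B x y| <= fnorm x * fnorm y.
Proof.
rewrite /fnorm -sqrtrM// -sqrtr_sqr; apply: ler_wsqrtr; exact: form_CS.
Qed.

Lemma fnormD x y : fnorm (x + y) <= fnorm x + fnorm y.
Proof.
rewrite -(@ler_pXn2r _ 2)// ?nnegrE ?addr_ge0 ?fnorm_ge0// sqrrD !fnorm_sqr formDD.
by have := le_trans (ler_norm _) (form_le x y); rewrite -mulr_natl; lra.
Qed.

Lemma fnormZ c x : fnorm (c%:C *: x) = `|c| * fnorm x.
Proof. by rewrite /fnorm formZZ sqrtrM ?sqr_ge0// sqrtr_sqr. Qed.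

Lemma fnormN x : fnorm (- x) = fnorm x.
Proof. by rewrite /fnorm formNl formNr opprK. Qed.

Lemma fnormB x y : fnorm (x - y) <= fnorm x + fnorm y.
Proof. by rewrite -(fnormN y) fnormD. Qed.

Lemma fnorm_distC x y : fnorm (x - y) = fnorm (y - x).
Proof. by rewrite -opprB fnormN. Qed.

Lemma fnorm_dist x y : `|fnorm x - fnorm y| <= fnorm (x - y).
Proof.
rewrite ler_norml; apply/andP; split.
  by have := fnormD (y - x) x; rewrite subrK fnorm_distC; lra.
by have := fnormD (x - y) y; rewrite subrK; lra.
Qed.

Lemma form_cvg (x_ : nat -> V) x y : fnorm (x_ n - x) @[n --> \oo] --> 0 ->
  B (x_ n) y @[n --> \oo] --> B x y.
Proof.
move=> cx; apply/cvgrPdist_le => e e0.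
have fy : 0 < fnorm y + 1 by rewrite ltr_wpDl ?fnorm_ge0.
move/cvgrPdist_le : cx => /(_ (e / (fnorm y + 1)) (divr_gt0 e0 fy)).
apply: filterS => n; rewrite sub0r normrN ger0_norm ?fnorm_ge0// => H.
rewrite distrC -formBl (le_trans (form_le _ _))//.
rewrite ler_pdivlMr// in H; apply: le_trans H.
by rewrite ler_wpM2l ?fnorm_ge0// lerDl.
Qed.

End Theory.
End SymmetricForms.

(** * Almost-everywhere equalities *)

Section AlmostEverywhere.
Variable R : realType.
Local Notation leb := (@lebesgue_measure R).

Lemma ae_and (P Q : R -> Prop) : {ae leb, forall x, P x} ->
  {ae leb, forall x, Q x} -> {ae leb, forall x, P x /\ Q x}.
Proof.
have aeF := ae_filter_ringOfSetsType leb.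
exact: filterI.
Qed.

Lemma ae_affine a b (Q : R -> Prop) : a != 0 ->
  {ae leb, forall x, Q x} -> {ae leb, forall x, Q (a * x + b)}.
Proof.
move=> a0 [N [mN N0 QN]]; exists (affine a b @^-1` N); split.
- by rewrite -[X in measurable X]setTI; exact: measurable_affine.
- have := lebesgue_measure_affine b a0 mN; rewrite N0 => /esym/eqP.
  by rewrite mule_eq0 eqe normr_eq0 (negbTE a0) => /eqP.
- by move=> x /= nQ; exact: QN.
Qed.

(** By contraction, the average of a function that vanishes almost everywhere has zero L^2 norm. *)
Lemma steklov_ae_eq h (f g : R -> R) : sqi f -> sqi g ->
  {ae leb, forall x, f x = g x} -> {ae leb, forall x, steklov h f x = steklov h g x}.
Proof.
move=> fi gi fg; have aeF := ae_filter_ringOfSetsType leb.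
have di : sqi (fun x => -1 * g x + f x) := sqi_lin (-1) gi fi.
have : {ae leb, forall x, steklov h (fun x => -1 * g x + f x) x = 0}.
  apply: Int_sqr_eq0; first exact: sqi_steklov.
  apply/eqP; rewrite eq_le Int_ge0 ?andbT; last by move=> x; rewrite sqr_ge0.
  rewrite (le_trans (Int_steklov_sqr h di))//.
  rewrite (_ : (\int[leb]_x _)%R = (\int[leb]_x (fun=> 0 : R) x)%R).
    by rewrite Rintegral_cst// mul0r.
  apply: Int_ae; [exact: itg_measurable di.2|exact: measurable_cst|].
  by apply: filterS fg => x ->; rewrite mulN1r addNr expr0n.
by apply: filterS => x; rewrite steklov_lin// => /eqP; rewrite mulN1r addrC subr_eq0 => /eqP.
Qed.

End AlmostEverywhere.

(** * The space L^2 and its operators *)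

Section L2Space.
Variable R : realType.
Local Notation leb := (@lebesgue_measure R).
Local Notation itg f := (leb.-integrable setT (EFin \o f)).
Local Notation "'Int' f" := (\int[leb]_x f x)%R (at level 10).
Implicit Types (f g : R -> R) (u v w : L2 R) (a b h c : R).

Definition reL u (x : R) : R := complex.Re (u x).
Definition imL u (x : R) : R := complex.Im (u x).

Lemma sqi_square_integrable f g : sqi f -> sqi g ->
  (fun x => f x +i* g x) \in @square_integrable R.
Proof.
move=> [mf fi] [mg gi]; rewrite inE; split => //.
under eq_integral do rewrite normc_sqE /=.
by rewrite EFin_Int ?ltry//; exact: itgD.
Qed.

Lemma square_integrable_sqi (F : R -> R[i]) : F \in @square_integrable R ->
  sqi (fun x => complex.Re (F x)) /\ sqi (fun x => complex.Im (F x)).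
Proof.
rewrite inE => -[[mr mi] F2].
have iF : itg (fun x => ComplexField.Normc.normc (F x) ^+ 2).
  by apply: ge0_itg => //; [exact: measurable_normc_sq|move=> x; rewrite sqr_ge0].
split; split => //; apply: itg_le iF _.
- exact: measurable_funX.
- by move=> x; rewrite normc_sqE ger0_norm ?sqr_ge0// lerDl sqr_ge0.
- exact: measurable_funX.
- by move=> x; rewrite normc_sqE ger0_norm ?sqr_ge0// lerDr sqr_ge0.
Qed.

Lemma sqi_reL u : sqi (reL u).
Proof. by have [] := square_integrable_sqi (valP (repr u)). Qed.

Lemma sqi_imL u : sqi (imL u).
Proof. by have [] := square_integrable_sqi (valP (repr u)). Qed.

Lemma L2_ext u w : {ae leb, forall x, reL u x = reL w x} ->
  {ae leb, forall x, imL u x = imL w x} -> u = w.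
Proof.
move=> rr ii; have aeF := ae_filter_ringOfSetsType leb.
rewrite -[u]reprK -[w]reprK; apply/eqP; rewrite -Quotient.idealrBE inE /=.
apply: filterS2 rr ii => x; rewrite /reL /imL /L2_repr => xr xi.
apply: (@eq_trans _ _ (L2fun_val (repr u) x - L2fun_val (repr w) x)); first by [].
by apply/eqP; rewrite subr_eq0 eq_complex xr xi !eqxx.
Qed.

Lemma repr_pi (F : L2fun R) : {ae leb, forall x, L2_repr (\pi_(L2 R) F) x = F x}.
Proof.
have : repr (\pi_(L2 R) F) - F \in @null_L2fun R.
  by rewrite Quotient.idealrBE reprK.
rewrite inE; have aeF := ae_filter_ringOfSetsType leb.
by apply: filterS => x /eqP; rewrite subr_eq0 => /eqP.
Qed.

Lemma L2_lin_ae (k : R[i]) u w :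
  {ae leb, forall x, L2_repr (k *: u + w) x = k * u x + w x}.
Proof.
have : repr (k *: u + w) - (k *: repr u + repr w) \in @null_L2fun R.
  rewrite Quotient.idealrBE reprK; apply/eqP; rewrite pi_L2D reprK.
  by congr (_ + _).
rewrite inE; have aeF := ae_filter_ringOfSetsType leb.
by apply: filterS => x /eqP; rewrite subr_eq0 => /eqP.
Qed.

Lemma reL_lin (k : R[i]) u w : {ae leb, forall x, reL (k *: u + w) x =
  complex.Re k * reL u x - complex.Im k * imL u x + reL w x}.
Proof.
have aeF := ae_filter_ringOfSetsType leb.
by apply: filterS (L2_lin_ae k u w) => x; rewrite /reL => ->; exact: ReMD.
Qed.

Lemma imL_lin (k : R[i]) u w : {ae leb, forall x, imL (k *: u + w) x =
  complex.Re k * imL u x + complex.Im k * reL u x + imL w x}.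
Proof.
have aeF := ae_filter_ringOfSetsType leb.
by apply: filterS (L2_lin_ae k u w) => x; rewrite /imL => ->; exact: ImMD.
Qed.

(* The class of [f + i g]; it is [0] when [f] or [g] is not square integrable. *)
Definition mkL2 f g : L2 R := \pi_(L2 R) (insubd 0 (fun x => f x +i* g x)).

Lemma mkL2_ae f g : sqi f -> sqi g ->
  {ae leb, forall x, L2_repr (mkL2 f g) x = f x +i* g x}.
Proof.
move=> fi gi; have aeF := ae_filter_ringOfSetsType leb.
apply: filterS (repr_pi (insubd 0 (fun x => f x +i* g x))) => x ->.
by have := insubdK (0 : L2fun R) (sqi_square_integrable fi gi) => /= ->.
Qed.

Lemma reL_mk f g : sqi f -> sqi g -> {ae leb, forall x, reL (mkL2 f g) x = f x}.
Proof.
move=> fi gi; have aeF := ae_filter_ringOfSetsType leb.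
by apply: filterS (mkL2_ae fi gi) => x; rewrite /reL => ->.
Qed.

Lemma imL_mk f g : sqi f -> sqi g -> {ae leb, forall x, imL (mkL2 f g) x = g x}.
Proof.
move=> fi gi; have aeF := ae_filter_ringOfSetsType leb.
by apply: filterS (mkL2_ae fi gi) => x; rewrite /imL => ->.
Qed.

Lemma Int_reL_lin (k : R[i]) u w g : sqi g ->
  Int (fun x => reL (k *: u + w) x * g x) =
  complex.Re k * Int (fun x => reL u x * g x) -
  complex.Im k * Int (fun x => imL u x * g x) + Int (fun x => reL w x * g x).
Proof.
move=> gi; have aeF := ae_filter_ringOfSetsType leb.
have i1 := sqi_mul (sqi_reL u) gi; have i2 := sqi_mul (sqi_imL u) gi.
have i3 := sqi_mul (sqi_reL w) gi.
rewrite -!IntZ// -IntB ?itgZ// -IntD//; last by apply: itgB; exact: itgZ.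
apply: Int_ae.
- exact: itg_measurable (sqi_mul (sqi_reL _) gi).
- by apply: itg_measurable; apply: itgD => //; apply: itgB; exact: itgZ.
- by apply: filterS (reL_lin k u w) => x ->; ring.
Qed.

Lemma Int_imL_lin (k : R[i]) u w g : sqi g ->
  Int (fun x => imL (k *: u + w) x * g x) =
  complex.Re k * Int (fun x => imL u x * g x) +
  complex.Im k * Int (fun x => reL u x * g x) + Int (fun x => imL w x * g x).
Proof.
move=> gi; have aeF := ae_filter_ringOfSetsType leb.
have i1 := sqi_mul (sqi_reL u) gi; have i2 := sqi_mul (sqi_imL u) gi.
have i3 := sqi_mul (sqi_imL w) gi.
rewrite -!IntZ// -IntD ?itgZ// -IntD//; last by apply: itgD; exact: itgZ.
apply: Int_ae.
- exact: itg_measurable (sqi_mul (sqi_imL _) gi).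
- by apply: itg_measurable; apply: itgD => //; apply: itgD; exact: itgZ.
- by apply: filterS (imL_lin k u w) => x ->; ring.
Qed.

(* The real part of the complex inner product. *)
Definition ip u w : R :=
  Int (fun x => reL u x * reL w x) + Int (fun x => imL u x * imL w x).

Lemma ip_form : sform ip.
Proof.
split.
- by move=> u w; rewrite /ip; congr (_ + _); apply: eq_Rintegral => x _; rewrite mulrC.
- move=> u v w; rewrite /ip -[u in LHS]scale1r Int_reL_lin ?Int_imL_lin/=; try exact: sqi_reL; try exact: sqi_imL.
  by ring.
- move=> c u w; rewrite /ip -[c%:C *: u]addr0 Int_reL_lin ?Int_imL_lin/=; try exact: sqi_reL; try exact: sqi_imL.
  have z0 g : sqi g -> Int (fun x => reL 0 x * g x) = 0.
    move=> gi; have := Int_reL_lin 1 0 0 gi; rewrite scaler0 addr0 /= mul0r mul1r; lra.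
  have z1 g : sqi g -> Int (fun x => imL 0 x * g x) = 0.
    move=> gi; have := Int_imL_lin 1 0 0 gi; rewrite scaler0 addr0 /= mul0r mul1r; lra.
  by rewrite z0 ?z1; [ring|exact: sqi_imL|exact: sqi_reL].
Qed.

Lemma ip_ge0 u : 0 <= ip u u.
Proof. by rewrite addr_ge0// Int_ge0// => x; rewrite -expr2 sqr_ge0. Qed.

Lemma ipE u : ip u u = Int (fun x => reL u x ^+ 2) + Int (fun x => imL u x ^+ 2).
Proof. by congr (_ + _); apply: eq_Rintegral => x _; rewrite expr2. Qed.

Lemma reL0 : {ae leb, forall x, reL 0 x = 0}.
Proof.
have aeF := ae_filter_ringOfSetsType leb.
by apply: filterS (reL_lin 1 0 0) => x; rewrite scaler0 addr0 /= => H; lra.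
Qed.

Lemma imL0 : {ae leb, forall x, imL 0 x = 0}.
Proof.
have aeF := ae_filter_ringOfSetsType leb.
by apply: filterS (imL_lin 1 0 0) => x; rewrite scaler0 addr0 /= => H; lra.
Qed.

Lemma ip_eq0 u : ip u u = 0 -> u = 0.
Proof.
move=> /eqP; rewrite ipE paddr_eq0 ?Int_ge0//; [|by move=> x; rewrite sqr_ge0..].
have aeF := ae_filter_ringOfSetsType leb.
move=> /andP[/eqP r0 /eqP i0]; apply: L2_ext.
  by apply: filterS2 (Int_sqr_eq0 (sqi_reL u) r0) reL0 => x -> ->.
by apply: filterS2 (Int_sqr_eq0 (sqi_imL u) i0) imL0 => x -> ->.
Qed.

Lemma L2_normE u : L2_norm u = fnorm ip u.
Proof.
rewrite /L2_norm /fnorm ipE -IntD; [|exact: (sqi_reL u).2|exact: (sqi_imL u).2].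
by congr Num.sqrt; apply: eq_Rintegral => x _; rewrite normc_sqE.
Qed.

Lemma ip_mk u f g : sqi f -> sqi g ->
  ip u (mkL2 f g) = Int (fun x => reL u x * f x) + Int (fun x => imL u x * g x).
Proof.
move=> fi gi; have aeF := ae_filter_ringOfSetsType leb; congr (_ + _); apply: Int_ae.
- exact: itg_measurable (sqi_mul (sqi_reL u) (sqi_reL _)).
- exact: itg_measurable (sqi_mul (sqi_reL u) fi).
- by apply: filterS (reL_mk fi gi) => x ->.
- exact: itg_measurable (sqi_mul (sqi_imL u) (sqi_imL _)).
- exact: itg_measurable (sqi_mul (sqi_imL u) gi).
- by apply: filterS (imL_mk fi gi) => x ->.
Qed.

End L2Space.

(* The operators are locked: unifying two applications to different arguments
   would otherwise unfold down to Lebesgue integrals. *)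
HB.lock Definition pull (R : realType) (a b : R) (u : L2 R) : L2 R :=
  mkL2 (fun x => reL u (a * x + b)) (fun x => imL u (a * x + b)).

HB.lock Definition St (R : realType) (h : R) (u : L2 R) : L2 R :=
  mkL2 (steklov h (reL u)) (steklov h (imL u)).

Section L2Operators.
Variable R : realType.
Local Notation leb := (@lebesgue_measure R).
Local Notation itg f := (leb.-integrable setT (EFin \o f)).
Local Notation "'Int' f" := (\int[leb]_x f x)%R (at level 10).
Implicit Types (f g : R -> R) (u v w : L2 R) (a b h c : R).
Let aeF := ae_filter_ringOfSetsType leb.
Local Existing Instance aeF.

Lemma reLZ c u : {ae leb, forall x, reL (c%:C *: u) x = c * reL u x}.
Proof.
apply: filterS2 (reL_lin c%:C u 0) (reL0 R) => x.
by rewrite addr0 /= mul0r subr0 => -> ->; rewrite addr0.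
Qed.

Lemma imLZ c u : {ae leb, forall x, imL (c%:C *: u) x = c * imL u x}.
Proof.
apply: filterS2 (imL_lin c%:C u 0) (imL0 R) => x.
by rewrite addr0 /= mul0r addr0 => -> ->; rewrite addr0.
Qed.

Lemma reLB u w : {ae leb, forall x, reL (u - w) x = reL u x - reL w x}.
Proof.
apply: filterS (reL_lin (-1) w u) => x.
by rewrite scaleN1r addrC /= => ->; rewrite oppr0; ring.
Qed.

Lemma imLB u w : {ae leb, forall x, imL (u - w) x = imL u x - imL w x}.
Proof.
apply: filterS (imL_lin (-1) w u) => x.
by rewrite scaleN1r addrC /= => ->; rewrite oppr0; ring.
Qed.

Lemma Int_sqi_ae f f' g g' : sqi f -> sqi f' -> sqi g -> sqi g' ->
  {ae leb, forall x, f x = f' x} -> {ae leb, forall x, g x = g' x} ->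
  Int (fun x => f x * g x) = Int (fun x => f' x * g' x).
Proof.
move=> fi fi' gi gi' ff gg; apply: Int_ae.
- exact: itg_measurable (sqi_mul fi gi).
- exact: itg_measurable (sqi_mul fi' gi').
- by apply: filterS2 ff gg => x -> ->.
Qed.

Section Pull.
Variables (a b : R).
Hypothesis a0 : a != 0.

Lemma reL_pull u : {ae leb, forall x, reL (pull a b u) x = reL u (a * x + b)}.
Proof. by rewrite pull.unlock; apply: reL_mk; apply: sqi_affine => //; [exact: sqi_reL|exact: sqi_imL]. Qed.

Lemma imL_pull u : {ae leb, forall x, imL (pull a b u) x = imL u (a * x + b)}.
Proof. by rewrite pull.unlock; apply: imL_mk; apply: sqi_affine => //; [exact: sqi_reL|exact: sqi_imL]. Qed.

Lemma pull_lin (k : R[i]) u w :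
  pull a b (k *: u + w) = k *: pull a b u + pull a b w.
Proof.
have H1 := ae_and (reL_pull u) (imL_pull u); have H2 := ae_and (reL_pull w) (imL_pull w).
apply: L2_ext.
- have H3 := ae_and (reL_lin k (pull a b u) (pull a b w)) (ae_affine b a0 (reL_lin k u w)).
  have H4 := ae_and H1 H2.
  apply: filterS3 H3 H4 (reL_pull (k *: u + w)).
  by move=> x [-> e] [[-> ->] [-> _]] ->.
- have H3 := ae_and (imL_lin k (pull a b u) (pull a b w)) (ae_affine b a0 (imL_lin k u w)).
  have H4 := ae_and H1 H2.
  apply: filterS3 H3 H4 (imL_pull (k *: u + w)).
  by move=> x [-> e] [[-> ->] [_ ->]] ->.
Qed.

Lemma ip_pull u w : ip (pull a b u) (pull a b w) = `|a|^-1 * ip u w.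
Proof.
have sr v : sqi (fun x => reL v (a * x + b)) by exact: sqi_affine (sqi_reL v).
have si v : sqi (fun x => imL v (a * x + b)) by exact: sqi_affine (sqi_imL v).
rewrite /ip mulrDr; congr (_ + _).
  rewrite (Int_affine b a0 (sqi_mul (sqi_reL u) (sqi_reL w))) mulKf ?normr_eq0//.
  by apply: Int_sqi_ae; rewrite ?sr//; try exact: sqi_reL; exact: reL_pull.
rewrite (Int_affine b a0 (sqi_mul (sqi_imL u) (sqi_imL w))) mulKf ?normr_eq0//.
by apply: Int_sqi_ae; rewrite ?si//; try exact: sqi_imL; exact: imL_pull.
Qed.

End Pull.

Let n10 : (1 : R) != 0 := oner_neq0 R.

Lemma pull_shiftK h u : pull 1 (- h) (pull 1 h u) = u.
Proof.
apply: L2_ext.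
  apply: filterS2 (reL_pull (- h) n10 (pull 1 h u)) (ae_affine (- h) n10 (reL_pull h n10 u)).
  by move=> x -> ->; rewrite !mul1r subrK.
apply: filterS2 (imL_pull (- h) n10 (pull 1 h u)) (ae_affine (- h) n10 (imL_pull h n10 u)).
by move=> x -> ->; rewrite !mul1r subrK.
Qed.

Lemma ip_shift h u w : ip (pull 1 h u) (pull 1 h w) = ip u w.
Proof. by rewrite ip_pull// normr1 invr1 mul1r. Qed.

Lemma ip_shift_adj h u w : ip (pull 1 h u) w = ip u (pull 1 (- h) w).
Proof.
by rewrite -(ip_shift (- h) (pull 1 h u) w) pull_shiftK.
Qed.

Lemma reL_shift h u : {ae leb, forall x, reL (pull 1 h u) x = reL u (x + h)}.
Proof. by apply: filterS (reL_pull h n10 u) => x; rewrite mul1r. Qed.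

Lemma imL_shift h u : {ae leb, forall x, imL (pull 1 h u) x = imL u (x + h)}.
Proof. by apply: filterS (imL_pull h n10 u) => x; rewrite mul1r. Qed.

Lemma ip_shift_cvg0 u : ip (pull 1 n%:R u) u @[n --> \oo] --> 0.
Proof.
have -> : (fun n => ip (pull 1 n%:R u) u) =
    (fun n => Int (fun x => reL u (x + n%:R) * reL u x) +
              Int (fun x => imL u (x + n%:R) * imL u x)).
  apply/funext => n; congr (_ + _); apply: Int_sqi_ae.
  - exact: sqi_reL.
  - exact/sqi_shift/sqi_reL.
  - exact: sqi_reL.
  - exact: sqi_reL.
  - exact: reL_shift.
  - exact: aeW.
  - exact: sqi_imL.
  - exact/sqi_shift/sqi_imL.
  - exact: sqi_imL.
  - exact: sqi_imL.
  - exact: imL_shift.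
  - exact: aeW.
rewrite -[X in _ --> X](addr0 (0 : R)).
by apply: cvgD; apply: Int_shift_mul_cvg0; [exact: sqi_reL|exact: sqi_imL].
Qed.

Lemma reL_St h u : {ae leb, forall x, reL (St h u) x = steklov h (reL u) x}.
Proof. by rewrite St.unlock; apply: reL_mk; apply: sqi_steklov; [exact: sqi_reL|exact: sqi_imL]. Qed.

Lemma imL_St h u : {ae leb, forall x, imL (St h u) x = steklov h (imL u) x}.
Proof. by rewrite St.unlock; apply: imL_mk; apply: sqi_steklov; [exact: sqi_reL|exact: sqi_imL]. Qed.

Lemma StB h u w : St h (u - w) = St h u - St h w.
Proof.
have B f g : sqi f -> sqi g ->
    steklov h (fun x => f x - g x) = (fun x => steklov h f x - steklov h g x).
  move=> fi gi; have := steklov_lin h (-1) gi fi.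
  rewrite (_ : (fun x => -1 * g x + f x) = (fun x => f x - g x)); last first.
    by apply/funext => x; ring.
  by move=> ->; apply/funext => x; ring.
apply: L2_ext.
- have H := steklov_ae_eq h (sqi_reL (u - w)) (sqiB (sqi_reL u) (sqi_reL w)) (reLB u w).
  rewrite B in H; [|exact: sqi_reL..].
  apply: filterS3 (ae_and (reL_St h u) (reL_St h w)) (ae_and H (reL_St h (u - w))) (reLB (St h u) (St h w)).
  move=> x [e1 e2] [e3 e4] e5; rewrite [LHS]e4 [LHS]e3 [RHS]e5.
  by congr (_ - _); apply/esym; [exact: e1|exact: e2].
- have H := steklov_ae_eq h (sqi_imL (u - w)) (sqiB (sqi_imL u) (sqi_imL w)) (imLB u w).
  rewrite B in H; [|exact: sqi_imL..].
  apply: filterS3 (ae_and (imL_St h u) (imL_St h w)) (ae_and H (imL_St h (u - w))) (imLB (St h u) (St h w)).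
  move=> x [e1 e2] [e3 e4] e5; rewrite [LHS]e4 [LHS]e3 [RHS]e5.
  by congr (_ - _); apply/esym; [exact: e1|exact: e2].
Qed.

Lemma Int_sqr_ae f g : sqi f -> sqi g -> {ae leb, forall x, f x = g x} ->
  Int (fun x => f x ^+ 2) = Int (fun x => g x ^+ 2).
Proof.
move=> fi gi fg; under eq_Rintegral do rewrite expr2.
under [RHS]eq_Rintegral do rewrite expr2.
exact: Int_sqi_ae.
Qed.

Lemma St_le h u : ip (St h u) (St h u) <= ip u u.
Proof.
rewrite !ipE lerD//.
  rewrite (Int_sqr_ae (sqi_reL _) (sqi_steklov h (sqi_reL u)) (reL_St h u)).
  exact: Int_steklov_sqr (sqi_reL u).
rewrite (Int_sqr_ae (sqi_imL _) (sqi_steklov h (sqi_imL u)) (imL_St h u)).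
exact: Int_steklov_sqr (sqi_imL u).
Qed.

Lemma St_adj h u w : ip (St h u) w = ip u (St (- h) w).
Proof.
have sr k v := sqi_steklov k (sqi_reL v); have si k v := sqi_steklov k (sqi_imL v).
rewrite /ip; congr (_ + _).
  transitivity (Int (fun x => steklov h (reL u) x * reL w x)).
    by apply: Int_sqi_ae; rewrite ?sr//; try exact: sqi_reL; [exact: reL_St|exact: aeW].
  rewrite (Int_steklov_adj h (sqi_reL u) (sqi_reL w)); apply/esym.
  by apply: Int_sqi_ae; rewrite ?sr//; try exact: sqi_reL; [exact: aeW|exact: reL_St].
transitivity (Int (fun x => steklov h (imL u) x * imL w x)).
  by apply: Int_sqi_ae; rewrite ?si//; try exact: sqi_imL; [exact: imL_St|exact: aeW].
rewrite (Int_steklov_adj h (sqi_imL u) (sqi_imL w)); apply/esym.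
by apply: Int_sqi_ae; rewrite ?si//; try exact: sqi_imL; [exact: aeW|exact: imL_St].
Qed.

(** The steps for which [steklov_ae] gives convergence; all limits [h -> 0] run along them. *)
Definition hn n : R := n.+1%:R^-1.

Lemma hn_gt0 n : 0 < hn n. Proof. by rewrite invr_gt0. Qed.
Lemma hn_neq0 n : hn n != 0. Proof. by rewrite gt_eqF ?hn_gt0. Qed.

Lemma St_cvg u : ip (St (hn n) u - u) (St (hn n) u - u) @[n --> \oo] --> 0.
Proof.
have -> : (fun n => ip (St (hn n) u - u) (St (hn n) u - u)) =
    (fun n => Int (fun x => (steklov (hn n) (reL u) x - reL u x) ^+ 2) +
              Int (fun x => (steklov (hn n) (imL u) x - imL u x) ^+ 2)).
  apply/funext => n; rewrite ipE; congr (_ + _); apply: Int_sqr_ae.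
  - exact: sqi_reL.
  - by apply: sqiB; [apply: sqi_steklov|]; exact: sqi_reL.
  - by apply: filterS2 (reLB (St (hn n) u) u) (reL_St (hn n) u) => x -> ->.
  - exact: sqi_imL.
  - by apply: sqiB; [apply: sqi_steklov|]; exact: sqi_imL.
  - by apply: filterS2 (imLB (St (hn n) u) u) (imL_St (hn n) u) => x -> ->.
rewrite -[X in _ --> X](addr0 (0 : R)).
by apply: cvgD; apply: steklov_cvg; [exact: sqi_reL|exact: sqi_imL].
Qed.

(** Real and imaginary parts converge separately, each with the rate of [sqi_complete]; hence the
    factor two. *)
Lemma L2_complete (u : nat -> L2 R) :
  (forall n m, (n <= m)%N -> ip (u m - u n) (u m - u n) <= (4^-1) ^+ n) ->
  exists l, forall n, ip (l - u n) (l - u n) <= 2 * (4^-1) ^+ n.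
Proof.
move=> H.
have rE v w : ip (v - w) (v - w) = Int (fun x => (reL v x - reL w x) ^+ 2) +
    Int (fun x => (imL v x - imL w x) ^+ 2).
  rewrite ipE; congr (_ + _); apply: Int_sqr_ae.
  - exact: sqi_reL.
  - by apply: sqiB; exact: sqi_reL.
  - exact: reLB.
  - exact: sqi_imL.
  - by apply: sqiB; exact: sqi_imL.
  - exact: imLB.
have [f fi fu] : exists2 f, sqi f & forall n, Int (fun x => (f x - reL (u n) x) ^+ 2) <= (4^-1) ^+ n.
  apply: sqi_complete => [n|n m nm]; first exact: sqi_reL.
  by apply: le_trans (H n m nm); rewrite rE lerDl Int_ge0// => x; rewrite sqr_ge0.
have [g gi gu] : exists2 g, sqi g & forall n, Int (fun x => (g x - imL (u n) x) ^+ 2) <= (4^-1) ^+ n.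
  apply: sqi_complete => [n|n m nm]; first exact: sqi_imL.
  by apply: le_trans (H n m nm); rewrite rE lerDr Int_ge0// => x; rewrite sqr_ge0.
exists (mkL2 f g) => n; rewrite rE mulr_natl mulr2n lerD//.
  rewrite (Int_sqr_ae (g := fun x => f x - reL (u n) x)) ?fu//.
  - by apply: sqiB; exact: sqi_reL.
  - by apply: sqiB => //; exact: sqi_reL.
  - by apply: filterS (reL_mk fi gi) => x ->.
rewrite (Int_sqr_ae (g := fun x => g x - imL (u n) x)) ?gu//.
- by apply: sqiB; exact: sqi_imL.
- by apply: sqiB => //; exact: sqi_imL.
- by apply: filterS (imL_mk fi gi) => x ->.
Qed.

End L2Operators.

(** * Weak derivatives in L^2 *)

HB.lock Definition Dq (R : realType) (h : R) (u : L2 R) : L2 R :=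
  (h^-1)%:C *: (pull 1 h u - u).

Section WeakL2.
Variable R : realType.
Local Notation leb := (@lebesgue_measure R).
Local Notation itg f := (leb.-integrable setT (EFin \o f)).
Local Notation "'Int' f" := (\int[leb]_x f x)%R (at level 10).
Local Notation wd := (@is_weak_derivative R).
Implicit Types (f g phi : R -> R) (u v w : L2 R) (a b h c : R).
Let aeF := ae_filter_ringOfSetsType leb.
Local Existing Instance aeF.

Lemma complex_integral_mul u phi : complex_integral (fun x => u x * (phi x)%:C) =
  (Int (fun x => reL u x * phi x)) +i* (Int (fun x => imL u x * phi x)).
Proof.
rewrite /complex_integral; congr (_ +i* _); apply: eq_Rintegral => x _;
  rewrite /reL /imL; case: (L2_repr u x) => p q /=; ring.
Qed.

Lemma wdP u w : wd u w <-> rwd (reL u) (reL w) /\ rwd (imL u) (imL w).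
Proof.
split=> [H|[Hr Hi] phi tp].
  by split=> phi tp; have := H phi tp; rewrite !complex_integral_mul => -[].
by rewrite !complex_integral_mul Hr// Hi.
Qed.

Lemma rwd_ae f f' g g' : sqi f -> sqi f' -> sqi g -> sqi g' ->
  {ae leb, forall x, f x = f' x} -> {ae leb, forall x, g x = g' x} ->
  rwd f g -> rwd f' g'.
Proof.
move=> fi fi' gi gi' ff gg H phi tp.
have pi := test_sqi tp; have dpi := test_sqi (test_derive1 tp).
rewrite -(Int_sqi_ae fi fi' dpi dpi ff (aeW _ (fun=> erefl))).
by rewrite -(Int_sqi_ae gi gi' pi pi gg (aeW _ (fun=> erefl))) H.
Qed.

Lemma wd_unique u w w' : wd u w -> wd u w' -> w = w'.
Proof.
move=> /wdP[r i] /wdP[r' i']; apply: L2_ext.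
  exact: (rwd_unique (sqi_reL w) (sqi_reL w') r r').
exact: (rwd_unique (sqi_imL w) (sqi_imL w') i i').
Qed.

Lemma wd_lin (k : R[i]) u w u' w' : wd u u' -> wd w w' ->
  wd (k *: u + w) (k *: u' + w').
Proof.
move=> /wdP[ru iu] /wdP[rw iw]; apply/wdP; split=> phi tp.
  rewrite !Int_reL_lin; try exact: test_sqi; try exact/test_sqi/test_derive1.
  by rewrite ru// iu// rw//; ring.
rewrite !Int_imL_lin; try exact: test_sqi; try exact/test_sqi/test_derive1.
by rewrite ru// iu// iw//; ring.
Qed.

Lemma wd0 : wd 0 0.
Proof.
have z f : sqi f -> Int (fun x => reL (0 : L2 R) x * f x) = 0.
  by move=> fi; have := Int_reL_lin 1 (0 : L2 R) 0 fi; rewrite scaler0 addr0 /= mul0r mul1r; lra.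
have z' f : sqi f -> Int (fun x => imL (0 : L2 R) x * f x) = 0.
  by move=> fi; have := Int_imL_lin 1 (0 : L2 R) 0 fi; rewrite scaler0 addr0 /= mul0r mul1r; lra.
apply/wdP; split=> phi tp; rewrite ?z ?z' ?oppr0//;
  solve [exact: test_sqi | exact/test_sqi/test_derive1].
Qed.

Lemma wdZ (k : R[i]) u u' : wd u u' -> wd (k *: u) (k *: u').
Proof. by move=> H; have := wd_lin k H wd0; rewrite !addr0. Qed.

Lemma wdD u w u' w' : wd u u' -> wd w w' -> wd (u + w) (u' + w').
Proof. by move=> H H'; have := wd_lin 1 H H'; rewrite !scale1r. Qed.

Lemma wdN u u' : wd u u' -> wd (- u) (- u').
Proof. by move=> H; have := wdZ (-1) H; rewrite !scaleN1r. Qed.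

Lemma weak_derivativeE u w : wd u w -> weak_derivative u = w.
Proof.
move=> uw; rewrite /weak_derivative; case: xgetP => [y _ /= H|/(_ w)//].
exact: wd_unique H uw.
Qed.

Lemma H1_wd u : u \in @H1_pred R -> wd u (weak_derivative u).
Proof. by rewrite inE => -[w uw]; rewrite (weak_derivativeE uw). Qed.

Lemma wd_H1 u w : wd u w -> u \in @H1_pred R.
Proof. by move=> uw; rewrite inE; exists w. Qed.

Lemma wd_pull a b u w : a != 0 -> wd u w -> wd (pull a b u) (a%:C *: pull a b w).
Proof.
move=> a0 /wdP[r i]; apply/wdP; split.
- refine (rwd_ae _ _ _ _ _ _ (rwd_affine b a0 (sqi_reL u) (sqi_reL w) r)).
  + exact: sqi_affine (sqi_reL u).
  + exact: sqi_reL.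
  + have := sqi_lin a (sqi_affine b a0 (sqi_reL w)) (sqi_cst0 R).
    by congr sqi; apply/funext => x; rewrite addr0.
  + exact: sqi_reL.
  + by apply: filterS (reL_pull b a0 u) => x H; exact: esym.
  + apply: filterS2 (reLZ a (pull a b w)) (reL_pull b a0 w) => x H1 H2.
    by apply: esym; rewrite [LHS]H1; congr (_ * _).
- refine (rwd_ae _ _ _ _ _ _ (rwd_affine b a0 (sqi_imL u) (sqi_imL w) i)).
  + exact: sqi_affine (sqi_imL u).
  + exact: sqi_imL.
  + have := sqi_lin a (sqi_affine b a0 (sqi_imL w)) (sqi_cst0 R).
    by congr sqi; apply/funext => x; rewrite addr0.
  + exact: sqi_imL.
  + by apply: filterS (imL_pull b a0 u) => x H; exact: esym.
  + apply: filterS2 (imLZ a (pull a b w)) (imL_pull b a0 w) => x H1 H2.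
    by apply: esym; rewrite [LHS]H1; congr (_ * _).
Qed.

Lemma reL_Dq h u : {ae leb, forall x, reL (Dq h u) x = dq h (reL u) x}.
Proof.
rewrite Dq.unlock; apply: filterS3 (reLZ h^-1 (pull 1 h u - u)) (reLB (pull 1 h u) u) (reL_shift h u).
by move=> x H1 H2 H3; rewrite [LHS]H1 H2 H3.
Qed.

Lemma imL_Dq h u : {ae leb, forall x, imL (Dq h u) x = dq h (imL u) x}.
Proof.
rewrite Dq.unlock; apply: filterS3 (imLZ h^-1 (pull 1 h u - u)) (imLB (pull 1 h u) u) (imL_shift h u).
by move=> x H1 H2 H3; rewrite [LHS]H1 H2 H3.
Qed.

Lemma ae_sym f g : {ae leb, forall x, f x = g x} -> {ae leb, forall x, g x = f x}.
Proof. by apply: filterS => x. Qed.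

Lemma wd_St h u : h != 0 -> wd (St h u) (Dq h u).
Proof.
move=> h0; apply/wdP; split.
- refine (rwd_ae _ _ _ _ _ _ (rwd_steklov h0 (sqi_reL u))).
  + exact: sqi_steklov (sqi_reL u).
  + exact: sqi_reL.
  + exact: sqi_dq (sqi_reL u).
  + exact: sqi_reL.
  + exact: ae_sym (reL_St h u).
  + exact: ae_sym (reL_Dq h u).
- refine (rwd_ae _ _ _ _ _ _ (rwd_steklov h0 (sqi_imL u))).
  + exact: sqi_steklov (sqi_imL u).
  + exact: sqi_imL.
  + exact: sqi_dq (sqi_imL u).
  + exact: sqi_imL.
  + exact: ae_sym (imL_St h u).
  + exact: ae_sym (imL_Dq h u).
Qed.

Lemma wd_Dq h u w : h != 0 -> wd u w -> Dq h u = St h w.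
Proof.
move=> h0 /wdP[r i]; apply: L2_ext.
  apply: filterS3 (rwd_dq h0 (sqi_reL u) (sqi_reL w) r) (reL_Dq h u) (reL_St h w).
  by move=> x H1 H2 H3; rewrite [LHS]H2 [LHS]H1 [RHS]H3.
apply: filterS3 (rwd_dq h0 (sqi_imL u) (sqi_imL w) i) (imL_Dq h u) (imL_St h w).
by move=> x H1 H2 H3; rewrite [LHS]H2 [LHS]H1 [RHS]H3.
Qed.

Let nm := fnorm (@ip R).
Let ipf := @ip_form R.
Let ip0 := @ip_ge0 R.

Lemma Dq_adj h u w : ip (Dq h u) w = - ip u (Dq (- h) w).
Proof.
rewrite Dq.unlock (formZl ipf) (formZr ipf) (formBl ipf) (formBr ipf) ip_shift_adj invrN.
by ring.
Qed.

Lemma St_nm_cvg u : nm (St (hn R n) u - u) @[n --> \oo] --> 0.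
Proof.
rewrite -[X in _ --> X](@sqrtr0 R); apply: continuous_cvg; last exact: St_cvg.
exact: sqrt_continuous.
Qed.

Lemma ip_cvg (u_ : nat -> L2 R) u w : nm (u_ n - u) @[n --> \oo] --> 0 ->
  ip (u_ n) w @[n --> \oo] --> ip u w.
Proof. exact: form_cvg. Qed.
Arguments ip_cvg {u_ u} w _.

Lemma St_nm_le h u : nm (St h u) <= nm u.
Proof. by apply: ler_wsqrtr; exact: St_le. Qed.

(** Neither factor is a test function. The rule is exact for difference quotients, where
    [D_h u = S_h u'] and [D_(-h) w = S_(-h) w'], and passes to the limit [h -> 0]. *)
Lemma wd_ibp u u' w w' : wd u u' -> wd w w' -> ip u' w = - ip u w'.
Proof.
move=> uu ww.
have c1 : ip (Dq (hn R n) u) w @[n --> \oo] --> ip u' w.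
  have := ip_cvg w (St_nm_cvg u').
  by under eq_fun do rewrite -(wd_Dq (hn_neq0 R _) uu).
have c2 : ip (Dq (hn R n) u) w @[n --> \oo] --> - ip u w'.
  rewrite (_ : (fun n => _) = (fun n => - ip (St (hn R n) u) w')).
    exact: cvgN (ip_cvg w' (St_nm_cvg u)).
  apply/funext => n; rewrite Dq_adj (wd_Dq _ ww) ?oppr_eq0 ?hn_neq0//.
  by rewrite St_adj.
exact: (cvg_unique _ c1 c2).
Qed.

Lemma Dq_nm_le h u w : h != 0 -> wd u w -> nm (Dq h u) <= nm w.
Proof. by move=> h0 uw; rewrite (wd_Dq h0 uw); exact: St_nm_le. Qed.

Lemma Dq_nm_cvg u w : wd u w -> nm (Dq (hn R n) u - w) @[n --> \oo] --> 0.
Proof.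
by move=> uw; under eq_fun do rewrite (wd_Dq (hn_neq0 R _) uw); exact: St_nm_cvg.
Qed.

(** Each side of the defining identity is an inner product with a fixed class built from the test
    function, hence continuous. *)
Lemma wd_closed (u_ w_ : nat -> L2 R) u w : (forall n, wd (u_ n) (w_ n)) ->
  nm (u_ n - u) @[n --> \oo] --> 0 -> nm (w_ n - w) @[n --> \oo] --> 0 -> wd u w.
Proof.
move=> uw cu cw; apply/wdP.
have z0 f : Int (fun x => f x * (fun=> 0) x) = 0.
  rewrite (_ : (fun x => _) = (fun=> 0 : R)) ?Rintegral_cst ?mul0r//.
  by apply/funext => x; rewrite mulr0.
have sz := sqi_cst0 R.
split=> phi tp; have pi := test_sqi tp; have dpi := test_sqi (test_derive1 tp).
- have E v f : sqi f -> Int (fun x => reL v x * f x) = ip v (mkL2 f (fun=> 0)).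
    by move=> fi; rewrite ip_mk// z0 addr0.
  rewrite !E//; have c1 := ip_cvg (mkL2 (derive1 phi) (fun=> 0)) cu.
  have c2 := cvgN (ip_cvg (mkL2 phi (fun=> 0)) cw).
  rewrite (_ : (fun n => ip (u_ n) _) = (fun n => - ip (w_ n) (mkL2 phi (fun=> 0)))) in c1.
    exact: (cvg_unique _ c1 (c2 _)).
  by apply/funext => n; rewrite -!E//; have /wdP[-> //] := uw n.
- have E v f : sqi f -> Int (fun x => imL v x * f x) = ip v (mkL2 (fun=> 0) f).
    by move=> fi; rewrite ip_mk// z0 add0r.
  rewrite !E//; have c1 := ip_cvg (mkL2 (fun=> 0) (derive1 phi)) cu.
  have c2 := cvgN (ip_cvg (mkL2 (fun=> 0) phi) cw).
  rewrite (_ : (fun n => ip (u_ n) _) = (fun n => - ip (w_ n) (mkL2 (fun=> 0) phi))) in c1.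
    exact: (cvg_unique _ c1 (c2 _)).
  by apply/funext => n; rewrite -!E//; have /wdP[_ -> //] := uw n.
Qed.

Lemma St0 h : St h 0 = 0 :> L2 R.
Proof. by rewrite -[X in St h X](subrr (0 : L2 R)) StB subrr. Qed.

(** All difference quotients of [u] vanish, so [u] equals its translates by every positive integer;
    distant translates become orthogonal, whence [|u|^2 = 0]. *)
Lemma wd_eq0 u : wd u 0 -> u = 0.
Proof.
move=> u0; apply: ip_eq0.
have sh n : pull 1 n.+1%:R u = u.
  have n0 : (n.+1%:R : R) != 0 by rewrite pnatr_eq0.
  have := wd_Dq n0 u0; rewrite St0 Dq.unlock => /eqP; rewrite scaler_eq0 subr_eq0.
  by rewrite (_ : ((n.+1%:R : R)^-1)%:C == 0 = false) ?orFb; [move/eqP|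
    rewrite eq_complex /= eqxx andbT invr_eq0 (negbTE n0)].
have := ip_shift_cvg0 u; rewrite -(cvg_shiftS) /=.
by under eq_fun do rewrite sh; move/cvg_lim => <- //; rewrite lim_cst.
Qed.

Fixpoint Hk k u : Prop :=
  if k is k'.+1 then exists2 u', wd u u' & Hk k' u' else True.

(** The derivative of an average is [Dq h u], which is itself the average of [u'], so the induction
    applies to it. *)
Lemma Hk_St k h u : h != 0 -> Hk k u -> Hk k.+1 (St h u).
Proof.
move=> h0; elim: k u => [|k IH] u; first by move=> _; exists (Dq h u) => //; exact: wd_St.
case=> u' uu' ku'; exists (Dq h u); first exact: wd_St.
by rewrite (wd_Dq h0 uu'); exact: IH.
Qed.

(** A multiple of the indicator of [[0, 1]] is averaged [k] times. Averages converge to the function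
    as the step shrinks, so some step keeps the result non-zero. This supplies the regular profile
    of the optimality construction. *)
Lemma Hk_neq0 k : exists2 u, Hk k u & u != 0.
Proof.
elim: k => [|k [u ku u0]].
  pose f := (\1_(`[0, 1] : set R) : R -> R).
  have fi : sqi f.
    split; first exact: measurable_indic.
    rewrite (_ : (fun x => _) = f); last first.
      by apply/funext => x; rewrite /f indicE; case: (_ \in _); rewrite ?expr1n ?expr0n.
    apply: ge0_itg => [|x|]; [exact: measurable_indic|by rewrite /f indicE|].
    by rewrite integral_indic// setIT/= lebesgue_measure_itv/= lte_fin ltr01 -EFinD ltry.
  exists (mkL2 f f) => //; apply/eqP => u0.
  have := ip_mk (mkL2 f f) fi fi; rewrite {1}u0 (form0l ipf).
  have E g : {ae leb, forall x, g x = f x} -> sqi g -> Int (fun x => g x * f x) = 1.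
    move=> gf gi; rewrite (Int_sqi_ae gi fi fi fi gf (aeW _ (fun=> erefl))).
    rewrite (_ : (fun x => _) = f).
      rewrite /f /Rintegral integral_indic// setIT/= lebesgue_measure_itv /= lte_fin ltr01.
      by rewrite oppr0 addr0.
    by apply/funext => x; rewrite /f indicE; case: (_ \in _); rewrite ?mulr1 ?mulr0.
  rewrite (E _ (reL_mk fi fi) (sqi_reL _)) (E _ (imL_mk fi fi) (sqi_imL _)); lra.
have [n un] : exists n, St (hn R n) u != 0.
  apply: contrapT => H; have {}H n : St (hn R n) u = 0.
    by apply/eqP; apply: contrapT => /negP un; apply: H; exists n.
  have := St_cvg u; under eq_fun do rewrite H sub0r formNl// formNr// opprK.
  move/cvg_lim => H'; have : ip u u = 0 by rewrite -H'// lim_cst.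
  by move/ip_eq0 => u00; rewrite u00 eqxx in u0.
by exists (St (hn R n) u) => //; apply: Hk_St => //; exact: hn_neq0.
Qed.

End WeakL2.

(** * Energy estimates for semigroups *)

Section Evolution.
Variable R : realType.

(** A substitute for the mean value inequality: local increments with a slope uniform in [t] add up
    along a subdivision finer than [d], and the slack [e / t0] per unit of time adds up to [e]. *)
Lemma telescoping_bound (phi : R -> R) (t0 K : R) : 0 <= t0 ->
  (forall e, 0 < e -> exists2 d, 0 < d & forall t s, 0 <= t -> 0 < s < d ->
     t + s <= t0 -> phi (t + s) <= phi t + s * (K + e)) ->
  phi t0 <= phi 0 + t0 * K.
Proof.
rewrite le_eqVlt => /predU1P[<-|t0_gt0] H; first by rewrite mul0r addr0.
apply/ler_addgt0Pr => e e0.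
have [|d d0 Hd] := H (e / t0); first by rewrite divr_gt0.
pose n := (Num.truncn (t0 / d)).+1.
have n0 : (0 : R) < n%:R by rewrite ltr0n.
have sd : 0 < t0 / n%:R < d.
  rewrite divr_gt0//= ltr_pdivrMr// mulrC -ltr_pdivrMr//.
  exact: truncnS_gt.
have st k : (k <= n)%N -> phi (k%:R * (t0 / n%:R)) <= phi 0 + k%:R * (t0 / n%:R) * (K + e / t0).
  elim: k => [|k IH] kn; first by rewrite !mul0r addr0.
  rewrite -natr1 mulrDl mul1r; apply: (le_trans (Hd _ _ _ sd _)).
  - by rewrite mulr_ge0// ltW//; case/andP: sd.
  - rewrite -[X in _ + X]mul1r -mulrDl natr1 mulrA ler_pdivrMr// mulrC ler_pM2l//.
    by rewrite ler_nat.
  - by have := IH (ltnW kn); lra.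
have := st n (leqnn n); rewrite mulrCA mulfV ?gt_eqF// mulr1 => /le_trans; apply.
by rewrite mulrDr mulrCA mulfV ?gt_eqF// mulr1 addrA.
Qed.

Variables (V : lmodType R[i]) (B : V -> V -> R).
Hypotheses (sB : sform B) (B0 : forall x, 0 <= B x x).
Local Notation nrm := (fnorm B).
Implicit Types (x y z w : V) (q : V -> V -> R).

Definition bounded_form q := exists2 K, 0 <= K &
  forall z w, `|q z w| <= K * (nrm z * nrm w).

Lemma bounded_formD q q' : bounded_form q -> bounded_form q' ->
  bounded_form (fun z w => q z w + q' z w).
Proof.
move=> [K K0 Kq] [K' K0' Kq']; exists (K + K'); first exact: addr_ge0.
by move=> z w; rewrite (le_trans (ler_normD _ _))// mulrDl lerD.
Qed.

Lemma bounded_formZ c q : bounded_form q -> bounded_form (fun z w => c * q z w).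
Proof.
move=> [K K0 Kq]; exists (`|c| * K); first exact: mulr_ge0.
by move=> z w; rewrite normrM -mulrA ler_wpM2l.
Qed.

Lemma bounded_form_comp q (L : V -> V) M : 0 <= M ->
  (forall z, nrm (L z) <= M * nrm z) ->
  bounded_form q -> bounded_form (fun z w => q (L z) (L w)).
Proof.
move=> M0 LM [K K0 Kq]; exists (K * M ^+ 2); first by rewrite mulr_ge0// sqr_ge0.
move=> z w; rewrite (le_trans (Kq _ _))// -mulrA ler_wpM2l//.
rewrite (_ : M ^+ 2 * _ = (M * nrm z) * (M * nrm w)); last by ring.
by apply: ler_pM; rewrite ?fnorm_ge0.
Qed.

Lemma bounded_form_self : bounded_form B.
Proof. by exists 1 => // z w; rewrite mul1r form_le. Qed.

Lemma sformD q q' : sform q -> sform q' -> sform (fun z w => q z w + q' z w).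
Proof.
move=> [c d z] [c' d' z']; split.
- by move=> x y; rewrite c c'.
- by move=> x y w; rewrite d d'; ring.
- by move=> k x y; rewrite z z'; ring.
Qed.

Lemma sformZ k q : sform q -> sform (fun z w => k * q z w).
Proof.
move=> [c d z]; split.
- by move=> x y; rewrite c.
- by move=> x y w; rewrite d; ring.
- by move=> l x y; rewrite z; ring.
Qed.

Lemma sform_comp q (L : V -> V) : linear L -> sform q ->
  sform (fun z w => q (L z) (L w)).
Proof.
move=> lL [c d z]; split.
- by move=> x y; rewrite c.
- by move=> x y w; have := lL 1 x y; rewrite !scale1r => ->; exact: d.
- move=> k x y; have L0 : L 0 = 0.
    have := lL 1 0 0; rewrite !scale1r addr0 => /eqP.
    by rewrite -subr_eq0 opprD addNKr oppr_eq0 => /eqP.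
  by have := lL k%:C x 0; rewrite L0 !addr0 => ->; exact: z.
Qed.

Section Trajectories.
Variables (D : set V) (A : V -> V).

(* A uniform-in-time first-order expansion of [x' = A x]; it replaces
   differentiability of trajectories in all the energy estimates. *)
Definition approx_sol (x : R -> V) := [/\ forall t, 0 <= t -> D (x t),
  exists M, forall t, 0 <= t -> nrm (x t) <= M /\ nrm (A (x t)) <= M &
  forall e, 0 < e -> exists2 d, 0 < d & forall t s, 0 <= t -> 0 < s < d ->
    nrm (x (t + s) - x t - s%:C *: A (x t)) <= s * e].

Lemma approx_sol_step (x : R -> V) q : approx_sol x -> sform q -> bounded_form q ->
  forall e, 0 < e -> exists2 d, 0 < d & forall t s, 0 <= t -> 0 < s < d ->
    q (x (t + s)) (x (t + s)) <=
    q (x t) (x t) + s * (2 * q (A (x t)) (x t) + e).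
Proof.
move=> [Dx [M HM] Hx] sq [K K0 Kq] e e0.
have M0 : 0 <= M by rewrite (le_trans (fnorm_ge0 _ _) (HM 0 (lexx _)).1).
(* Collects the constants of the two error terms, the linear one [2 q (x t) r] and the quadratic one
   [s * q dd dd]; the last summand keeps [c] positive. *)
pose c := 2 * K * M + K * (M + 1) ^+ 2 + 1.
have c0 : 0 < c.
  by rewrite ltr_wpDl// addr_ge0// ?mulr_ge0// ?sqr_ge0// addr_ge0.
pose e1 := Num.min 1 (e / c).
have e10 : 0 < e1 by rewrite lt_min ltr01 divr_gt0.
have [d d0 Hd] := Hx e1 e10.
exists (Num.min d e1); first by rewrite lt_min d0.
move=> t s t0 /andP[s0]; rewrite lt_min => /andP[sd se1].
have := Hd t s t0; rewrite s0 sd => /(_ isT) H.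
pose r := s^-1%:C *: (x (t + s) - x t - s%:C *: A (x t)).
have rn : nrm r <= e1.
  rewrite fnormZ// ger0_norm ?invr_ge0 ?(ltW s0)//.
  by rewrite ler_pdivrMl.
pose dd := A (x t) + r.
have ddn : nrm dd <= M + 1.
  rewrite (le_trans (fnormD sB B0 _ _))// lerD ?(HM t t0).2//.
  by rewrite (le_trans rn)// ge_min lexx.
have E : x (t + s) = x t + s%:C *: dd.
  rewrite /dd scalerDr /r scalerA -rmorphM mulfV ?gt_eqF// rmorph1 scale1r.
  set a := s%:C *: A (x t); rewrite [a + _]addrC. rewrite [in RHS](subrK a).
 by rewrite [RHS]addrC subrK.
rewrite E formDD// formZr// formZZ// {2}/dd formDr// (formC sq (x t) (A _)).
have h1 : q (x t) r <= K * M * e1.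
  rewrite (le_trans (ler_norm _))// (le_trans (Kq _ _))// -mulrA ler_wpM2l//.
  by rewrite ler_pM ?fnorm_ge0 ?(HM t t0).1.
have h2 : q dd dd <= K * (M + 1) ^+ 2.
  rewrite (le_trans (ler_norm _))// (le_trans (Kq _ _))// ler_wpM2l// expr2.
  by rewrite ler_pM ?fnorm_ge0.
have h3 : s * q dd dd <= e1 * (K * (M + 1) ^+ 2).
  have k0 : 0 <= K * (M + 1) ^+ 2 by rewrite mulr_ge0// sqr_ge0.
  apply: (@le_trans _ _ (s * (K * (M + 1) ^+ 2))); first by rewrite ler_pM2l.
  by rewrite ler_wpM2r// ltW.
have h4 : e1 * c <= e by rewrite -ler_pdivlMr// ge_min lexx orbT.
have h5 : 2 * q (x t) r + s * q dd dd <= e.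
  by move: h4; rewrite /c; nra.
by rewrite expr2 -mulrA -addrA lerD2l mulrCA -mulrDr ler_pM2l//; lra.
Qed.

Lemma approx_sol_upper (x : R -> V) q K t : approx_sol x -> sform q -> bounded_form q ->
  (forall s, 0 <= s -> 2 * q (A (x s)) (x s) <= K) -> 0 <= t ->
  q (x t) (x t) <= q (x 0) (x 0) + t * K.
Proof.
move=> ax sq bq HK t0; apply: (telescoping_bound (phi := fun t => q (x t) (x t))) => // e e0.
have [d d0 Hd] := approx_sol_step ax sq bq e0; exists d => // s h s0 h0 _.
rewrite (le_trans (Hd s h s0 h0))// lerD2l ler_wpM2l ?lerD2r ?HK//.
by rewrite ltW//; case/andP: h0.
Qed.

Lemma approx_sol_lower (x : R -> V) q K t : approx_sol x -> sform q -> bounded_form q ->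
  (forall s, 0 <= s -> - K <= 2 * q (A (x s)) (x s)) -> 0 <= t ->
  q (x 0) (x 0) - t * K <= q (x t) (x t).
Proof.
move=> ax sq bq HK t0.
have H s : 0 <= s -> 2 * (-1 * q (A (x s)) (x s)) <= K by move=> /HK; lra.
by have := approx_sol_upper ax (sformZ (-1) sq) (bounded_formZ (-1) bq) H t0; lra.
Qed.

(** The derivative of [q1 + t q2] along a trajectory is [(2 q1 (A x) x + q2 x x) + 2 t q2 (A x) x],
    and both terms are non-positive. A non-increasing [q2] that is paid for by the decrease of a
    non-negative [q1] thus decays like [1/t]. *)
Lemma approx_sol_lyapunov (x : R -> V) q1 q2 t : approx_sol x ->
  sform q1 -> bounded_form q1 -> sform q2 -> bounded_form q2 ->
  (forall z, D z -> 2 * q1 (A z) z + q2 z z <= 0) ->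
  (forall z, D z -> q2 (A z) z <= 0) -> 0 <= t ->
  q1 (x t) (x t) + t * q2 (x t) (x t) <= q1 (x 0) (x 0).
Proof.
move=> ax s1 b1 s2 b2 H1 H2 t0.
have Dx : forall s, 0 <= s -> D (x s) by case: ax.
pose phi s := q1 (x s) (x s) + s * q2 (x s) (x s).
suff : phi t <= phi 0 + t * 0 by rewrite /phi mulr0 mul0r !addr0.
apply: telescoping_bound => // e e0.
have [d1 d10 Hd1] := approx_sol_step ax s1 b1 (divr_gt0 e0 (ltr0n R 2)).
(* The error of [q2] gets multiplied by the time [s + h <= t], whence the division by [t + 1]. *)
have [|d2 d20 Hd2] := approx_sol_step ax s2 b2 (e := e / 2 / (t + 1)).
  by rewrite !divr_gt0// ltr_wpDl.
exists (Num.min d1 d2); first by rewrite lt_min d10.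
move=> s h s0 /andP[h0]; rewrite lt_min => /andP[hd1 hd2] sht; rewrite /phi add0r.
have := Hd1 s h s0; have := Hd2 s h s0; rewrite h0 hd1 hd2 => /(_ isT) K2 /(_ isT) K1.
have sh0 : 0 <= s + h by rewrite addr_ge0// ltW.
have h3 : (s + h) * (h * (e / 2 / (t + 1))) <= h * (e / 2).
  rewrite mulrCA ler_pM2l// mulrCA ler_piMr ?divr_ge0 ?(ltW e0)//.
  by rewrite ler_pdivrMr ?ltr_wpDl// mul1r; lra.
have h4 : (s + h) * (h * (2 * q2 (A (x s)) (x s))) <= 0.
  rewrite mulr_ge0_le0// mulr_ge0_le0 ?(ltW h0)// mulr_ge0_le0//; exact/H2/Dx.
have h5 : h * (2 * q1 (A (x s)) (x s) + q2 (x s) (x s)) <= 0.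
  by rewrite mulr_ge0_le0 ?(ltW h0)//; exact/H1/Dx.
have h6 := ler_wpM2l sh0 K2; nra.
Qed.

End Trajectories.

Section Semigroup.
Variables (D : set V) (A : V -> V) (T : R -> V -> V).
Hypotheses (T_sg : contraction_C0_semigroup nrm T) (T_gen : generator_of nrm T D A).

Let T_lin t : 0 <= t -> linear (T t). Proof. by case: T_sg => H _ _ _ _; exact: H. Qed.
Let T_0 : T 0 = id. Proof. by case: T_sg. Qed.
Let T_D s t : 0 <= s -> 0 <= t -> T (s + t) = T s \o T t.
Proof. by case: T_sg => _ _ H _ _; exact: H. Qed.
Lemma sg_contr t z : 0 <= t -> nrm (T t z) <= nrm z.
Proof. by case: T_sg => _ _ _ H _ t0; exact: H. Qed.

Lemma sg_lin k t z w : 0 <= t -> T t (k *: z + w) = k *: T t z + T t w.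
Proof. by move=> t0; exact: T_lin. Qed.
Lemma sg_0 t : 0 <= t -> T t 0 = 0.
Proof.
move=> t0; have := sg_lin 1 0 0 t0; rewrite !scale1r addr0 => /eqP.
by rewrite -subr_eq0 opprD addNKr oppr_eq0 => /eqP.
Qed.
Lemma sgZ k t z : 0 <= t -> T t (k *: z) = k *: T t z.
Proof. by move=> t0; have := sg_lin k z 0 t0; rewrite sg_0// !addr0. Qed.
Lemma sgD t z w : 0 <= t -> T t (z + w) = T t z + T t w.
Proof. by move=> t0; have := sg_lin 1 z w t0; rewrite !scale1r. Qed.
Lemma sgB t z w : 0 <= t -> T t (z - w) = T t z - T t w.
Proof. by move=> t0; rewrite sgD// -scaleN1r sgZ// scaleN1r. Qed.
Lemma sg_comp s t z : 0 <= s -> 0 <= t -> T (s + t) z = T s (T t z).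
Proof. by move=> s0 t0; rewrite T_D. Qed.
Lemma sg_start z : T 0 z = z. Proof. by rewrite T_0. Qed.

Lemma sg_mono s t z : 0 <= s -> s <= t -> nrm (T t z) <= nrm (T s z).
Proof.
move=> s0 st; rewrite -(subrK s t) sg_comp ?subr_ge0//.
by apply: sg_contr; rewrite subr_ge0.
Qed.

(** [T t] commutes with the quotients that define the generator and is a contraction, so it
    transports their limit. *)
Lemma sg_dom t z : 0 <= t -> D z -> D (T t z) /\ A (T t z) = T t (A z).
Proof.
move=> t0 Dz; apply/T_gen.
have := (T_gen z (A z)).1 (conj Dz erefl).
move/cvgrPdist_le => H; apply/cvgrPdist_le => e e0.
near=> s; rewrite sub0r normrN ger0_norm ?fnorm_ge0//.
have s0 : 0 < s by near: s; exact: nbhs_right_gt.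
rewrite -sg_comp ?(ltW s0)// (addrC s) sg_comp ?(ltW s0)// -sgB// -sgZ// -sgB//.
rewrite (le_trans (sg_contr _ t0))//.
have : `|0 - nrm ((s^-1)%:C *: (T s z - z) - A z)| <= e by near: s; exact: H.
by rewrite sub0r normrN ger0_norm ?fnorm_ge0.
Unshelve. all: by end_near. Qed.

(** The expansion error at time [t] is [T t] applied to the error at time zero, so by contraction
    one [d] serves all times. *)
Lemma sg_approx_sol z : D z -> approx_sol D A (T ^~ z).
Proof.
move=> Dz; split.
- by move=> t t0; have [] := sg_dom t0 Dz.
- exists (Num.max (nrm z) (nrm (A z))) => t t0.
  have [_ ->] := sg_dom t0 Dz.
  by split; rewrite (le_trans (sg_contr _ t0))// le_max lexx ?orbT.
- move=> e e0; have := (T_gen z (A z)).1 (conj Dz erefl).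
  move/cvgrPdist_le => /(_ e e0) [d /= d0 Hd]; exists d => // t s t0 /andP[s0 sd].
  have := Hd s; rewrite /ball_ /= sub0r normrN gtr0_norm// => /(_ sd s0).
  rewrite sub0r normrN ger0_norm ?fnorm_ge0// => H.
  have [_ ->] := sg_dom t0 Dz; rewrite sg_comp ?(ltW s0)//.
  rewrite -sgB// -sgZ// -sgB//.
  rewrite (le_trans (sg_contr _ t0))//.
  rewrite (_ : _ - _ = s%:C *: ((s^-1)%:C *: (T s z - z) - A z)); last first.
    by rewrite scalerBr scalerA -rmorphM mulfV ?gt_eqF// rmorph1 scale1r.
  by rewrite fnormZ// gtr0_norm// ler_pM2l.
Qed.

End Semigroup.
End Evolution.

(** * The energy space and the generator *)

Definition pos (R : realType) (z : KG_space R) : L2 R := \val (z.1 : H1 R).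
Definition vel (R : realType) (z : KG_space R) : L2 R := z.2.
Definition dpos (R : realType) (z : KG_space R) : L2 R := weak_derivative (pos z).

(* Meaningful when [u] is in H^1; the position defaults to 0 elsewhere. *)
HB.lock Definition mkX (R : realType) (u v : L2 R) : KG_space R :=
  (insubd (0 : H1 R) u, v).

HB.lock Definition shX (R : realType) (h : R) (z : KG_space R) : KG_space R :=
  mkX (pull 1 h (pos z)) (pull 1 h (vel z)).

HB.lock Definition DX (R : realType) (h : R) (z : KG_space R) : KG_space R :=
  (h^-1)%:C *: (shX h z - z).

HB.lock Definition StX (R : realType) (h : R) (z : KG_space R) : KG_space R :=
  mkX (St h (pos z)) (St h (vel z)).

Section EnergySpace.
Variables (R : realType) (m : R).
Hypothesis m0 : 0 < m.
Local Notation X := (KG_space R).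
Local Notation wd := (@is_weak_derivative R).
Local Notation D := (@KG_dom R).
Local Notation A := (KG_op m).
Local Notation nm := (fnorm (@ip R)).
Implicit Types (z w y : X) (u v : L2 R) (h c : R).
Let ipf := @ip_form R.
Let ip0 := @ip_ge0 R.

Let mip_ge0 u : 0 <= m * ip u u.
Proof. by apply: mulr_ge0; [exact: ltW|exact: ip0]. Qed.

Lemma wd_pos z : wd (pos z) (dpos z).
Proof. by apply: H1_wd; exact: valP. Qed.

Lemma state_ext z w : pos z = pos w -> vel z = vel w -> z = w.
Proof. by case: z w => [z1 z2] [w1 w2] /val_inj /= -> /= ->. Qed.

Lemma pos_lin (k : R[i]) z w : pos (k *: z + w) = k *: pos z + pos w.
Proof. by []. Qed.
Lemma vel_lin (k : R[i]) z w : vel (k *: z + w) = k *: vel z + vel w.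
Proof. by []. Qed.
Lemma dpos_lin (k : R[i]) z w : dpos (k *: z + w) = k *: dpos z + dpos w.
Proof. by apply: weak_derivativeE; rewrite pos_lin; apply: wd_lin; exact: wd_pos. Qed.

Lemma lin_0 (L : X -> L2 R) : (forall k z w, L (k *: z + w) = k *: L z + L w) -> L 0 = 0.
Proof.
move=> HL; have := HL 1 0 0; rewrite !scale1r addr0 => /eqP.
by rewrite -subr_eq0 opprD addNKr oppr_eq0 => /eqP.
Qed.

Lemma lin_D (L : X -> L2 R) : (forall k z w, L (k *: z + w) = k *: L z + L w) ->
  forall z w, L (z + w) = L z + L w.
Proof. by move=> HL z w; have := HL 1 z w; rewrite !scale1r. Qed.

Lemma lin_Z (L : X -> L2 R) : (forall k z w, L (k *: z + w) = k *: L z + L w) ->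
  forall k z, L (k *: z) = k *: L z.
Proof. by move=> HL k z; have := HL k z 0; rewrite (lin_0 HL) !addr0. Qed.

Lemma lin_B (L : X -> L2 R) : (forall k z w, L (k *: z + w) = k *: L z + L w) ->
  forall z w, L (z - w) = L z - L w.
Proof. by move=> HL z w; rewrite (lin_D HL) -scaleN1r (lin_Z HL) scaleN1r. Qed.

Lemma cross_form (L L' : X -> L2 R) :
  (forall k z w, L (k *: z + w) = k *: L z + L w) ->
  (forall k z w, L' (k *: z + w) = k *: L' z + L' w) ->
  sform (fun z w => ip (L z) (L' w) + ip (L w) (L' z)).
Proof.
move=> HL HL'; split.
- by move=> z w; rewrite addrC.
- move=> z w y; rewrite (lin_D HL) (lin_D HL') (formDl ipf) (formDr ipf); ring.
- move=> k z w; rewrite (lin_Z HL) (lin_Z HL') (formZl ipf) (formZr ipf); ring.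
Qed.

Lemma pull_form (L : X -> L2 R) :
  (forall k z w, L (k *: z + w) = k *: L z + L w) -> sform (fun z w => ip (L z) (L w)).
Proof.
move=> HL; split.
- by move=> z w; rewrite (formC ipf).
- by move=> z w y; rewrite (lin_D HL) (formDl ipf).
- by move=> k z w; rewrite (lin_Z HL) (formZl ipf).
Qed.

Definition ipX z w : R :=
  m * ip (pos z) (pos w) + ip (dpos z) (dpos w) + ip (vel z) (vel w).

Lemma ipX_form : sform ipX.
Proof.
apply: (sformD (sformD (sformZ m _) _) _); apply: pull_form;
  [exact: pos_lin|exact: dpos_lin|exact: vel_lin].
Qed.

Lemma ipX_ge0 z : 0 <= ipX z z.
Proof. by apply: addr_ge0 (ip0 _); exact: addr_ge0 (mip_ge0 _) (ip0 _). Qed.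

Lemma ipX_eq0 z : ipX z z = 0 -> z = 0.
Proof.
move=> H; have p0 := ip0 (pos z); have d0 := ip0 (dpos z); have v0 := ip0 (vel z).
have mp : 0 <= m * ip (pos z) (pos z) by [].
apply: state_ext.
  rewrite (lin_0 pos_lin); apply: ip_eq0; apply: (mulfI (lt0r_neq0 m0)).
  by rewrite mulr0; move: H; rewrite /ipX; lra.
by rewrite (lin_0 vel_lin); apply: ip_eq0; move: H; rewrite /ipX; lra.
Qed.

Local Notation nX := (fnorm ipX).

Lemma KG_normE z : KG_norm m z = nX z.
Proof.
rewrite /KG_norm /fnorm /ipX; congr Num.sqrt.
by rewrite !L2_normE !fnorm_sqr.
Qed.

Lemma nX_sqr z : nX z ^+ 2 = ipX z z.
Proof. by rewrite fnorm_sqr//; exact: ipX_ge0. Qed.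

Lemma vel_le z : nm (vel z) <= nX z.
Proof.
by apply: ler_wsqrtr; rewrite /ipX lerDr; exact: addr_ge0 (mip_ge0 _) (ip0 _).
Qed.

Lemma dpos_le z : nm (dpos z) <= nX z.
Proof.
by apply: ler_wsqrtr; rewrite /ipX -addrA addrCA lerDl; exact: addr_ge0 (mip_ge0 _) (ip0 _).
Qed.

Lemma pos_le z : nm (pos z) <= (Num.sqrt m)^-1 * nX z.
Proof.
rewrite ler_pdivlMl ?sqrtr_gt0// -sqrtrM ?(ltW m0)//.
by apply: ler_wsqrtr; rewrite /ipX -addrA lerDl; exact: addr_ge0 (ip0 _) (ip0 _).
Qed.

Lemma bounded_cross (L L' : X -> L2 R) M M' : 0 <= M -> 0 <= M' ->
  (forall z, nm (L z) <= M * nX z) -> (forall z, nm (L' z) <= M' * nX z) ->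
  bounded_form ipX (fun z w => ip (L z) (L' w)).
Proof.
move=> M0 M0' LM LM'; exists (M * M'); first exact: mulr_ge0.
move=> z w; rewrite (le_trans (form_le ipf ip0 _ _))//.
rewrite (_ : _ * (nX z * nX w) = (M * nX z) * (M' * nX w)); last by ring.
by apply: ler_pM; rewrite ?fnorm_ge0.
Qed.

Lemma pos_mkX u v u' : wd u u' -> pos (mkX u v) = u.
Proof. by move=> /wd_H1 uu; rewrite mkX.unlock /pos /= insubdK. Qed.

Lemma dpos_mkX u v u' : wd u u' -> dpos (mkX u v) = u'.
Proof. by move=> uu; rewrite /dpos (pos_mkX v uu) (weak_derivativeE uu). Qed.

Lemma vel_mkX u v : vel (mkX u v) = v. Proof. by rewrite mkX.unlock. Qed.

Lemma wd_shift h u u' : wd u u' -> wd (pull 1 h u) (pull 1 h u').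
Proof. by move=> uu; have := wd_pull h (oner_neq0 R) uu; rewrite scale1r. Qed.

Lemma pos_shX h z : pos (shX h z) = pull 1 h (pos z).
Proof. by rewrite shX.unlock; exact: (pos_mkX _ (wd_shift h (wd_pos z))). Qed.
Lemma dpos_shX h z : dpos (shX h z) = pull 1 h (dpos z).
Proof. by rewrite shX.unlock; exact: (dpos_mkX _ (wd_shift h (wd_pos z))). Qed.
Lemma vel_shX h z : vel (shX h z) = pull 1 h (vel z).
Proof. by rewrite shX.unlock vel_mkX. Qed.

Lemma shX_lin h : linear (shX h).
Proof.
move=> k z w; have n1 := oner_neq0 R; apply: state_ext.
  by rewrite pos_lin !pos_shX pos_lin pull_lin.
by rewrite vel_lin !vel_shX vel_lin pull_lin.
Qed.

Lemma ipX_shX h z w : ipX (shX h z) (shX h w) = ipX z w.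
Proof. by rewrite /ipX !pos_shX !dpos_shX !vel_shX !ip_shift. Qed.

Lemma nX_shX h z : nX (shX h z) = nX z.
Proof. by rewrite /fnorm ipX_shX. Qed.

Lemma pos_DX h z : pos (DX h z) = Dq h (pos z).
Proof. by rewrite DX.unlock Dq.unlock (lin_Z pos_lin) (lin_B pos_lin) pos_shX. Qed.
Lemma vel_DX h z : vel (DX h z) = Dq h (vel z).
Proof. by rewrite DX.unlock Dq.unlock (lin_Z vel_lin) (lin_B vel_lin) vel_shX. Qed.

Lemma DX_lin h : linear (DX h).
Proof.
move=> k z w; rewrite DX.unlock shX_lin opprD addrACA -scalerBr scalerDr !scalerA.
by rewrite (mulrC k).
Qed.

Lemma nX_DX h z : nX (DX h z) <= `|h|^-1 * 2 * nX z.
Proof.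
rewrite DX.unlock (fnormZ ipX_form) normfV -mulrA ler_wpM2l ?invr_ge0//.
by rewrite (le_trans (fnormB ipX_form ipX_ge0 _ _))// nX_shX mulr_natl.
Qed.

Lemma wd_St_H1 h u u' : h != 0 -> wd u u' -> wd (St h u) (St h u').
Proof. by move=> h0 uu; rewrite -(wd_Dq h0 uu); exact: wd_St. Qed.

Section StX.
Variable h : R.
Hypothesis h0 : h != 0.

Lemma pos_StX z : pos (StX h z) = St h (pos z).
Proof. by rewrite StX.unlock; exact: (pos_mkX _ (wd_St_H1 h0 (wd_pos z))). Qed.
Lemma dpos_StX z : dpos (StX h z) = St h (dpos z).
Proof. by rewrite StX.unlock; exact: (dpos_mkX _ (wd_St_H1 h0 (wd_pos z))). Qed.
Lemma vel_StX z : vel (StX h z) = St h (vel z).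
Proof. by rewrite StX.unlock vel_mkX. Qed.

Lemma StX_B z w : StX h (z - w) = StX h z - StX h w.
Proof.
apply: state_ext.
  by rewrite (lin_B pos_lin) !pos_StX (lin_B pos_lin) StB.
by rewrite (lin_B vel_lin) !vel_StX (lin_B vel_lin) StB.
Qed.

Lemma nX_StX z : nX (StX h z) <= nX z.
Proof.
apply: ler_wsqrtr; rewrite /ipX pos_StX dpos_StX vel_StX.
by apply: lerD; [apply: lerD; [rewrite ler_pM2l//|]|]; exact: St_le.
Qed.

End StX.

Lemma StX_cvg z : nX (StX (hn R n) z - z) @[n --> \oo] --> 0.
Proof.
rewrite -[X in _ --> X](@sqrtr0 R); apply: continuous_cvg; first exact: sqrt_continuous.
have -> : (fun n => ipX (StX (hn R n) z - z) (StX (hn R n) z - z)) = (fun n =>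
   m * ip (St (hn R n) (pos z) - pos z) (St (hn R n) (pos z) - pos z) +
   ip (St (hn R n) (dpos z) - dpos z) (St (hn R n) (dpos z) - dpos z) +
   ip (St (hn R n) (vel z) - vel z) (St (hn R n) (vel z) - vel z)).
  apply/funext => n; have n0 := hn_neq0 R n.
  by rewrite /ipX (lin_B pos_lin) (lin_B dpos_lin) (lin_B vel_lin) pos_StX// dpos_StX// vel_StX.
rewrite (_ : 0 = m * 0 + 0 + 0); last by rewrite mulr0 !addr0.
by do 2?apply: cvgD; try exact: St_cvg; apply: cvgMr; exact: St_cvg.
Qed.

Lemma StX2_cvg z : nX (StX (hn R n) (StX (hn R n) z) - z) @[n --> \oo] --> 0.
Proof.
have H : (fun n => nX (StX (hn R n) z - z) + nX (StX (hn R n) z - z)) @ \oo --> (0 : R).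
  by rewrite -[X in _ --> X](addr0 (0 : R)); apply: cvgD; exact: StX_cvg.
apply: (squeeze_cvgr _ (cvg_cst 0) H); apply: nearW => n; rewrite fnorm_ge0 /=.
rewrite (_ : _ - z = (StX (hn R n) (StX (hn R n) z) - StX (hn R n) z) + (StX (hn R n) z - z)); last first.
  by rewrite addrA subrK.
rewrite (le_trans (fnormD ipX_form ipX_ge0 _ _))// lerD2r -StX_B ?hn_neq0//.
exact: nX_StX (hn_neq0 R n) _.
Qed.

(* On the domain only [pos z + vel z] is in H^2, not [pos z] itself. *)
Definition dom_data z v' p' p'' :=
  [/\ wd (vel z) v', wd (pos z + vel z) p' & wd p' p''].

Lemma domP z : D z <-> exists v' p' p'', dom_data z v' p' p''.
Proof.
split.
  move=> [/H1_wd wv]; rewrite inE => -[/H1_wd wp /H1_wd wpp].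
  exists (weak_derivative z.2), (weak_derivative (\val z.1 + z.2)),
    (weak_derivative (weak_derivative (\val z.1 + z.2))).
  exact: And3 wv wp wpp.
move=> [v' [p' [p'' [wv wp wpp]]]]; split; first exact: wd_H1 wv.
rewrite inE; split; first exact: wd_H1 wp.
by rewrite (weak_derivativeE wp); exact: wd_H1 wpp.
Qed.

Lemma KG_opE z : A z = mkX (vel z)
  (weak_derivative (weak_derivative (pos z + vel z)) - m%:C *: pos z).
Proof. by rewrite mkX.unlock. Qed.

Section DomData.
Variables (z : X) (v' p' p'' : L2 R).
Hypothesis dz : dom_data z v' p' p''.

Lemma pos_A : pos (A z) = vel z.
Proof. by case: dz => wv _ _; rewrite KG_opE; exact: (pos_mkX _ wv). Qed.
Lemma dpos_A : dpos (A z) = v'.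
Proof. by case: dz => wv _ _; rewrite KG_opE; exact: (dpos_mkX _ wv). Qed.
Lemma vel_A : vel (A z) = p'' - m%:C *: pos z.
Proof.
by case: dz => _ wp wpp; rewrite KG_opE vel_mkX (weak_derivativeE wp) (weak_derivativeE wpp).
Qed.

Lemma dom_p' : p' = dpos z + v'.
Proof. by case: dz => wv wp _; exact: wd_unique wp (wdD (wd_pos z) wv). Qed.

(** Integration by parts cancels the elastic terms and leaves the Kelvin-Voigt damping alone, which
    sees only the derivative of the velocity. *)
Lemma A_dissipative : ipX (A z) z = - ip v' v'.
Proof.
case: (dz) => wv wp wpp; rewrite /ipX pos_A dpos_A vel_A.
rewrite (formBl ipf) (formZl ipf) (wd_ibp wpp wv) dom_p' (formDl ipf).
by rewrite (formC ipf (vel z)) (formC ipf v' (dpos z)); ring.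
Qed.

End DomData.

(* The classical cross term: it trades kinetic for potential energy, which makes
   the energy estimate of [Dq_decay_dom] coercive in all three components. *)
Definition qI z w : R := 2^-1 * (ip (vel z) (pos w) + ip (vel w) (pos z)) +
  2^-1 * ip (dpos z) (dpos w).

Lemma qI_form : sform qI.
Proof.
apply: (sformD (sformZ _ (cross_form vel_lin pos_lin)) (sformZ _ (pull_form dpos_lin))).
Qed.

Lemma qI_bounded : bounded_form ipX qI.
Proof.
have s0 : 0 <= (Num.sqrt m)^-1 by rewrite invr_ge0 sqrtr_ge0.
have v1 z : nm (vel z) <= 1 * nX z by rewrite mul1r vel_le.
have d1 z : nm (dpos z) <= 1 * nX z by rewrite mul1r dpos_le.
apply: bounded_formD; apply: bounded_formZ; last exact: (bounded_cross ler01 ler01 d1 d1).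
apply: bounded_formD; first exact: (bounded_cross ler01 s0 v1 pos_le).
have := bounded_cross s0 ler01 pos_le v1; congr bounded_form.
by apply/funext => z; apply/funext => w; rewrite (formC ipf).
Qed.

(** Pairing the equation with the position produces the damping term [- ip v' (dpos z)]; the summand
    of [qI] in [dpos] is there to cancel it. *)
Lemma qI_A z v' p' p'' : dom_data z v' p' p'' ->
  2 * qI (A z) z = ip (vel z) (vel z) - m * ip (pos z) (pos z) - ip (dpos z) (dpos z).
Proof.
move=> dz; case: (dz) => wv wp wpp; rewrite /qI (pos_A dz) (dpos_A dz) (vel_A dz).
rewrite (formBl ipf) (formZl ipf) (wd_ibp wpp (wd_pos z)) (dom_p' dz) (formDl ipf).
by field.
Qed.

(** [2 |ip (vel z) (pos z)|] is at most [|vel z|^2 + |pos z|^2], while the energy contains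
    [m |pos z|^2]: this is the origin of [1 + m^-1]. *)
Lemma qI_le z : `|qI z z| <= 2^-1 * (1 + m^-1) * ipX z z.
Proof.
have mi : 0 < m^-1 by rewrite invr_gt0.
have p0 := ip0 (pos z); have d0 := ip0 (dpos z); have v0 := ip0 (vel z).
have mm : m^-1 * m = 1 by rewrite mulVf ?gt_eqF.
have h1 := ip0 (vel z + pos z); have h2 := ip0 (vel z - pos z).
rewrite (formDD ipf) in h1; rewrite (formBB ipf) in h2.
have e : (1 + m^-1) * ipX z z = ip (pos z) (pos z) + m * ip (pos z) (pos z) +
   (1 + m^-1) * (ip (dpos z) (dpos z) + ip (vel z) (vel z)).
  by rewrite /ipX; field; rewrite gt_eqF.
have h3 : 0 <= m * ip (pos z) (pos z) by [].
have h4 : 0 <= m^-1 * (ip (dpos z) (dpos z) + ip (vel z) (vel z)).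
  by apply: mulr_ge0; [exact: ltW|exact: addr_ge0].
by rewrite -mulrA e /qI ler_norml; apply/andP; split; lra.
Qed.

Lemma dom_shX h z v' p' p'' : dom_data z v' p' p'' ->
  dom_data (shX h z) (pull 1 h v') (pull 1 h p') (pull 1 h p'').
Proof.
move=> [wv wp wpp]; split; [by rewrite vel_shX; exact: wd_shift| |exact: wd_shift].
rewrite pos_shX vel_shX; have := pull_lin h (oner_neq0 R) 1 (pos z) (vel z); rewrite !scale1r => <-.
exact: wd_shift.
Qed.

Lemma A_shX h z : D z -> A (shX h z) = shX h (A z).
Proof.
move=> /domP[v' [p' [p'' dz]]]; have sz := dom_shX h dz; apply: state_ext.
  by rewrite (pos_A sz) vel_shX pos_shX (pos_A dz).
rewrite (vel_A sz) vel_shX (vel_A dz) pos_shX.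
have := pull_lin h (oner_neq0 R) (- m%:C) (pos z) p''.
by rewrite !scaleNr addrC [RHS]addrC => ->.
Qed.

Lemma dom_lin (k : R[i]) z v' p' p'' w v1 p1 p2 :
  dom_data z v' p' p'' -> dom_data w v1 p1 p2 ->
  dom_data (k *: z + w) (k *: v' + v1) (k *: p' + p1) (k *: p'' + p2).
Proof.
move=> [a1 a2 a3] [b1 b2 b3]; rewrite /dom_data pos_lin vel_lin addrACA -scalerDr.
by split; [exact: wd_lin a1 b1|exact: wd_lin a2 b2|exact: wd_lin a3 b3].
Qed.

Lemma D_lin (k : R[i]) z w : D z -> D w ->
  D (k *: z + w) /\ A (k *: z + w) = k *: A z + A w.
Proof.
move=> /domP[v' [p' [p'' dz]]] /domP[v1 [p1 [p2 dw]]]; have dzw := dom_lin k dz dw.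
split; first by apply/domP; exists (k *: v' + v1), (k *: p' + p1), (k *: p'' + p2).
apply: state_ext; first by rewrite pos_lin !(pos_A dzw, pos_A dz, pos_A dw) vel_lin.
rewrite vel_lin (vel_A dzw) (vel_A dz) (vel_A dw) pos_lin !scalerBr !scalerDr.
by rewrite !scalerA (mulrC k) opprD addrACA.
Qed.

Lemma D_DX h z : D z -> D (DX h z) /\ A (DX h z) = DX h (A z).
Proof.
move=> Dz; have Dsz : D (shX h z).
  by case/domP: Dz => v' [p' [p'' dz]]; apply/domP; do 3 eexists; exact: dom_shX dz.
have [D1 A1] := D_lin (-1) Dz Dsz.
have E : -1 *: z + shX h z = shX h z - z by rewrite scaleN1r addrC.
rewrite E in D1 A1; have {}A1 : A (shX h z - z) = A (shX h z) - A z.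
  by rewrite A1 scaleN1r addrC.
have D0 : D 0.
  apply/domP; exists 0, 0, 0; rewrite /dom_data (lin_0 pos_lin) (lin_0 vel_lin) addr0.
  by split; exact: wd0.
have [D2 A2] := D_lin (h^-1)%:C D1 D0; rewrite (addr0 (_ *: _)) in D2 A2.
have A0 : A 0 = 0.
  have [_] := D_lin (-1) D0 D0; rewrite (scaler0 _ (-1)) (addr0 0) scaleN1r.
  by rewrite (addNr (A 0)).
rewrite DX.unlock A0 (addr0 (_ *: _)) A1 (A_shX h Dz) in D2 A2 *.
by split.
Qed.

(** Two averages give each component two weak derivatives, so position and velocity are separately
    in H^2. *)
Lemma D_StX2 h z : h != 0 -> D (StX h (StX h z)).
Proof.
move=> h0; have H (u : L2 R) : Hk 2 (St h (St h u)) by do 2 apply: Hk_St => //.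
have [p1 w1 [p2 w2 _]] := H (pos z); have [v1 x1 [v2 x2 _]] := H (vel z).
apply/domP; exists v1, (p1 + v1), (p2 + v2).
rewrite /dom_data !(pos_StX h0, vel_StX).
by split => //; exact: wdD.
Qed.

Lemma dense_D z e : 0 < e -> exists2 y, D y & nX (y - z) < e.
Proof.
move=> e0; have /cvgrPdist_lt/(_ e e0)[N _ HN] := StX2_cvg z.
exists (StX (hn R N) (StX (hn R N) z)); first exact: D_StX2 (hn_neq0 R N).
by have := HN N (leqnn N); rewrite /= sub0r normrN ger0_norm ?fnorm_ge0.
Qed.

End EnergySpace.

Lemma subr_regroup (V : zmodType) (a b c d e f : V) :
  a - b - (c - d) - (e - f) = (a - c - e) - (b - d - f).
Proof.
by rewrite !opprD !opprK !addrA [LHS](ACl (1*3*5*2*4*6)).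
Qed.

Lemma subr_cancel (V : zmodType) (a b c : V) : c - b = (a - b) - (a - c).
Proof. by rewrite opprB [RHS]addrC addrA subrK. Qed.

(** * Decay of difference quotients *)

Section Decay.
Variables (R : realType) (m : R).
Hypothesis m0 : 0 < m.
Local Notation X := (KG_space R).
Local Notation wd := (@is_weak_derivative R).
Local Notation D := (@KG_dom R).
Local Notation A := (KG_op m).
Local Notation nX := (fnorm (ipX m)).
Local Notation hn := (hn R).
Implicit Types (z w y : X) (h c t s : R).
Variable T : R -> X -> X.
Hypotheses (T_sg : contraction_C0_semigroup nX T) (T_gen : generator_of nX T D A).
Let fX := @ipX_form R m.
Let X0 := ipX_ge0 m0.
Let ip0 := @ip_ge0 R.

Let dbl (a b c k : R) : 2 * (a + (b + 2^-1 * k * c)) = 2 * a + (2 * b + k * c).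
Proof. by rewrite !mulrDr -mulrA mulVKf ?pnatr_eq0. Qed.

Lemma ipX_A_le0 z : D z -> ipX m (A z) z <= 0.
Proof.
by move=> /domP[v' [p' [p'' dz]]]; rewrite (A_dissipative m dz) oppr_le0.
Qed.

Lemma approx_sol_shX h (x : R -> X) : approx_sol (ipX m) D A x ->
  approx_sol (ipX m) D A (fun t => shX h (x t)).
Proof.
have HB := shX_lin h.
have shB z w : shX h (z - w) = shX h z - shX h w.
  have := HB (-1) w z; rewrite !scaleN1r => H.
  by rewrite [z - w]addrC [shX h z - _]addrC.
have shZ c z : shX h (c%:C *: z) = c%:C *: shX h z.
  have s0 : shX h 0 = 0 by have := shB 0 0; rewrite (subrr 0) (subrr (shX h 0)).
  by have := HB c%:C z 0; rewrite s0 (addr0 (_ *: z)) (addr0 (_ *: shX h z)).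
move=> [Dx [M HM] Hx]; split.
- by move=> t t0; case/domP: (Dx t t0) => v' [p' [p'' dz]]; apply/domP; do 3 eexists; exact: dom_shX dz.
- by exists M => t t0; rewrite A_shX ?nX_shX; [exact: HM|exact: Dx].
- move=> e e0; have [d d0 Hd] := Hx e e0; exists d => // t s t0 s0.
  rewrite A_shX; last exact: Dx.
  by rewrite -shZ -!shB nX_shX; exact: Hd.
Qed.

Lemma approx_solB (x y : R -> X) : approx_sol (ipX m) D A x ->
  approx_sol (ipX m) D A y -> approx_sol (ipX m) D A (fun t => x t - y t).
Proof.
move=> [Dx [M HM] Hx] [Dy [M' HM'] Hy].
have DAB t : 0 <= t -> D (x t - y t) /\ A (x t - y t) = A (x t) - A (y t).
  move=> t0; have [D1 A1] := D_lin m (-1) (Dy t t0) (Dx t t0).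
  have E : -1 *: y t + x t = x t - y t by rewrite scaleN1r addrC.
  by rewrite E in D1 A1; split => //; rewrite A1 scaleN1r addrC.
split.
- by move=> t /DAB[].
- exists (M + M') => t t0; have [_ ->] := DAB t t0; have [h1 h2] := HM t t0.
  have [h3 h4] := HM' t t0.
  by split; rewrite (le_trans (fnormB fX X0 _ _))// lerD.
- move=> e e0; have e2 : 0 < e / 2 by rewrite divr_gt0.
  have [d d0 Hd] := Hx _ e2; have [d' d0' Hd'] := Hy _ e2.
  exists (Num.min d d'); first by rewrite lt_min d0.
  move=> t s t0 /andP[s0]; rewrite lt_min => /andP[sd sd'].
  have [_ ->] := DAB t t0; have := Hd t s t0; have := Hd' t s t0.
  rewrite s0 sd sd' => /(_ isT) H' /(_ isT) H.
  rewrite (_ : _ - _ = (x (t + s) - x t - s%:C *: A (x t)) -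
    (y (t + s) - y t - s%:C *: A (y t))); last first.
    by rewrite scalerBr subr_regroup.
  rewrite (le_trans (fnormB fX X0 _ _))//; lra.
Qed.

(** A bounded form is continuous and the domain is dense. An approximant with [|y| <= |z| + 1] makes
    [q y y - q z z] at most [|y - z| * c]. *)
Lemma dense_closed (q : X -> X -> R) : sform q -> bounded_form (ipX m) q ->
  (forall z, D z -> 0 <= q z z) -> forall z, 0 <= q z z.
Proof.
move=> sq [K K0 Kq] Hq z; apply/ler_addgt0Pr => e e0.
pose c := K * (2 * nX z + 1) + 1.
have c0 : 0 < c by rewrite ltr_wpDl// mulr_ge0// addr_ge0// mulr_ge0// fnorm_ge0.
have [|y Dy yz] := dense_D m0 z (e := Num.min 1 (e / c)).
  by rewrite lt_min ltr01 divr_gt0.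
move: yz; rewrite lt_min => /andP[yz1 yz2].
have y1 : nX y <= nX z + 1.
  have := fnormD fX X0 (y - z) z; rewrite subrK; lra.
have H : q y y - q z z = q (y - z) y + q (y - z) z.
  by rewrite !formBl// (formC sq z y); ring.
have H1 : q (y - z) y <= nX (y - z) * (K * nX y).
  by rewrite (le_trans (ler_norm _))// (le_trans (Kq _ _))// mulrCA.
have H2 : q (y - z) z <= nX (y - z) * (K * nX z).
  by rewrite (le_trans (ler_norm _))// (le_trans (Kq _ _))// mulrCA.
have H3 : nX (y - z) * (K * nX y + K * nX z) <= e.
  apply: (@le_trans _ _ (nX (y - z) * c)).
    rewrite ler_wpM2l ?fnorm_ge0// /c -mulrDr.
    rewrite (@le_trans _ _ (K * (2 * nX z + 1)))//; last by rewrite lerDl.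
    by rewrite ler_wpM2l//; lra.
  by rewrite -ler_pdivlMr// ltW.
by have := Hq y Dy; lra.
Qed.

(** Uniqueness by dissipativity: for data in the domain, the translated trajectory minus the
    trajectory of the translate starts from zero and solves the equation, so its energy stays zero.
    Density and contraction give the rest. *)
Lemma sg_shX h t z : 0 <= t -> T t (shX h z) = shX h (T t z).
Proof.
move=> t0; have shB z' w : shX h (z' - w) = shX h z' - shX h w.
  have := shX_lin h (-1) w z'; rewrite !scaleN1r => H.
  by rewrite [z' - w]addrC [shX h z' - _]addrC.
have key y : D y -> T t (shX h y) = shX h (T t y).
  move=> Dy; have Dsy : D (shX h y).
    by case/domP: Dy => v' [p' [p'' dz]]; apply/domP; do 3 eexists; exact: dom_shX dz.
  have ax := approx_solB (approx_sol_shX h (sg_approx_sol fX T_sg T_gen Dy))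
    (sg_approx_sol fX T_sg T_gen Dsy).
  have [Dx _ _] := ax.
  have := approx_sol_upper fX X0 ax fX (bounded_form_self fX X0) (K := 0) _ t0.
  rewrite mulr0 addr0 !(sg_start T_sg) subrr (form0l fX) => H.
  apply/eqP; rewrite eq_sym -subr_eq0; apply/eqP/(ipX_eq0 m0).
  apply/eqP; rewrite eq_le X0 andbT; apply: H => s s0.
  by rewrite pmulr_rle0//; exact/ipX_A_le0/Dx.
apply/eqP; rewrite -subr_eq0; apply/eqP/(ipX_eq0 m0).
suff n0 : nX (T t (shX h z) - shX h (T t z)) <= 0.
  have n00 : nX (T t (shX h z) - shX h (T t z)) = 0.
    by apply/eqP; rewrite eq_le n0 fnorm_ge0.
  by rewrite -nX_sqr// n00 expr0n.
apply/ler_addgt0Pr => e e0; rewrite add0r.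
have [|y Dy yz] := dense_D m0 z (e := e / 2); first by rewrite divr_gt0.
rewrite (_ : _ - _ = shX h (T t (y - z)) - T t (shX h (y - z))); last first.
  rewrite (sgB T_sg y z t0) (shB (T t y)) (shB y z) (sgB T_sg (shX h y) _ t0) (key y Dy).
  exact: subr_cancel.
rewrite (le_trans (fnormB fX X0 _ _))// nX_shX.
have := sg_contr T_sg (y - z) t0; have := sg_contr T_sg (shX h (y - z)) t0.
rewrite nX_shX; lra.
Qed.

Lemma sg_DX h t z : 0 <= t -> T t (DX h z) = DX h (T t z).
Proof. by move=> t0; rewrite DX.unlock (sgZ T_sg)// (sgB T_sg)// sg_shX. Qed.

Let C : R := 1 + m^-1.

Lemma Dq_decay_dom h t z : h != 0 -> 0 <= t -> D z ->
  t * ipX m (DX h (T t z)) (DX h (T t z)) <=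
  ipX m z z + C * ipX m (DX h z) (DX h z).
Proof.
move=> h0 t0 Dz.
pose q2 z w := ipX m (DX h z) (DX h w).
pose q1 z w := ipX m z w + (qI (DX h z) (DX h w) + 2^-1 * C * q2 z w).
have M0 : 0 <= `|h|^-1 * 2 by rewrite mulr_ge0 ?invr_ge0.
have s2 : sform q2 by apply: sform_comp fX; exact: DX_lin.
have b2 : bounded_form (ipX m) q2.
  exact: (bounded_form_comp M0 (nX_DX m0 h) (bounded_form_self fX X0)).
have s1 : sform q1.
  apply: sformD => //; apply: sformD; last exact: sformZ.
  by apply: (sform_comp (DX_lin h)); exact: qI_form.
have b1 : bounded_form (ipX m) q1.
  apply: bounded_formD; first exact: bounded_form_self.
  apply: bounded_formD; last exact: bounded_formZ.
  exact: (bounded_form_comp M0 (nX_DX m0 h) (qI_bounded m0)).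
have C0 : 0 <= C by rewrite addr_ge0// invr_ge0 ltW.
have H2 y : D y -> q2 (A y) y <= 0.
  by move=> Dy; have [D1 A1] := D_DX m h Dy; rewrite /q2 -A1; exact: ipX_A_le0.
(* Twice the cross term turns into [|D_h v|^2] minus the two potential terms, so adding [q2] leaves
   [2 |D_h v|^2 - 2 |v'|^2] besides a non-positive multiple of the energy production of [D_h y]. As
   [D_h v = S_h v'], the damping absorbs it for every [h]. *)
have H1 y : D y -> 2 * q1 (A y) y + q2 y y <= 0.
  move=> Dy; have [D1 A1] := D_DX m h Dy; rewrite /q1 dbl.
  have := H2 y Dy; move: Dy => /domP[v' [p' [p'' dy]]].
  rewrite (A_dissipative m dy) -A1.
  case/domP: D1 => v1 [p1 [p2 d1]]; rewrite (qI_A m d1).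
  have e1 : q2 y y = m * ip (pos (DX h y)) (pos (DX h y)) +
     ip (dpos (DX h y)) (dpos (DX h y)) + ip (vel (DX h y)) (vel (DX h y)) by [].
  rewrite e1 vel_DX; case: dy => wv _ _; rewrite (wd_Dq h0 wv).
  have := St_le h v' => H3 H4; have := mulr_ge0_le0 C0 H4; lra.
have := approx_sol_lyapunov fX X0 (sg_approx_sol fX T_sg T_gen Dz) s1 b1 s2 b2 H1 H2 t0.
rewrite (sg_start T_sg) => H.
(* By [qI_le] the cross term plus [C/2] times [q2] lies between zero and [C] times [q2]: the lower
   bound serves at time [t], the upper one at time zero. *)
have /ler_normlP[_ k2] := qI_le m0 (DX h z).
have /ler_normlP[k1 _] := qI_le m0 (DX h (T t z)).
have := X0 (T t z); move: H k1 k2.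
rewrite /q1 /q2 /C; move: (qI _ _) (qI _ _) (ipX m _ _) (ipX m _ _) (ipX m _ _) (ipX m _ _) (1 + m^-1).
by move=> a b x y d e c; lra.
Qed.

(** Once [DX h] is moved through [T t], both sides are bounded quadratic forms in the initial state,
    so the inequality extends from the dense domain. *)
Lemma Dq_decay h t z : h != 0 -> 0 <= t ->
  t * ipX m (T t (DX h z)) (T t (DX h z)) <= ipX m z z + C * ipX m (DX h z) (DX h z).
Proof.
move=> h0 t0; rewrite sg_DX//.
have M0 : 0 <= `|h|^-1 * 2 by rewrite mulr_ge0 ?invr_ge0.
have lT : linear (fun z => DX h (T t z)).
  by move=> k y w; rewrite (sg_lin T_sg)// DX_lin.
pose q y w := (ipX m y w + C * ipX m (DX h y) (DX h w)) +
  (- t) * ipX m (DX h (T t y)) (DX h (T t w)).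
have := @dense_closed q _ _ _ z; rewrite /q mulNr subr_ge0; apply.
- apply: (sformD (sformD fX (sformZ _ _)) (sformZ _ _)).
    exact: (sform_comp (DX_lin h) fX).
  exact: (sform_comp lT fX).
- apply: bounded_formD; last apply: bounded_formZ.
    apply: bounded_formD; first exact: bounded_form_self.
    apply: bounded_formZ.
    exact: (bounded_form_comp M0 (nX_DX m0 h) (bounded_form_self fX X0)).
  apply: (bounded_form_comp (L := fun z => DX h (T t z)) M0 _ (bounded_form_self fX X0)).
  move=> y; rewrite (le_trans (nX_DX m0 _ _))// ler_wpM2l//; exact: sg_contr.
- by move=> y Dy; rewrite mulNr subr_ge0; exact: Dq_decay_dom.
Qed.

End Decay.

Lemma subr_telescope (V : zmodType) (a b c : V) : a - (b - c) + (- c - a) = - b.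
Proof. by rewrite opprB (addrA a) -opprD (addrC c a) [LHS]addrAC subrr add0r. Qed.

Definition wd2 (R : realType) (q r : L2 R) :=
  exists2 q', is_weak_derivative q q' & is_weak_derivative q' r.

(** * Stability and the rate on the resolvent ranges *)

Section ResolventRange.
Variables (R : realType) (m : R).
Hypothesis m0 : 0 < m.
Local Notation X := (KG_space R).
Local Notation wd := (@is_weak_derivative R).
Local Notation D := (@KG_dom R).
Local Notation A := (KG_op m).
Local Notation nX := (fnorm (ipX m)).
Local Notation hn := (hn R).
Implicit Types (z w y : X) (h c t s : R).

Lemma ipX_shift_cvg0 z : ipX m (shX n%:R z) z @[n --> \oo] --> (0 : R).
Proof.
have -> : (fun n : nat => ipX m (shX n%:R z) z) = (fun n : nat =>
    m * ip (pull 1 n%:R (pos z)) (pos z) + ip (pull 1 n%:R (dpos z)) (dpos z) +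
    ip (pull 1 n%:R (vel z)) (vel z)).
  by apply/funext => n; rewrite /ipX pos_shX dpos_shX vel_shX.
rewrite -[X in _ --> X](addr0 (0 : R)); apply: cvgD; last exact: ip_shift_cvg0.
rewrite -[X in _ --> X](addr0 (0 : R)); apply: cvgD; last exact: ip_shift_cvg0.
by rewrite -[X in _ --> X](mulr0 m); apply: cvgM (cvg_cst _) _; exact: ip_shift_cvg0.
Qed.

Lemma wd2_lin (k : R[i]) (q r q1 r1 : L2 R) : wd2 q r -> wd2 q1 r1 ->
  wd2 (k *: q + q1) (k *: r + r1).
Proof. by move=> [q' a b] [q1' a1 b1]; exists (k *: q' + q1'); exact: wd_lin. Qed.

Lemma wd20 : wd2 (0 : L2 R) 0.
Proof. by exists 0; exact: wd0. Qed.

Lemma Ran_wd2 (a : R[i]) z : a ^+ 2 = (- m)%:C -> resolvent_range D A a z ->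
  exists q, wd2 q (vel z + a *: pos z).
Proof.
move=> a2 [y /domP[v' [p' [p'' dy]]] <-]; exists (-1 *: (pos y + vel y) + 0).
have -> : vel (a *: y - A y) + a *: pos (a *: y - A y) = -1 *: p'' + 0.
  rewrite (lin_B (@vel_lin R)) (lin_B (@pos_lin R)) (lin_Z (@vel_lin R)) (lin_Z (@pos_lin R)).
  rewrite (pos_A m dy) (vel_A m dy) scalerBr scalerA -expr2 a2 scaleN1r.
  by rewrite rmorphN scaleNr (addr0 (- p'')); exact: subr_telescope.
by case: dy => _ w1 w2; apply: wd2_lin wd20; exists p'.
Qed.

(** The two ranges make [vel z + a pos z] and [vel z - a pos z] second derivatives; as [a] is
    non-zero, sum and difference recover both components. *)
Lemma Ran_pm_wd2 (a : R[i]) z : a ^+ 2 = (- m)%:C ->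
  resolvent_range D A a z -> resolvent_range D A (- a) z ->
  exists q1 q2, wd2 q1 (pos z) /\ wd2 q2 (vel z).
Proof.
move=> a2 /(Ran_wd2 a2)[p wp] /Ran_wd2[|q wq]; first by rewrite sqrrN.
have a0 : a != 0.
  apply/eqP => a00; move/eqP: a2; rewrite a00 expr0n eq_complex /=.
  by rewrite (eq_sym 0) oppr_eq0 gt_eqF.
have a20 : a * 2 != 0 by rewrite mulf_neq0// pnatr_eq0.
have two : (2 : R[i]) != 0 by rewrite pnatr_eq0.
exists ((a * 2)^-1 *: (-1 *: q + p) + 0), (2^-1 *: (1 *: q + p) + 0).
split.
- rewrite [pos z](_ : _ = (a * 2)^-1 *:
    (-1 *: (vel z + - a *: pos z) + (vel z + a *: pos z)) + 0).
    by apply: wd2_lin wd20; exact: wd2_lin.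
  rewrite scaleN1r (addr0 (_ *: _)) scaleNr opprB addrA subrK -scalerDl.
  by rewrite -mulr2n -(mulr_natr a) scalerA mulVf// scale1r.
- rewrite [vel z](_ : _ = 2^-1 *:
    (1 *: (vel z + - a *: pos z) + (vel z + a *: pos z)) + 0).
    by apply: wd2_lin wd20; exact: wd2_lin.
  rewrite scale1r (addr0 (_ *: _)) scaleNr addrCA subrK -(mulr2n (vel z)) -(scaler_nat _ (vel z)).
  by rewrite scalerA mulVf// scale1r.
Qed.

(* The solution of [a y - A y = z] has [vel y = a pos y] and
   [(1 + a) pos y = - g]. *)
Lemma Ran_mkX (a : R[i]) (g g' g'' : L2 R) : a ^+ 2 = (- m)%:C ->
  wd g g' -> wd g' g'' -> resolvent_range D A a (mkX 0 g'').
Proof.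
move=> a2 gg' gg''.
have a1 : 1 + a != 0.
  apply/eqP => a1; have ea : a = -1 by apply/eqP; rewrite -addr_eq0 addrC a1.
  move/eqP: a2; rewrite ea sqrrN expr1n eq_complex /= eqxx andbT => /eqP e1.
  by move: m0; rewrite -oppr_lt0 -e1 ltr10.
pose k := - (1 + a)^-1; pose y := mkX (k *: g) (a *: (k *: g)).
have wy : wd (k *: g) (k *: g') by exact: wdZ.
have E (u : L2 R) : k *: u + a *: (k *: u) = - u.
  by rewrite -[X in X + _]scale1r -scalerDl scalerA mulrN mulfV// scaleN1r.
have dy : dom_data y (a *: (k *: g')) (- g') (- g'').
  rewrite /dom_data vel_mkX (pos_mkX _ wy) (E g); split; [|exact: wdN|exact: wdN].
  by apply: wdZ; exact: wdZ.
exists y; first by apply/domP; do 3 eexists; exact: dy.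
apply: state_ext.
  rewrite (lin_B (@pos_lin R)) (lin_Z (@pos_lin R)) (pos_A m dy) (pos_mkX _ wy) vel_mkX.
  by rewrite (pos_mkX _ (@wd0 R)) subrr.
rewrite (lin_B (@vel_lin R)) (lin_Z (@vel_lin R)) (vel_A m dy) (pos_mkX _ wy) !vel_mkX.
by rewrite opprB opprK scalerA -expr2 a2 rmorphN scaleNr addKr.
Qed.

Variable T : R -> X -> X.
Hypotheses (T_sg : contraction_C0_semigroup nX T) (T_gen : generator_of nX T D A).
Let fX := @ipX_form R m.
Let X0 := ipX_ge0 m0.
Let C : R := 1 + m^-1.

(* [z] is the half-sum of itself and a far translate, which are almost orthogonal,
   plus a difference quotient, whose energy decays. *)
Lemma sg_contraction_step z : exists2 t, 0 <= t & nX (T t z) <= 7 / 8 * nX z.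
Proof.
have [N0|N0] := eqVneq (nX z) 0.
  by exists 0; rewrite ?(sg_start T_sg) ?N0 ?mulr0.
have N1 : 0 < nX z by rewrite lt_neqAle eq_sym N0 fnorm_ge0.
have N2 : 0 < nX z ^+ 2 by rewrite exprn_gt0.
have [n n0 Hn] : exists2 n : nat, (0 < n)%N & ipX m (shX n%:R z) z <= nX z ^+ 2 / 8.
  have /cvgrPdist_le/(_ (nX z ^+ 2 / 8)) := ipX_shift_cvg0 z.
  case; first by rewrite divr_gt0.
  move=> N _ HN; exists N.+1 => //; have := HN N.+1 (leqnSn N).
  by rewrite /= sub0r normrN => /ler_normlP[].
have h0 : n%:R != 0 :> R by rewrite pnatr_eq0 -lt0n.
pose sz := shX n%:R z; pose dz := DX n%:R z.
pose K := ipX m z z + C * ipX m dz dz.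
have K0 : 0 <= K.
  by rewrite addr_ge0 ?X0// mulr_ge0 ?X0// addr_ge0// invr_ge0 ltW.
pose t := 16 * n%:R ^+ 2 * K / nX z ^+ 2 + 1.
have t1 : 0 <= 16 * n%:R ^+ 2 * K / nX z ^+ 2.
  by rewrite divr_ge0 ?(ltW N2)// mulr_ge0// mulr_ge0// sqr_ge0.
have t0 : 0 < t by rewrite ltr_wpDl.
exists t; first exact: ltW.
have zE : z = (2^-1)%:C *: (z + sz) - (n%:R / 2)%:C *: dz.
  rewrite /dz DX.unlock -/sz scalerA -rmorphM mulrAC mulfV// mul1r -scalerBr.
  rewrite opprB addrACA subrr addr0 -(mulr2n z) -(scaler_nat _ z) scalerA.
  by rewrite fmorphV rmorph_nat mulVf ?pnatr_eq0// scale1r.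
(* The shift is an isometry, so [|z + sz|^2 = 2 |z|^2 + 2 (sz, z) <= (9/4) |z|^2]. *)
have H1 : nX ((2^-1)%:C *: (z + sz)) <= 3 / 4 * nX z.
  rewrite (fnormZ fX) gtr0_norm ?invr_gt0//.
  have : nX (z + sz) ^+ 2 <= (3 / 2 * nX z) ^+ 2.
    rewrite nX_sqr// (formDD fX) (formC fX z sz) ipX_shX -nX_sqr//.
    by rewrite exprMn; move: Hn; rewrite -/sz; lra.
  rewrite ler_sqr ?nnegrE ?fnorm_ge0 ?mulr_ge0 ?fnorm_ge0//; lra.
have H2 : nX (T t ((n%:R / 2)%:C *: dz)) <= 8^-1 * nX z.
  rewrite (sgZ T_sg) ?(ltW t0)// (fnormZ fX) ger0_norm ?divr_ge0//.
  rewrite -(@ler_sqr R) ?nnegrE ?mulr_ge0 ?fnorm_ge0 ?divr_ge0 ?invr_ge0//.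
  rewrite -(ler_pM2l t0) !exprMn mulrCA (nX_sqr m0 (T t dz)).
  have := Dq_decay m0 T_sg T_gen z h0 (ltW t0); rewrite -/dz -/C -/K => H3.
  have n20 : 0 <= n%:R ^+ 2 * 2^-1 ^+ 2 :> R by rewrite mulr_ge0// sqr_ge0.
  apply: (le_trans (ler_wpM2l n20 H3)).
  have : 16 * n%:R ^+ 2 * K <= t * nX z ^+ 2.
    by rewrite /t (mulrDl _ 1) mulfVK ?gt_eqF// mul1r lerDl ltW.
  move: (t * nX z ^+ 2) (nX z ^+ 2) (n%:R ^+ 2) => a b c; rewrite (mulrA t) [t * _]mulrC -mulrA.
  lra.
rewrite [in leLHS]zE (sgB T_sg) ?(ltW t0)// (le_trans (fnormB fX X0 _ _))//.
have := sg_contr T_sg ((2^-1)%:C *: (z + sz)) (ltW t0); lra.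
Qed.
End ResolventRange.

Section DecayRates.
Variables (R : realType) (m : R).
Hypothesis m0 : 0 < m.
Local Notation X := (KG_space R).
Local Notation wd := (@is_weak_derivative R).
Local Notation D := (@KG_dom R).
Local Notation A := (KG_op m).
Local Notation nX := (fnorm (ipX m)).
Local Notation hn := (hn R).
Implicit Types (z w y : X) (h c t s : R).
Variable T : R -> X -> X.
Hypotheses (T_sg : contraction_C0_semigroup nX T) (T_gen : generator_of nX T D A).
Let fX := @ipX_form R m.
Let X0 := ipX_ge0 m0.
Let C : R := 1 + m^-1.

(** The waiting time of a contraction step depends on the state, so each step restarts from the
    state reached before; the total time is not controlled. *)
Lemma sg_geometric_decay n z : exists2 t, 0 <= t & nX (T t z) <= (7 / 8) ^+ n * nX z.
Proof.
elim: n z => [|n IHn] z.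
  by exists 0; rewrite ?(sg_start T_sg) ?mul1r.
have [s s0 Hs] := sg_contraction_step m0 T_sg T_gen z.
have [t t0 Ht] := IHn (T s z); exists (t + s); first exact: addr_ge0.
rewrite (sg_comp T_sg)// (le_trans Ht)// exprSr -mulrA ler_wpM2l//.
Qed.

Lemma sg_strongly_stable z : nX (T t z) @[t --> +oo] --> (0 : R).
Proof.
apply/cvgrPdist_le => e e0.
have q1 : `|7 / 8 : R| < 1 by rewrite ger0_norm ?divr_ge0// ltr_pdivrMr// mul1r ltr_nat.
have /cvgrPdist_le/(_ e e0)[N _ HN] := cvg_geometric (nX z) q1.
have [s s0 Hs] := sg_geometric_decay N z; near=> t.
rewrite sub0r normrN ger0_norm ?fnorm_ge0//.
have st : s <= t by near: t; exact: nbhs_pinfty_ge (num_real _).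
rewrite (le_trans (sg_mono T_sg z s0 st))// (le_trans Hs)//.
by have := HN N (leqnn N); rewrite /= sub0r normrN mulrC => /ler_normlP[].
Unshelve. all: by end_near. Qed.

Lemma DX_primitive h q q' v v' w : h != 0 -> pos w = q' -> vel w = v' ->
  wd q q' -> wd v v' -> DX h (mkX q v) = StX h w.
Proof.
move=> h0 pw vw wq wv; apply: state_ext.
  by rewrite pos_DX (pos_mkX _ wq) (wd_Dq h0 wq) (pos_StX h0) pw.
by rewrite vel_DX vel_mkX (wd_Dq h0 wv) vel_StX vw.
Qed.

Let iterated_bound (t k a b q w u p r : R) : 0 <= k ->
  t * a <= q + k * w -> t * b <= w + k * u -> w <= p -> u <= r ->
  t * (a + k * b) <= q + 2 * k * p + k ^+ 2 * r.
Proof.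
move=> k0 H1 H2 wp ur; have kp := ler_wpM2l k0 wp.
have kr := ler_wpM2l (mulr_ge0 k0 k0) ur; have := ler_wpM2l k0 H2.
by rewrite expr2; lra.
Qed.

(* [z] is the second derivative of a state [Q], so the smoothed [St_h (St_h z)]
   equals [D_h (D_h Q)] and [Dq_decay] applies twice; then [h] tends to 0. *)
Lemma sg_inverse_decay q1 q2 z : wd2 q1 (pos z) -> wd2 q2 (vel z) ->
  exists2 K, 0 <= K & forall t, 0 <= t -> t * nX (T (t + t) z) <= K.
Proof.
move=> [q1' w1 w1'] [q2' w2 w2']; pose Q := mkX q1 q2; pose Q' := mkX q1' q2'.
have C0 : 0 <= C by rewrite addr_ge0// invr_ge0 ltW.
pose K := ipX m Q Q + 2 * C * ipX m Q' Q' + C ^+ 2 * ipX m z z.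
have K0 : 0 <= K.
  exact: addr_ge0 (addr_ge0 (X0 _) (mulr_ge0 (mulr_ge0 (ler0n _ 2) C0) (X0 _))) (mulr_ge0 (exprn_ge0 2 C0) (X0 _)).
exists (Num.sqrt K); first exact: sqrtr_ge0.
move=> t t0; pose S n x := StX (hn n) x.
have HS n : t * nX (T (t + t) (S n (S n z))) <= Num.sqrt K.
  have h0 := hn_neq0 R n.
  have E1 : DX (hn n) Q = S n Q'.
    by apply: (DX_primitive h0 (pos_mkX _ w1') (vel_mkX _ _)).
  have E2 : DX (hn n) (S n Q') = S n (S n z).
    have -> : S n Q' = mkX (St (hn n) q1') (St (hn n) q2').
      by rewrite /S StX.unlock (pos_mkX _ w1') vel_mkX.
    apply: (DX_primitive h0 (pos_StX h0 z) (vel_StX _ z)); exact: wd_St_H1.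
  have le1 y : ipX m (S n y) (S n y) <= ipX m y y.
    by rewrite -!(nX_sqr m0) ler_sqr ?nnegrE ?fnorm_ge0//; exact: nX_StX.
  (* Three decay estimates: for [Q] and for [S n Q'] up to time [t], then for the state
     [T t (S n Q')] over a further time [t]. The right-hand side of the third consists of the two
     quantities bounded by the others, and averaging being a contraction keeps [K] independent of
     [n]. *)
  have := Dq_decay m0 T_sg T_gen Q h0 t0; rewrite E1 -/C => H1.
  have := Dq_decay m0 T_sg T_gen (S n Q') h0 t0; rewrite E2 -/C => H2.
  have := Dq_decay m0 T_sg T_gen (T t (S n Q')) h0 t0.
  rewrite -(sg_DX m0 T_sg T_gen _ _ t0) E2 -(sg_comp T_sg)// -/C => H3.
  rewrite -(@ler_sqr R) ?nnegrE ?sqrtr_ge0 ?mulr_ge0 ?fnorm_ge0//.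
  rewrite exprMn (nX_sqr m0) sqr_sqrtr// expr2 -mulrA.
  apply: (le_trans (ler_wpM2l t0 H3)); rewrite /K.
  exact: (iterated_bound C0 H1 H2 (le1 Q') (le_trans (le1 (S n z)) (le1 z))).
apply/ler_addgt0Pr => e e0.
have t1 : 0 < t + 1 by rewrite ltr_wpDl.
have /cvgrPdist_le/(_ _ (divr_gt0 e0 t1))[N _ HN] := StX2_cvg m0 z.
have := HN N (leqnn N); rewrite /= sub0r normrN ger0_norm ?fnorm_ge0// => Hn.
have tt0 : 0 <= t + t by rewrite addr_ge0.
have E : z = S N (S N z) - (S N (S N z) - z) by rewrite subKr.
rewrite [in leLHS]E (sgB T_sg)//.
rewrite (le_trans (ler_wpM2l t0 (fnormB fX X0 _ _)))// mulrDr lerD//.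
have := sg_contr T_sg (S N (S N z) - z) tt0 => H.
rewrite (le_trans (ler_wpM2l t0 (le_trans H Hn)))// mulrCA ler_piMr ?ltW//.
by rewrite ltr_pdivrMr// mul1r ltrDl.
Qed.

End DecayRates.

(** * Optimality *)

Section LowerBound.
Variables (R : realType) (m : R).
Hypothesis m0 : 0 < m.
Local Notation X := (KG_space R).
Local Notation wd := (@is_weak_derivative R).
Local Notation D := (@KG_dom R).
Local Notation A := (KG_op m).
Local Notation nX := (fnorm (ipX m)).
Local Notation nm := (fnorm (@ip R)).
Local Notation hn := (hn R).
Implicit Types (z w y : X) (h c t s : R) (u v f g : L2 R).
Let fX := @ipX_form R m.
Let X0 := ipX_ge0 m0.
Let ipf := @ip_form R.
Let ip0 := @ip_ge0 R.

Lemma mkX0_lin (k : R[i]) u v : mkX 0 (k *: u + v) = k *: mkX 0 u + mkX 0 v.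
Proof.
apply: state_ext; last by rewrite vel_lin !vel_mkX.
by rewrite pos_lin !(pos_mkX _ (@wd0 R)) scaler0 addr0.
Qed.

Lemma mkX0Z (k : R[i]) u : mkX 0 (k *: u) = k *: mkX 0 u.
Proof.
apply: state_ext; last by rewrite (lin_Z (@vel_lin R)) !vel_mkX.
by rewrite (lin_Z (@pos_lin R)) !(pos_mkX _ (@wd0 R)) scaler0.
Qed.

Lemma ipX_mkX0 u : ipX m (mkX 0 u) (mkX 0 u) = ip u u.
Proof.
rewrite /ipX (pos_mkX _ (@wd0 R)) (dpos_mkX _ (@wd0 R)) vel_mkX.
by rewrite !(form0l ipf) mulr0 !add0r.
Qed.

Lemma nX_mkX0 u : nX (mkX 0 u) = nm u.
Proof. by rewrite /fnorm ipX_mkX0. Qed.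

Lemma DX_mkX0 h u : DX h (mkX 0 u) = mkX 0 (Dq h u).
Proof.
apply: state_ext; last by rewrite vel_DX !vel_mkX.
rewrite pos_DX !(pos_mkX _ (@wd0 R)) Dq.unlock.
have -> : pull 1 h 0 = 0 :> L2 R.
  have := pull_lin h (oner_neq0 R) (-1) (0 : L2 R) 0.
  by rewrite scaleN1r (addNr (0 : L2 R)) scaleN1r (addNr (pull 1 h (0 : L2 R))).
by rewrite (subrr (0 : L2 R)) scaler0.
Qed.

Variable T : R -> X -> X.
Hypotheses (T_sg : contraction_C0_semigroup nX T) (T_gen : generator_of nX T D A).

(* [v] is the velocity of [T t (0, f)]; difference quotients commute with [T]. *)
Lemma sg_vel_deriv_le f f' t v' : 0 <= t -> wd f f' ->
  wd (vel (T t (mkX 0 f))) v' -> nm v' <= nm f'.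
Proof.
move=> t0 ff' wv.
have H n : nm v' <= nm f' + nm (Dq (hn n) (vel (T t (mkX 0 f))) - v').
  have le1 : nm (Dq (hn n) (vel (T t (mkX 0 f)))) <= nm f'.
    rewrite -vel_DX -(sg_DX m0 T_sg T_gen _ _ t0) DX_mkX0.
    rewrite (le_trans (vel_le m0 _))// (le_trans (sg_contr T_sg _ t0))// nX_mkX0.
    exact: Dq_nm_le (hn_neq0 R n) ff'.
  have := fnorm_dist ipf ip0 (Dq (hn n) (vel (T t (mkX 0 f)))) v'.
  by move=> /ler_normlP[]; lra.
apply/ler_addgt0Pr => e e0.
have /cvgrPdist_le/(_ _ e0)[N _ HN] := Dq_nm_cvg wv.
have := HN N (leqnn N); rewrite /= sub0r normrN ger0_norm ?fnorm_ge0// => Hn.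
by rewrite (le_trans (H N))// lerD2l.
Qed.

Lemma sg_lower_bound f f' f'' t : 0 <= t -> wd f f' -> wd f' f'' ->
  ip f f - t * (2 * ip f' f') <= ipX m (T t (mkX 0 f)) (T t (mkX 0 f)).
Proof.
move=> t0 ff' ff''.
have dz : dom_data (mkX 0 f) f' f' f''.
  by split; rewrite ?vel_mkX// (pos_mkX _ (@wd0 R)) add0r.
have Dz : D (mkX 0 f) by apply/domP; exists f', f', f''.
have ax := sg_approx_sol fX T_sg T_gen Dz.
rewrite -(ipX_mkX0 f) -[in leLHS](sg_start T_sg (mkX 0 f)).
apply: (approx_sol_lower fX X0 ax fX (bounded_form_self fX X0) _ t0) => s s0.
have [Ds _] := sg_dom T_sg T_gen s0 Dz; move: Ds => /domP[v' [p' [p'' dx]]].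
rewrite (A_dissipative m dx); case: dx => wv _ _.
have := sg_vel_deriv_le s0 ff' wv.
rewrite -(@ler_sqr R) ?nnegrE ?fnorm_ge0// !(fnorm_sqr ip0).
by rewrite mulrN lerN2 ler_pM2l.
Qed.

End LowerBound.

Section Humps.
Variable R : realType.
Local Notation wd := (@is_weak_derivative R).
Local Notation nm := (fnorm (@ip R)).
Implicit Types (u v f g : L2 R).
Let ipf := @ip_form R.
Let ip0 := @ip_ge0 R.

(** The factor [sqrt e] makes the dilation an isometry of L^2. *)
Definition dil (e : R) u : L2 R := (Num.sqrt e)%:C *: pull e 0 u.

Lemma dil_nm e u : 0 < e -> nm (dil e u) = nm u.
Proof.
move=> e0; rewrite /dil (fnormZ ipf) /fnorm ip_pull ?gt_eqF// sqrtrM ?invr_ge0//.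
by rewrite ger0_norm ?sqrtr_ge0// (gtr0_norm e0) mulrA -sqrtrM ?(ltW e0)// mulfV ?gt_eqF// sqrtr1 mul1r.
Qed.

Lemma dil_wd e u u' : 0 < e -> wd u u' -> wd (dil e u) (e%:C *: dil e u').
Proof.
move=> e0 uu; rewrite /dil scalerA mulrC -scalerA; apply: wdZ.
by apply: wd_pull => //; rewrite gt_eqF.
Qed.

Variables (m : R) (T : R -> KG_space R -> KG_space R).
Hypothesis m0 : 0 < m.
Local Notation nX := (fnorm (ipX m)).
Hypotheses (T_sg : contraction_C0_semigroup nX T)
  (T_gen : generator_of nX T (@KG_dom R) (KG_op m)).
Let fX := @ipX_form R m.
Let X0 := ipX_ge0 m0.

Let half_bound (p q r : R) : 0 <= p * q -> p * (4 * r) <= p * q ->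
  p * q * 4^-1 <= p * q - 2 * (p * r).
Proof. by lra. Qed.

Let dilation_identity (t e a b : R) :
  t ^+ 2 * ((e ^+ 2 * a) ^+ 2 - t * (2 * (e ^+ 3 * b) ^+ 2)) =
  (t * e ^+ 2) ^+ 2 * a ^+ 2 - 2 * ((t * e ^+ 2) ^+ 2 * (t * e ^+ 2 * b ^+ 2)).
Proof. by ring. Qed.

(* Dilating a fixed profile by a frequency of order [t^(-1/2)] keeps the damping
   from acting before time [t]. *)
Lemma slow_data : exists2 k : R, 0 < k & forall t, 1 <= t -> exists g g' g'',
  [/\ wd g g', wd g' g'', nm g <= 1, nm g' <= 1 & nm g'' <= 1] /\
  k <= t * nX (T t (mkX 0 g'')).
Proof.
(* The datum is built on [u2], the dissipation is measured by [u3], and [u4] places the datum in the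
   domain. *)
have [u0 [u1 w0 [u2 w1 [u3 w2 [u4 w3 _]]]] u00] := Hk_neq0 R 4.
(* [u2 = 0] would give [u1 = 0] and then [u0 = 0], by [wd_eq0]. *)
have c20 : 0 < nm u2.
  rewrite lt_neqAle fnorm_ge0 andbT eq_sym; apply/eqP => n2.
  have u20 : u2 = 0 by apply: ip_eq0; rewrite -(fnorm_sqr ip0) n2 expr0n.
  rewrite u20 in w1; rewrite (wd_eq0 w1) in w0; move/eqP: u00; apply; exact: wd_eq0 w0.
have [l0 l1 l2] : [/\ nm u0 <= nm u0 + nm u1 + nm u2, nm u1 <= nm u0 + nm u1 + nm u2 &
    nm u2 <= nm u0 + nm u1 + nm u2].
  split; [by rewrite -addrA lerDl addr_ge0 ?fnorm_ge0| |by rewrite lerDr addr_ge0 ?fnorm_ge0].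
  by rewrite addrAC lerDr addr_ge0 ?fnorm_ge0.
have [c0 c1 c3] : [/\ 0 <= nm u0, 0 <= nm u1 & 0 <= nm u3] by split; exact: fnorm_ge0.
set s := nm u0 + nm u1 + nm u2 in l0 l1 l2.
have s0 : 0 <= s by rewrite (le_trans c0).
pose d := (s + 1)^-1; have d0 : 0 < d by rewrite invr_gt0 ltr_wpDl.
have dle x : x <= s -> d * x <= 1.
  by move=> xs; rewrite mulrC ler_pdivrMr ?ltr_wpDl// mul1r (le_trans xs)// lerDl.
pose b := 4 * nm u3 ^+ 2 + nm u2 ^+ 2.
have b0 : 0 < b by rewrite ltr_wpDl ?exprn_gt0// mulr_ge0// sqr_ge0.
(* [eta <= 1] keeps the frequency [e] at most one for [t >= 1], and [4 eta |u3|^2 <= |u2|^2] limits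
   the dissipation up to time [t] to half of the initial squared norm. *)
pose eta := nm u2 ^+ 2 / b.
have eta0 : 0 < eta by rewrite divr_gt0// exprn_gt0.
have eta1 : eta <= 1 by rewrite ler_pdivrMr// mul1r /b lerDr mulr_ge0// sqr_ge0.
have eta3 : 4 * (eta * nm u3 ^+ 2) <= nm u2 ^+ 2.
  rewrite mulrCA /eta mulrAC ler_pdivrMr// ler_wpM2l ?sqr_ge0//.
  by rewrite /b lerDl sqr_ge0.
clearbody eta.
exists (d * (eta * nm u2 / 2)); first by rewrite !mulr_gt0// invr_gt0.
move=> t t1; have t0 : 0 < t by rewrite (lt_le_trans ltr01).
pose e := Num.sqrt (eta / t).
have e0 : 0 < e by rewrite sqrtr_gt0 divr_gt0.
have e2 : e ^+ 2 = eta / t by rewrite sqr_sqrtr// ltW// divr_gt0.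
have e1 : e <= 1.
  rewrite -(@ler_sqr R) ?nnegrE ?(ltW e0)// e2 expr1n ler_pdivrMr// mul1r.
  exact: le_trans eta1 t1.
(* Each derivative of a dilated profile brings a factor [e], so [v n] of the [n]-th derivative of
   [u0] is the [n]-th derivative of [dil e u0]. *)
pose v n u : L2 R := (e ^+ n)%:C *: dil e u.
have vw n u u' : wd u u' -> wd (v n u) (v n.+1 u').
  move=> uu; have := wdZ (e ^+ n)%:C (dil_wd e0 uu).
  by rewrite scalerA -rmorphM -exprSr.
have vn n u : nm (v n u) = e ^+ n * nm u.
  by rewrite (fnormZ ipf) dil_nm// ger0_norm// exprn_ge0// ltW.
have gn n u : nm u <= s -> nm (d%:C *: v n u) <= 1.
  move=> us; rewrite (fnormZ ipf) gtr0_norm// vn; apply: le_trans (dle _ us).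
  by rewrite ler_pM2l// ler_piMl ?fnorm_ge0// exprn_ile1// (ltW e0).
exists (d%:C *: v 0%N u0), (d%:C *: v 1%N u1), (d%:C *: v 2%N u2); split.
  by split; [apply: wdZ; exact: vw|apply: wdZ; exact: vw|exact: gn..].
rewrite mkX0Z (sgZ T_sg) ?(ltW t0)// (fnormZ fX) gtr0_norm// [t * _]mulrCA ler_pM2l//.
have := sg_lower_bound m0 T_sg T_gen (ltW t0) (vw 2%N _ _ w2) (vw 3%N _ _ w3).
rewrite -!(fnorm_sqr ip0) -(nX_sqr m0) !vn.
set N := nX _ => HN; have N0 : 0 <= N by exact: fnorm_ge0.
have N1 : t * N \is Num.nneg by rewrite nnegrE mulr_ge0// ltW.
have L0 : eta * nm u2 / 2 \is Num.nneg.
  by rewrite nnegrE; apply: mulr_ge0 (mulr_ge0 (ltW eta0) (ltW c20)) _; rewrite invr_ge0.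
rewrite -(ler_sqr L0 N1) [leRHS]exprMn; have t2 : 0 < t ^+ 2 by rewrite exprn_gt0.
have te : t * e ^+ 2 = eta by rewrite e2 mulrC mulfVK ?gt_eqF.
apply: le_trans (ler_wpM2l (ltW t2) HN).
rewrite dilation_identity te; have H1 := ler_wpM2l (sqr_ge0 eta) eta3.
have H0 := mulr_ge0 (sqr_ge0 eta) (sqr_ge0 (nm u2)); rewrite !exprMn.
have -> : (2^-1 : R) ^+ 2 = 4^-1 by rewrite exprVn -natrX.
exact: (half_bound H0 H1).
Qed.

End Humps.

(* Bundling a function with its derivatives lets a single recursion build all
   three limits in [gliding_hump]. *)
Definition jet (R : realType) (g : L2 R * L2 R * L2 R) :=
  is_weak_derivative g.1.1 g.1.2 /\ is_weak_derivative g.1.2 g.2.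

Definition jet_le (R : realType) (g : L2 R * L2 R * L2 R) (a : R) :=
  [/\ fnorm (@ip R) g.1.1 <= a, fnorm (@ip R) g.1.2 <= a & fnorm (@ip R) g.2 <= a].

(** * The gliding hump *)

Section GlidingHump.
Variable R : realType.
Local Notation wd := (@is_weak_derivative R).
Local Notation nm := (fnorm (@ip R)).
Local Notation G := (L2 R * L2 R * L2 R)%type.
Let ipf := @ip_form R.
Let ip0 := @ip_ge0 R.
Implicit Types (g S : G) (u v : L2 R).

Lemma jet0 : jet (0 : G).
Proof. by split; exact: wd0. Qed.

Lemma jet_step b S g : jet S -> jet g -> jet (S + b%:C *: g).
Proof. by move=> [s1 s2] [g1 g2]; split; apply: wdD => //; exact: wdZ. Qed.

Lemma jet_leD (S g : G) a b : jet_le S a -> jet_le g b -> jet_le (S + g) (a + b).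
Proof.
by move=> [s1 s2 s3] [g1 g2 g3]; split; rewrite (le_trans (fnormD ipf ip0 _ _))// lerD.
Qed.

Lemma jet_leZ c g a : 0 <= c -> jet_le g a -> jet_le (c%:C *: g) (c * a).
Proof.
by move=> c0 [g1 g2 g3]; split; rewrite (fnormZ ipf) ger0_norm// ler_wpM2l.
Qed.

Lemma jet_leW g a b : a <= b -> jet_le g a -> jet_le g b.
Proof. by move=> ab [g1 g2 g3]; split; exact: le_trans ab. Qed.

(** In each of the three coordinates the Cauchy rate squares to that of [L2_complete]; closedness of
    the weak derivative makes the limit a jet again. *)
Lemma jet_complete (S : nat -> G) : (forall n, jet (S n)) ->
  (forall n k, jet_le (S (n + k)%N - S n) ((2^-1) ^+ n)) ->
  exists2 g, jet g & nm (g.2 - (S n).2) @[n --> \oo] --> (0 : R).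
Proof.
move=> jS cS.
have key (p : G -> L2 R) : (forall S S', p (S - S') = p S - p S') ->
    (forall g a, jet_le g a -> nm (p g) <= a) ->
    exists l, nm (p (S n) - l) @[n --> \oo] --> (0 : R).
  move=> pB pl; have [|l Hl] := @L2_complete R (fun n => p (S n)).
    move=> n k nk; rewrite -(subnKC nk) -pB -(fnorm_sqr ip0).
    have := pl _ _ (cS n (k - n)%N).
    rewrite -(@ler_sqr R) ?nnegrE ?fnorm_ge0 ?exprn_ge0 ?invr_ge0//.
    by rewrite exprAC (_ : (2^-1 : R) ^+ 2 = 4^-1)// exprVn -natrX.
  exists l; apply/cvgrPdist_le => e e0.
  have e2 : 0 < e ^+ 2 by rewrite exprn_gt0.
  have q1 : `|4^-1 : R| < 1 by rewrite ger0_norm ?invr_ge0// invf_lt1// ltr1n.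
  have /cvgrPdist_le/(_ _ e2)[N _ HN] := cvg_geometric 2 q1.
  exists N => // n /= Nn; rewrite sub0r normrN ger0_norm ?fnorm_ge0//.
  rewrite -(@ler_sqr R) ?nnegrE ?fnorm_ge0 ?(ltW e0)// (fnorm_distC ipf) (fnorm_sqr ip0).
  rewrite (le_trans (Hl n))//.
  by have := HN n Nn; rewrite /= sub0r normrN => /ler_normlP[].
have [||l0 c0] := key (fun g => g.1.1); [by []|by move=> g a []|].
have [||l1 c1] := key (fun g => g.1.2); [by []|by move=> g a []|].
have [||l2 c2] := key (fun g => g.2); [by []|by move=> g a []|].
exists (l0, l1, l2).
  by split; [apply: (wd_closed (fun n => (jS n).1) c0 c1)|
    apply: (wd_closed (fun n => (jS n).2) c1 c2)].
by under eq_fun do rewrite /= (fnorm_distC ipf).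
Qed.

Variables (L : R -> L2 R -> R) (k : R) (rho : R -> R).
Hypotheses (k0 : 0 < k)
  (L_tri : forall t u v, 0 <= t -> L t (u + v) <= L t u + L t v)
  (LN : forall t u, 0 <= t -> L t (- u) = L t u)
  (LZ : forall t c u, 0 <= t -> 0 <= c -> L t (c%:C *: u) = c * L t u)
  (L_le : forall t u, 0 <= t -> L t u <= t * nm u)
  (humps : forall t, 1 <= t -> exists g, [/\ jet g, jet_le g 1 & k <= L t g.2])
  (rho_gt0 : forall t, 0 <= t -> 0 < rho t)
  (rho_cvg : rho t @[t --> +oo] --> (0 : R))
  (L_bounded : forall g, jet g -> exists K, \forall t \near +oo, L t g.2 <= K * rho t).

(** Given the partial sum and the next weight [b], the assumed bound of [L t] on the sum by a
    multiple of [rho], which tends to zero, makes both the past and [n * rho] small against [b * k]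
    at a late time, for which [humps] still offers a profile of strength [k]. *)
Let step (x : nat * (G * R)) : exists y : R * G, jet x.2.1 -> 0 < x.2.2 ->
  [/\ x.1%:R + 1 <= y.1, jet y.2, jet_le y.2 1, k <= L y.1 y.2.2 &
    L y.1 x.2.1.2 <= x.2.2 * k / 4 /\ x.1%:R * rho y.1 <= x.2.2 * k / 4].
Proof.
case: x => n [S b] /=; have [[jS b0]|] := pselect (jet S /\ 0 < b); last first.
  (* A default outside the invariant, so that [choice] yields a total function. *)
  by move=> H; exists (0, 0) => jS b0; case: H.
have [K HK] := L_bounded jS.
have e0 : 0 < b * k / 4 / (Num.max K n%:R + 1).
  by rewrite !divr_gt0 ?mulr_gt0// ltr_wpDl// le_max ler0n orbT.
have /cvgrPdist_le/(_ _ e0) rhoe := rho_cvg.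
near (pinfty_nbhs R) => t.
have nt : n%:R + 1 <= t by near: t; exact: nbhs_pinfty_ge (num_real _).
have t1 : 1 <= t by rewrite (le_trans _ nt)// lerDr.
have t0 : 0 <= t by rewrite (le_trans ler01).
have [g [jg g1 kg]] := humps t1; exists (t, g) => _ _; split => //=.
have rt0 := rho_gt0 t0.
have rt : (Num.max K n%:R + 1) * rho t <= b * k / 4.
  rewrite mulrC -ler_pdivlMr ?ltr_wpDl ?le_max ?ler0n ?orbT//.
  have : `|0 - rho t| <= b * k / 4 / (Num.max K n%:R + 1).
    by near: t.
  by rewrite sub0r normrN => /ler_normlP[].
split; apply: le_trans rt.
  apply: (@le_trans _ _ (K * rho t)); first by near: t.
  by rewrite ler_pM2r// (@le_trans _ _ (Num.max K n%:R)) ?lerDl// le_max lexx.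
by rewrite ler_pM2r// (@le_trans _ _ (Num.max K n%:R)) ?lerDl// le_max lexx orbT.
Unshelve. all: by end_near. Qed.

(** [L t u] stands for [t |T(t)(0, u)|] and [rho] for [(t + 1) sqrt r]. At time [t n] the limit of
    the weighted sums feels hump [n] with strength at least [b n * k], the earlier ones with at most
    a quarter of this by the choice of [t n], and the later ones with at most another quarter by
    that of [b n.+1]. What is left is at least [2 n rho (t n)], against a bound [K rho (t n)]. *)
Lemma gliding_hump : False.
Proof.
have [F HF] := choice step.
(* The state is a partial sum with its next weight. Dividing the weight by 4 bounds the tails by
   [2 * b n]; the second entry of the minimum makes the tail after hump [n], multiplied by [t n], at
   most [b n * k / 4]. *)
pose fix st n : G * R := if n is n'.+1 then
    let: y := F (n', st n') in
    ((st n').1 + (st n').2%:C *: y.2,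
     Num.min ((st n').2 / 4) ((st n').2 * k / (8 * y.1)))
  else (0, 2^-1).
pose S n := (st n).1; pose b n := (st n).2.
pose t n := (F (n, st n)).1; pose g n := (F (n, st n)).2.
have inv n : jet (S n) /\ 0 < b n.
  elim: n => [|n [jS b0]]; first by split; [exact: jet0|rewrite invr_gt0].
  have [nt jg _ _ _] := HF (n, st n) jS b0.
  split; first exact: jet_step.
  have t0 : 0 < t n by rewrite (lt_le_trans _ nt)// ltr_wpDl.
  by rewrite /b /= lt_min !divr_gt0 ?mulr_gt0.
have spec n : [/\ n%:R + 1 <= t n, jet (g n), jet_le (g n) 1, k <= L (t n) (g n).2 &
    L (t n) (S n).2 <= b n * k / 4 /\ n%:R * rho (t n) <= b n * k / 4].
  by have [jS b0] := inv n; exact: (HF (n, st n)).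
have jS n : jet (S n) by have [] := inv n.
have b0 n : 0 < b n by have [] := inv n.
have t0 n : 0 < t n by have [nt _ _ _ _] := spec n; rewrite (lt_le_trans _ nt)// ltr_wpDl.
have bS n : b n.+1 <= b n / 4 by rewrite /b /= ge_min lexx.
have bt n : t n * b n.+1 <= b n * k / 8.
  have : b n.+1 <= b n * k / (8 * t n) by rewrite [b n.+1]/b /= ge_min lexx orbT.
  rewrite !ler_pdivlMr ?mulr_gt0// (_ : t n * b n.+1 * 8 = b n.+1 * (8 * t n))//.
  by rewrite (mulrC (t n)) -mulrA (mulrC 8).
have tail n j : jet_le (S (n + j)%N - S n) (2 * b n).
  elim: j n => [|j IH] n.
    rewrite addn0 subrr; have H : nm (0 : L2 R) <= 2 * b n.
      by rewrite /fnorm (form0l ipf) sqrtr0 mulr_ge0// ltW.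
    by split.
  have [_ _ g1 _ _] := spec n.
  have -> : S (n + j.+1)%N - S n = (S (n.+1 + j)%N - S n.+1) + (b n)%:C *: g n.
    by rewrite addnS -addSn [S n.+1]/S /= opprD addrA -/(S n) subrK.
  apply: jet_leW (jet_leD (IH n.+1) (jet_leZ (ltW (b0 n)) g1)).
  by have := bS n; have := b0 n; lra.
have b4 n : b n <= 2^-1 * 4^-1 ^+ n.
  elim: n => [|n IH]; first by rewrite mulr1.
  by rewrite (le_trans (bS n))// exprSr mulrA ler_wpM2r// invr_ge0.
have [|gl jl cl] := jet_complete jS.
  move=> n j; apply: jet_leW (tail n j).
  apply: (@le_trans _ _ (4^-1 ^+ n)).
    by have := b4 n; lra.
  by apply: lerXn2r; rewrite ?nnegrE ?invr_ge0// lef_pV2 ?posrE// ler_nat.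
have lim n : nm (gl.2 - (S n.+1).2) <= 2 * b n.+1.
  apply/ler_addgt0Pr => e e0; have /cvgrPdist_le/(_ _ e0)[N _ HN] := cl.
  have := HN (n.+1 + N)%N (leq_addl _ _); rewrite /= sub0r normrN ger0_norm ?fnorm_ge0//.
  have [_ _ H] := tail n.+1 N.
  have := fnormD ipf ip0 (gl.2 - (S (n.+1 + N)%N).2) ((S (n.+1 + N)%N).2 - (S n.+1).2).
  rewrite addrA subrK => H1 H2.
  by rewrite (le_trans H1)// addrC lerD.
have low n : 2 * (n%:R * rho (t n)) <= L (t n) gl.2.
  have [_ _ _ kg [LS nr]] := spec n; have tn := ltW (t0 n).
  have E : (b n)%:C *: (g n).2 = (gl.2 - (S n).2) - (gl.2 - (S n.+1).2).
    rewrite opprB addrC addrA subrK [S n.+1]/S /= -/(S n) -/(g n) -/(b n).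
    by rewrite addrC addKr.
  have H1 := L_tri (gl.2 - (S n).2) (- (gl.2 - (S n.+1).2)) tn.
  have H2 := L_tri gl.2 (- (S n).2) tn.
  rewrite -E (LZ _ tn (ltW (b0 n))) !(LN _ tn) in H1 H2.
  have H3 := L_le (gl.2 - (S n.+1).2) tn.
  have H4 := ler_wpM2l tn (lim n); have := bt n.
  have := ler_wpM2l (ltW (b0 n)) kg.
  move: H1 H2 H3 H4 LS nr; rewrite mulrCA; lra.
have [K [M [_ HM]]] := L_bounded jl.
pose n := (Num.bound (Num.max `|K| `|M|)).
have nB : Num.max `|K| `|M| < n%:R by exact: archi_boundP; rewrite le_max normr_ge0.
move: nB; rewrite gt_max => /andP[nK nM].
have [nt _ _ _ _] := spec n.
have := HM (t n); have := low n.
have rt := rho_gt0 (ltW (t0 n)).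
have Mt : M < t n.
  by rewrite (le_lt_trans (ler_norm M))// (lt_le_trans nM)// (le_trans _ nt)// lerDl.
move=> H1 /(_ Mt) H2; have := le_trans H1 H2; rewrite mulrA ler_pM2r//.
by have := ler_norm K; have := normr_ge0 K; lra.
Qed.

End GlidingHump.

(** * Transfer to the energy *)

Section Energy.
Variables (R : realType) (m : R) (T : R -> KG_space R -> KG_space R).
Hypothesis m0 : 0 < m.
Local Notation nX := (fnorm (ipX m)).
Local Notation D := (@KG_dom R).
Local Notation A := (KG_op m).
Hypotheses (T_sg : contraction_C0_semigroup nX T) (T_gen : generator_of nX T D A).
Let fX := @ipX_form R m.
Let X0 := ipX_ge0 m0.

Lemma KG_energyE z t : KG_energy m T z t = 2^-1 * nX (T t z) ^+ 2.
Proof. by rewrite /KG_energy KG_normE. Qed.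

Lemma KG_energy_ge0 z t : 0 <= KG_energy m T z t.
Proof. by rewrite KG_energyE mulr_ge0 ?invr_ge0// sqr_ge0. Qed.

Lemma energy_cvg0 z : KG_energy m T z t @[t --> +oo] --> (0 : R).
Proof.
have H := sg_strongly_stable m0 T_sg T_gen z.
have -> : KG_energy m T z = (fun t => 2^-1 * nX (T t z) ^+ 2).
  by apply/funext => t; rewrite KG_energyE.
have -> : (0 : R) = 2^-1 * (0 * 0) by rewrite !mulr0.
by apply: cvgM; [exact: cvg_cst|exact: cvgM].
Qed.

Lemma energy_decay (a : R[i]) z : a ^+ 2 = (- m)%:C ->
  resolvent_range D A a z -> resolvent_range D A (- a) z ->
  KG_energy m T z =O_+oo (fun t : R => t ^- 2).
Proof.
move=> a2 Ra Rna; have [q1 [q2 [w1 w2]]] := Ran_pm_wd2 m0 a2 Ra Rna.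
have [K K0 HK] := sg_inverse_decay m0 T_sg T_gen w1 w2.
(* The estimate at [t/2 + t/2] gives [t^2 |T(t) z|^2 <= 4 K^2], and the energy carries a factor one
   half; adding one makes the constant positive. *)
apply/eqO_exP; exists (2 * K ^+ 2 + 1); first by rewrite ltr_wpDl// mulr_ge0// sqr_ge0.
near=> t; have t0 : 0 < t by near: t; exact: nbhs_pinfty_gt (num_real _).
rewrite ger0_norm ?KG_energy_ge0// ger0_norm ?invr_ge0 ?sqr_ge0// KG_energyE.
have := HK (t / 2) (divr_ge0 (ltW t0) (ler0n _ 2)); rewrite -splitr => H.
have {}H : t * nX (T t z) <= 2 * K.
  by move: H; rewrite mulrAC ler_pdivrMr// mulrC (mulrC K).
have n0 : 0 <= nX (T t z) by exact: fnorm_ge0.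
have : (t * nX (T t z)) ^+ 2 <= (2 * K) ^+ 2.
  by rewrite ler_sqr ?nnegrE ?mulr_ge0 ?(ltW t0).
rewrite !exprMn ler_pdivlMr ?exprn_gt0// => {}H.
by rewrite -mulrA (mulrC _ (t ^+ 2)); have := sqr_ge0 K; lra.
Unshelve. all: by end_near. Qed.

(** By contradiction: if the energies of all data [(0, g'')] were [O(r)], then [t |T(t)(0, g'')|]
    would be bounded by a multiple of [rho], which tends to zero, and [gliding_hump] excludes this.
    [P] stands for membership in both ranges. *)
Lemma slow_solutions (P : KG_space R -> Prop) (r : R -> R) :
  (forall g, jet g -> P (mkX 0 g.2)) ->
  (forall t, 0 <= t -> 0 < r t) -> r =o_+oo (fun t : R => t ^- 2) ->
  exists2 z, P z & ~ (KG_energy m T z =O_+oo r).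
Proof.
move=> HP r0 ro; apply: contrapT => Hn.
have HO g : jet g -> KG_energy m T (mkX 0 g.2) =O_+oo r.
  by move=> jg; apply: contrapT => HO; apply: Hn; exists (mkX 0 g.2) => //; exact: HP.
have [k k0 humps] := slow_data m0 T_sg T_gen.
(* The factor [t + 1] keeps [rho] positive at [t = 0]; it is at most [2 t] once [t >= 1]. *)
pose rho t := (t + 1) * Num.sqrt (r t).
apply: (@gliding_hump R (fun t u => t * nX (T t (mkX 0 u))) k rho k0).
- move=> t u v t0; rewrite -mulrDr ler_wpM2l//.
  have := mkX0_lin 1 u v; rewrite !scale1r => ->.
  by rewrite (sgD T_sg)//; exact: fnormD fX X0 _ _.
- move=> t u t0; rewrite -scaleN1r mkX0Z (sgZ T_sg)// scaleN1r.
  by rewrite (fnormN fX).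
- by move=> t c u t0 c0; rewrite mkX0Z (sgZ T_sg)// (fnormZ fX) ger0_norm// mulrCA.
- by move=> t u t0; rewrite ler_wpM2l// -(nX_mkX0 m) (sg_contr T_sg).
- move=> t t1; have [g [g' [g'' [[w1 w2 n1 n2 n3] H]]]] := humps t t1.
  by exists (g, g', g'').
- by move=> t t0; rewrite mulr_gt0 ?ltr_wpDl// sqrtr_gt0 r0.
- apply/cvgrPdist_le => e e0; near=> t.
  have t1 : 1 <= t by near: t; exact: nbhs_pinfty_ge (num_real _).
  have t0 : 0 < t by rewrite (lt_le_trans ltr01).
  have rt : `|r t| <= (e / 2) ^+ 2 * `|t ^- 2|.
    by near: t; move/eqoP: ro; apply; rewrite exprn_gt0// divr_gt0.
  have s0 : 0 <= Num.sqrt (r t) by exact: sqrtr_ge0.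
  rewrite sub0r normrN ger0_norm ?mulr_ge0 ?addr_ge0 ?(ltW t0)//.
  have : t * Num.sqrt (r t) <= e / 2.
    rewrite -(@ler_sqr R) ?nnegrE ?mulr_ge0 ?divr_ge0 ?(ltW t0) ?(ltW e0)//.
    rewrite exprMn sqr_sqrtr ?(ltW (r0 _ (ltW t0)))// mulrC -ler_pdivlMr ?exprn_gt0//.
    by rewrite (le_trans (ler_norm _))// (le_trans rt)// ger0_norm ?invr_ge0 ?sqr_ge0.
  have := ler_wpM2r s0 t1; rewrite /rho mul1r mulrDl mul1r; lra.
- move=> g /HO /eqO_exP[K K0 HK]; exists (Num.sqrt (2 * K)); near=> t.
  have t0 : 0 < t by near: t; exact: nbhs_pinfty_gt (num_real _).
  have rt := r0 _ (ltW t0).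
  have : `|KG_energy m T (mkX 0 g.2) t| <= K * `|r t| by near: t.
  rewrite ger0_norm ?KG_energy_ge0// (gtr0_norm rt) KG_energyE => H.
  have r2 : 0 <= 2 * K * r t by rewrite mulr_ge0 ?mulr_ge0 ?(ltW K0) ?(ltW rt).
  rewrite mulrCA -sqrtrM ?mulr_ge0 ?(ltW K0)//.
  apply: ler_pM; rewrite ?fnorm_ge0 ?(ltW t0) ?lerDl//.
  rewrite -(@ler_sqr R) ?nnegrE ?fnorm_ge0 ?sqrtr_ge0// (sqr_sqrtr r2).
  by rewrite -mulrA; lra.
Unshelve. all: by end_near. Qed.

End Energy.

Theorem theorem4p1 (R : realType) (m : R) (m_gt0 : 0 < m)
    (T : R -> KG_space R -> KG_space R)
    (T_semigroup : contraction_C0_semigroup (KG_norm m) T)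
    (T_generator : generator_of (KG_norm m) T (@KG_dom R) (KG_op m)) :
  let Ran := resolvent_range (@KG_dom R) (KG_op m) in
  let Ran_pm := Ran ((Num.sqrt m)*i) `&` Ran (- (Num.sqrt m)*i) in
  [/\ forall z0 : KG_space R, KG_energy m T z0 t @[t --> +oo] --> 0,
      forall z0 : KG_space R, Ran_pm z0 ->
        KG_energy m T z0 =O_+oo (fun t : R => t ^- 2) &
      forall r : R -> R, (forall t, 0 <= t -> 0 < r t) ->
        r =o_+oo (fun t : R => t ^- 2) ->
        exists2 z0 : KG_space R, Ran_pm z0 & ~ (KG_energy m T z0 =O_+oo r)].
Proof.
have nE : KG_norm m = fnorm (ipX m) by apply/funext => z; exact: KG_normE.
rewrite nE in T_semigroup T_generator => Ran Ran_pm.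
have a2 : ((Num.sqrt m)*i) ^+ 2 = (- m)%:C.
  by rewrite expr2; simpc; rewrite -expr2 sqr_sqrtr// ltW.
split.
- by move=> z0; exact: (energy_cvg0 m_gt0 T_semigroup T_generator).
- move=> z0 [R1 R2].
  exact: (energy_decay m_gt0 T_semigroup T_generator a2 R1 R2).
- move=> r r0 ro; apply: (slow_solutions m_gt0 T_semigroup T_generator) => // g [w1 w2].
  split; first exact: (Ran_mkX m_gt0 a2 w1 w2).
  by apply: (Ran_mkX m_gt0 _ w1 w2); rewrite sqrrN.
Qed.
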